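(* Let $\mathcal{C}$ be a modular tensor category with braiding $\sigma$, and let $g\in\mathcal{C}$ be an invertible object of order $M$. Let $q$ be the unique eigenvalue of $\sigma_{g,g}$, i.e. $\sigma_{g,g}=q\,\mathrm{id}_{g\otimes g}$, let $|q^2|$ denote the multiplicative order of $q^2$ (which divides $M$), put $A:=\frac{M}{|q^2|}$, and fix a primitive $M$-th root of unity $\zeta_M$ such that $\zeta_M^{A}=q^2$. Suppose that $A+1=\frac{M}{|q^2|}+1$ is coprime to $M$. Then: (1) There exists a monoidal auto-equivalence $\mathcal{F}_{(g,\zeta_M)}$ of $\mathcal{C}$ defined on objects by $$\mathcal{F}_{(g,\zeta_M)}(X):=g^{n}\otimes X,$$ where $n$ is such that $\zeta_M^{n}$ is the unique eigenvalue of the double braiding $\sigma_{g,X}\circ\sigma_{X,g}$ (for $X$ simple, or more generally $X\in\mathcal{C}_n$, extended additively to all of $\mathcal{C}$), with the monoidal structure maps $\tau$ described in the context. (2) The monoidal auto-equivalence $\mathcal{F}_{(g,\zeta_M)}$ is braided if and only if one of the following holds: (a) $M=1$, $q=1$, $\zeta_1=1$; (b) $M=2$, $q=-1$, $\zeta_2=-1$; (c) $M=3$, $q=e^{\pm 2\pi i/3}$, $\zeta_3=e^{\mp 2\pi i/3}$ (with corresponding signs); (d) $M=4$, $q=\pm i$, $\zeta_4=\mp i$ (with corresponding signs). (3) The monoidal auto-equivalence $\mathcal{F}_{(g,\zeta_M)}$ is pivotal if and only if the categorical dimension of $g$ is $1$.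
   Context: All categories are over $\mathbb{C}$; associators of $\mathcal{C}$ are suppressed (i.e. $\mathcal{C}$ is treated as strict). **Modular tensor category.** A fusion category is pivotal if it is equipped with natural isomorphisms $\psi_X:X\to X^{**}$ forming a monoidal natural isomorphism $\mathrm{Id}\to( ** )$. The symmetric centre of a braided fusion category $\mathcal{B}$ with braiding $\sigma_{X,Y}:X\otimes Y\to Y\otimes X$ is $\{X\in\mathcal{B}:\sigma_{X,Y}\circ\sigma_{Y,X}=\mathrm{id}\text{ for all }Y\in\mathcal{B}\}$. A modular tensor category is a pivotal braided fusion category whose symmetric centre is trivial (only multiples of the unit $\mathbf 1$). The categorical dimension of an object is its dimension computed with respect to the pivotal structure $\psi$. **Order, and the number $q$.** An invertible object $g$ has order $M$ if $M\ge1$ is minimal with $g^{\otimes M}\cong\mathbf 1$. It is known that $\sigma_{g,g}=q\,\mathrm{id}_{g\otimes g}$ with $q$ a $2M$-th root of unity if $M$ is even and an $M$-th root of unity if $M$ is odd, so $q^2$ is always an $M$-th root of unity. **Grading.** For $m\in\mathbb{Z}/M\mathbb{Z}$ let $\mathcal{C}_m$ be the full abelian subcategory of objects $X$ for which the double braiding of $g$ with $X$ equals $\zeta_M^m$ times the identity. Then $\mathcal{C}=\bigoplus_{m\in\mathbb{Z}/M\mathbb{Z}}\mathcal{C}_m$ is a grading by $\mathbb{Z}/M\mathbb{Z}$. Write $X_m$ for an object of $\mathcal{C}_m$. Classes in $\mathbb{Z}/M\mathbb{Z}$ are represented by $0,\dots,M-1$, and $g^m:=g^{\otimes m}$ for such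 a representative ($g^0=\mathbf 1$). **The functor.** $\mathcal{F}_{(g,\zeta_M)}(X_m):=g^m\otimes X_m$ for $X_m\in\mathcal{C}_m$, acting on morphisms of $\mathcal{C}_m$ by $f\mapsto\mathrm{id}_{g^m}\otimes f$, extended additively to $\mathcal{C}$. **Monoidal structure maps.** When $A+1$ is coprime to $M$, one can choose basis elements $v_{m,n}$ of the one-dimensional spaces $\mathrm{Hom}(g^m\otimes g^n,g^{m+n})$ (indices mod $M$) such that $$v_{m+n,p}\circ(v_{m,n}\otimes\mathrm{id}_{g^p})=v_{m,n+p}\circ(\mathrm{id}_{g^m}\otimes v_{n,p}),\qquad v_{n,m}\circ\sigma_{g^m,g^n}=q^{mn}\,v_{m,n}$$ for all $m,n,p$. Fix such a choice. The structure maps $\tau_{X_m,Y_n}:\mathcal{F}_{(g,\zeta_M)}(X_m)\otimes\mathcal{F}_{(g,\zeta_M)}(Y_n)\to\mathcal{F}_{(g,\zeta_M)}(X_m\otimes Y_n)$ are $$\tau_{X_m,Y_n}:=(v_{m,n}\otimes\mathrm{id}_{X_m\otimes Y_n})\circ(\mathrm{id}_{g^m}\otimes\sigma_{X_m,g^n}\otimes\mathrm{id}_{Y_n}).$$ (Using the reversed crossing $\sigma_{g^n,X_m}^{-1}$ in place of $\sigma_{X_m,g^n}$ gives a naturally isomorphic monoidal auto-equivalence.) **Monoidal, braided and pivotal auto-equivalences.** A monoidal auto-equivalence is an abelian auto-equivalence $\mathcal{F}$ together with natural isomorphisms $\tau_{X,Y}:\mathcal{F}(X)\otimes\mathcal{F}(Y)\to\mathcal{F}(X\otimes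 Y)$ satisfying the usual coherence (hexagon) equation with the associators. It is braided if $\mathcal{F}(\sigma_{X,Y})\circ\tau_{X,Y}=\tau_{Y,X}\circ\sigma_{\mathcal{F}(X),\mathcal{F}(Y)}$ for all $X,Y$. It is pivotal if $\delta_{X^*}\circ\mathcal{F}(\psi_X)=\delta_X^*\circ\psi_{\mathcal{F}(X)}$ for all $X$, where $\delta_X:\mathcal{F}(X^* )\to\mathcal{F}(X)^*$ is $$\delta_X:=\big((\mathcal{F}(\mathrm{ev}_X)\circ\tau_{X^*,X})\otimes\mathrm{id}_{\mathcal{F}(X)^*}\big)\circ(\mathrm{id}_{\mathcal{F}(X^* )}\otimes\mathrm{coev}_{\mathcal{F}(X)}).$$ *)

(* Defs.v *)
From mathcomp Require Import all_boot all_order all_algebra.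
From mathcomp Require Import complex.

Set Implicit Arguments.
Unset Strict Implicit.
Unset Printing Implicit Defensive.

Import GRing.Theory.
Local Open Scope ring_scope.

Declare Scope tcat_scope.
Delimit Scope tcat_scope with tcat.
Local Open Scope tcat_scope.

Reserved Notation "f ∘ g" (at level 40, left associativity).
Reserved Notation "X ⊗ Y" (at level 35, right associativity).
Reserved Notation "f ⊠ g" (at level 35, right associativity).
Reserved Notation "X ≅ Y" (at level 70, no associativity).

Record linCategory (K : fieldType) := LinCategory {
  obj :> Type;
  hom : obj -> obj -> vectType K;
  idm : forall X, hom X X;
  comp : forall X Y Z, hom Y Z -> hom X Y -> hom X Z;
  comp1m : forall X Y (f : hom X Y), comp (idm Y) f = f;
  compm1 : forall X Y (f : hom X Y), comp f (idm X) = f;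
  compA : forall X Y Z W (h : hom Z W) (g : hom Y Z) (f : hom X Y),
    comp h (comp g f) = comp (comp h g) f;
  comp_linr : forall X Y Z (g : hom Y Z), linear (fun f : hom X Y => comp g f);
  comp_linl : forall X Y Z (f : hom X Y), linear (fun g : hom Y Z => comp g f)
}.
Arguments hom {K C} X Y : rename.
Arguments idm {K C} X : rename.
Arguments comp {K C X Y Z} g f : rename.

Notation "g ∘ f" := (comp g f) : tcat_scope.

Section LinearNotions.
Variables (K : fieldType) (C : linCategory K).
Implicit Types X Y Z W : C.

Definition inverse_of X Y (f : hom X Y) (f' : hom Y X) : Prop :=
  f' ∘ f = idm X /\ f ∘ f' = idm Y.

Definition is_iso X Y (f : hom X Y) : Prop := exists f', inverse_of f f'.

Definition isomorphic X Y : Prop := exists f : hom X Y, is_iso f.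

Definition mono X Y (f : hom X Y) : Prop :=
  forall W (a b : hom W X), f ∘ a = f ∘ b -> a = b.

Definition epi X Y (f : hom X Y) : Prop :=
  forall W (a b : hom Y W), a ∘ f = b ∘ f -> a = b.

Definition is_kernel X Y (f : hom X Y) N (k : hom N X) : Prop :=
  f ∘ k = 0 /\
  forall W (a : hom W X), f ∘ a = 0 -> exists! b : hom W N, k ∘ b = a.

Definition is_cokernel X Y (f : hom X Y) N (c : hom Y N) : Prop :=
  c ∘ f = 0 /\
  forall W (a : hom Y W), a ∘ f = 0 -> exists! b : hom N W, b ∘ c = a.

(* For n = 0 this says that S is a zero object. *)
Definition is_direct_sum n (Xs : 'I_n -> C) (S : C)
    (inj : forall i, hom (Xs i) S) (proj : forall i, hom S (Xs i)) : Prop :=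
  [/\ forall i, proj i ∘ inj i = idm (Xs i),
      forall i j, i != j -> proj i ∘ inj j = 0
    & \sum_(i < n) inj i ∘ proj i = idm S].

Definition simple X : Prop :=
  idm X <> 0 /\ forall Y (f : hom Y X), mono f -> f = 0 \/ is_iso f.

End LinearNotions.

Notation "X ≅ Y" := (isomorphic X Y) : tcat_scope.

(* Finite direct sums (including the zero object, as the empty sum) are part of
   the structure; kernels and cokernels are only required to exist. *)
Record abelianCategory (K : fieldType) := AbelianCategory {
  ab_lin :> linCategory K;
  dsum : forall n, ('I_n -> ab_lin) -> ab_lin;
  dinj : forall n (Xs : 'I_n -> ab_lin) i, hom (Xs i) (dsum Xs);
  dproj : forall n (Xs : 'I_n -> ab_lin) i, hom (dsum Xs) (Xs i);
  dsumP : forall n (Xs : 'I_n -> ab_lin),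
    is_direct_sum (@dinj n Xs) (@dproj n Xs);
  has_kernels : forall (X Y : ab_lin) (f : hom X Y),
    exists N (k : hom N X), is_kernel f k;
  has_cokernels : forall (X Y : ab_lin) (f : hom X Y),
    exists N (c : hom Y N), is_cokernel f c;
  mono_normal : forall (X Y : ab_lin) (f : hom X Y), mono f ->
    exists Z (h : hom Y Z), is_kernel h f;
  epi_normal : forall (X Y : ab_lin) (f : hom X Y), epi f ->
    exists Z (h : hom Z X), is_cokernel h f
}.
Arguments dsum {K C n} Xs : rename.
Arguments dinj {K C n} Xs i : rename.
Arguments dproj {K C n} Xs i : rename.

(* Associators and unitors are explicit, so no equation between objects is ever
   needed; alphai, lambdai, rhoi are the inverses of alpha, lambda, rho. *)
Record monoidalCategory (K : fieldType) := MonoidalCategory {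
  mon_ab :> abelianCategory K;
  one : mon_ab;
  tens : mon_ab -> mon_ab -> mon_ab;
  tensm : forall X X' Y Y' : mon_ab,
    hom X X' -> hom Y Y' -> hom (tens X Y) (tens X' Y');
  alpha : forall X Y Z, hom (tens (tens X Y) Z) (tens X (tens Y Z));
  alphai : forall X Y Z, hom (tens X (tens Y Z)) (tens (tens X Y) Z);
  lambda : forall X, hom (tens one X) X;
  lambdai : forall X, hom X (tens one X);
  rho : forall X, hom (tens X one) X;
  rhoi : forall X, hom X (tens X one);
  tensm1 : forall X Y, tensm (idm X) (idm Y) = idm (tens X Y);
  tensm_comp : forall (X X' X'' Y Y' Y'' : mon_ab)
    (f' : hom X' X'') (f : hom X X') (h' : hom Y' Y'') (h : hom Y Y'),
    tensm (f' ∘ f) (h' ∘ h) = tensm f' h' ∘ tensm f h;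
  tensm_linl : forall (X X' Y Y' : mon_ab) (h : hom Y Y'),
    linear (fun f : hom X X' => tensm f h);
  tensm_linr : forall (X X' Y Y' : mon_ab) (f : hom X X'),
    linear (fun h : hom Y Y' => tensm f h);
  alpha_nat : forall (X X' Y Y' Z Z' : mon_ab)
    (f : hom X X') (h : hom Y Y') (k : hom Z Z'),
    alpha X' Y' Z' ∘ tensm (tensm f h) k = tensm f (tensm h k) ∘ alpha X Y Z;
  lambda_nat : forall (X X' : mon_ab) (f : hom X X'),
    lambda X' ∘ tensm (idm one) f = f ∘ lambda X;
  rho_nat : forall (X X' : mon_ab) (f : hom X X'),
    rho X' ∘ tensm f (idm one) = f ∘ rho X;
  alpha_iso : forall X Y Z, inverse_of (alpha X Y Z) (alphai X Y Z);
  lambda_iso : forall X, inverse_of (lambda X) (lambdai X);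
  rho_iso : forall X, inverse_of (rho X) (rhoi X);
  pentagon : forall X Y Z W,
    alpha X Y (tens Z W) ∘ alpha (tens X Y) Z W =
    tensm (idm X) (alpha Y Z W) ∘ alpha X (tens Y Z) W
      ∘ tensm (alpha X Y Z) (idm W);
  triangle : forall X Y,
    tensm (idm X) (lambda Y) ∘ alpha X one Y = tensm (rho X) (idm Y)
}.
Arguments one {K C} : rename.
Arguments tens {K C} X Y : rename.
Arguments tensm {K C X X' Y Y'} f h : rename.
Arguments alpha {K C} X Y Z : rename.
Arguments alphai {K C} X Y Z : rename.
Arguments lambda {K C} X : rename.
Arguments lambdai {K C} X : rename.
Arguments rho {K C} X : rename.
Arguments rhoi {K C} X : rename.

Notation "X ⊗ Y" := (tens X Y) : tcat_scope.
Notation "f ⊠ h" := (tensm f h) : tcat_scope.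

Definition dual_pair (K : fieldType) (C : monoidalCategory K) (X D : C)
    (ev : hom (D ⊗ X) one) (coev : hom one (X ⊗ D)) : Prop :=
  rho X ∘ (idm X ⊠ ev) ∘ alpha X D X ∘ (coev ⊠ idm X) = lambda X /\
  lambda D ∘ (ev ⊠ idm D) ∘ alphai D X D ∘ (idm D ⊠ coev) = rho D.

Record fusionCategory (K : fieldType) := FusionCategory {
  fus_mon :> monoidalCategory K;
  dual : fus_mon -> fus_mon;
  ev : forall X, hom (dual X ⊗ X) one;
  coev : forall X, hom one (X ⊗ dual X);
  dualP : forall X, dual_pair (ev X) (coev X);
  has_right_dual : forall X : fus_mon,
    exists D (ev' : hom (X ⊗ D) one) (coev' : hom one (D ⊗ X)),
      dual_pair ev' coev';
  semisimple : forall X : fus_mon,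
    exists n (Ss : 'I_n -> fus_mon), (forall i, simple (Ss i)) /\ X ≅ dsum Ss;
  finitely_many_simples : exists n (Ss : 'I_n -> fus_mon),
    forall X : fus_mon, simple X -> exists i, X ≅ Ss i;
  end_one : \dim {: hom (@one K fus_mon) one} = 1%N
}.
Arguments dual {K C} X : rename.
Arguments ev {K C} X : rename.
Arguments coev {K C} X : rename.

Section FusionNotions.
Variables (K : fieldType) (C : fusionCategory K).
Implicit Types X Y Z : C.

(* (p ⊗ id_{X^*}) ∘ (id_Z ⊗ coev_X) *)
Definition curry_dual Z X (p : hom (Z ⊗ X) one) : hom Z (dual X) :=
  lambda (dual X) ∘ (p ⊠ idm (dual X)) ∘ alphai Z X (dual X)
    ∘ (idm Z ⊠ coev X) ∘ rhoi Z.

Definition dualm X Y (f : hom X Y) : hom (dual Y) (dual X) :=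
  curry_dual (ev Y ∘ (idm (dual Y) ⊠ f)).

(* the canonical isomorphism Y^* ⊗ X^* -> (X ⊗ Y)^* *)
Definition dual_tens X Y : hom (dual Y ⊗ dual X) (dual (X ⊗ Y)) :=
  curry_dual
    (ev Y ∘ (idm (dual Y) ⊠ lambda Y)
       ∘ (idm (dual Y) ⊠ (ev X ⊠ idm Y))
       ∘ (idm (dual Y) ⊠ alphai (dual X) X Y)
       ∘ alpha (dual Y) (dual X) (X ⊗ Y)).

Fixpoint tpow (g : C) (n : nat) : C :=
  if n is n'.+1 then g ⊗ tpow g n' else one.

Definition invertible (g : C) : Prop :=
  exists h : C, g ⊗ h ≅ one /\ h ⊗ g ≅ one.

Definition has_order (g : C) (M : nat) : Prop :=
  [/\ (0 < M)%N, tpow g M ≅ one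
    & forall k, (0 < k < M)%N -> ~ (tpow g k ≅ one)].

End FusionNotions.

Record braidedFusionCategory (K : fieldType) := BraidedFusionCategory {
  br_fus :> fusionCategory K;
  braid : forall X Y : br_fus, hom (X ⊗ Y) (Y ⊗ X);
  braid_iso : forall X Y, is_iso (braid X Y);
  braid_nat : forall (X X' Y Y' : br_fus) (f : hom X X') (h : hom Y Y'),
    braid X' Y' ∘ (f ⊠ h) = (h ⊠ f) ∘ braid X Y;
  braid_hexagon1 : forall X Y Z,
    alpha Y Z X ∘ braid X (Y ⊗ Z) ∘ alpha X Y Z =
    (idm Y ⊠ braid X Z) ∘ alpha Y X Z ∘ (braid X Y ⊠ idm Z);
  braid_hexagon2 : forall X Y Z,
    alphai Z X Y ∘ braid (X ⊗ Y) Z ∘ alphai X Y Z =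
    (braid X Z ⊠ idm Y) ∘ alphai X Z Y ∘ (idm X ⊠ braid Y Z)
}.
Arguments braid {K C} X Y : rename.

(* psi_tens says that psi is monoidal, the monoidal structure of the double dual
   functor being the inverse of dualm (dual_tens X Y) composed with
   dual_tens (dual Y) (dual X).  Compatibility of psi with the unit follows. *)
Record modularCategory (K : fieldType) := ModularCategory {
  mod_br :> braidedFusionCategory K;
  psi : forall X : mod_br, hom X (dual (dual X));
  psi_iso : forall X, is_iso (psi X);
  psi_nat : forall (X Y : mod_br) (f : hom X Y),
    psi Y ∘ f = dualm (dualm f) ∘ psi X;
  psi_tens : forall X Y : mod_br,
    dualm (dual_tens X Y) ∘ psi (X ⊗ Y) =
    dual_tens (dual Y) (dual X) ∘ (psi X ⊠ psi Y);
  trivial_centre : forall X : mod_br,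
    (forall Y, braid Y X ∘ braid X Y = idm (X ⊗ Y)) ->
    exists n, X ≅ dsum (fun _ : 'I_n => one)
}.
Arguments psi {K C} X : rename.

(* dim X = d, where the scalar d is read in End(1). *)
Definition has_dim (K : fieldType) (C : modularCategory K) (X : C) (d : K) :=
  ev (dual X) ∘ (psi X ⊠ idm (dual X)) ∘ coev X = d *: idm one.

Record functor_data (K : fieldType) (C D : linCategory K) := FunctorData {
  fobj :> C -> D;
  fmor : forall X Y, hom X Y -> hom (fobj X) (fobj Y)
}.
Arguments fmor {K C D} F {X Y} f : rename.

Section Functors.
Variable K : fieldType.

Definition is_linear_functor (C D : linCategory K) (F : functor_data C D) :=
  [/\ forall X, fmor F (idm X) = idm (F X),
      forall X Y Z (h : hom Y Z) (f : hom X Y),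
        fmor F (h ∘ f) = fmor F h ∘ fmor F f
    & forall X Y, linear (fun f : hom X Y => fmor F f)].

Definition is_linear_equivalence (C D : linCategory K) (F : functor_data C D) :=
  is_linear_functor F /\
  exists G : functor_data D C, is_linear_functor G /\
    (exists eta : forall X, hom X (G (F X)),
       (forall X, is_iso (eta X)) /\
       forall X Y (f : hom X Y), eta Y ∘ f = fmor G (fmor F f) ∘ eta X) /\
    (exists eps : forall X, hom (F (G X)) X,
       (forall X, is_iso (eps X)) /\
       forall X Y (f : hom X Y), eps Y ∘ fmor F (fmor G f) = f ∘ eps X).

Definition tensor_structure (C : monoidalCategory K) (F : functor_data C C) :=
  forall X Y : C, hom (F X ⊗ F Y) (F (X ⊗ Y)).

Definition monoidal_autoequivalence (C : monoidalCategory K)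
    (F : functor_data C C) (tau : tensor_structure F) : Prop :=
  [/\ is_linear_equivalence F,
      forall X Y, is_iso (tau X Y),
      forall X X' Y Y' (f : hom X X') (h : hom Y Y'),
        fmor F (f ⊠ h) ∘ tau X Y = tau X' Y' ∘ (fmor F f ⊠ fmor F h)
    & forall X Y Z,
        fmor F (alpha X Y Z) ∘ tau (X ⊗ Y) Z ∘ (tau X Y ⊠ idm (F Z)) =
        tau X (Y ⊗ Z) ∘ (idm (F X) ⊠ tau Y Z) ∘ alpha (F X) (F Y) (F Z)].

Definition braided_functor (C : braidedFusionCategory K)
    (F : functor_data C C) (tau : tensor_structure F) : Prop :=
  forall X Y,
    fmor F (braid X Y) ∘ tau X Y = tau Y X ∘ braid (F X) (F Y).

(* the identification of F(1) with 1 determined by tau *)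
Definition unit_constraint (C : monoidalCategory K)
    (F : functor_data C C) (tau : tensor_structure F) (u : hom (F one) one) :=
  [/\ is_iso u,
      forall X, fmor F (lambda X) ∘ tau one X = lambda (F X) ∘ (u ⊠ idm (F X))
    & forall X, fmor F (rho X) ∘ tau X one = rho (F X) ∘ (idm (F X) ⊠ u)].

Definition delta (C : fusionCategory K) (F : functor_data C C)
    (tau : tensor_structure F) (u : hom (F one) one) (X : C) :
    hom (F (dual X)) (dual (F X)) :=
  curry_dual (u ∘ fmor F (ev X) ∘ tau (dual X) X).

Definition pivotal_functor (C : modularCategory K)
    (F : functor_data C C) (tau : tensor_structure F) : Prop :=
  exists u : hom (F one) one, unit_constraint tau u /\
    forall X, delta tau u (dual X) ∘ fmor F (psi X) =
              dualm (delta tau u X) ∘ psi (F X).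

End Functors.

Section SimpleCurrent.
Variables (K : fieldType) (C : modularCategory K) (g : C) (M : nat) (zeta : K).
Implicit Types X Y : C.

(* X is in C_m *)
Definition in_degree (m : nat) X : Prop :=
  braid g X ∘ braid X g = zeta ^+ m *: idm (X ⊗ g).

(* A choice, for every X, of a decomposition X = ⊕_m X_m with X_m in C_m. *)
Record grading := Grading {
  hcomp : C -> 'I_M -> C;
  hinj : forall X m, hom (hcomp X m) X;
  hproj : forall X m, hom X (hcomp X m);
  hcomp_degree : forall X (m : 'I_M), in_degree m (hcomp X m);
  hcomp_sum : forall X, is_direct_sum (hinj X) (hproj X)
}.

(* v m n k is only meaningful when k = m + n in Z/M; taking k as a separate index
   avoids casts along equalities such as (m + n) + p = m + (n + p) in Z/M. *)
Definition fusion_maps :=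
  forall m n k : 'I_M, hom (tpow g m ⊗ tpow g n) (tpow g k).

Definition is_add (m n k : 'I_M) : bool := (k == (m + n) %% M :> nat)%N.

(* Hom(g^m ⊗ g^n, g^{m+n}) being a line, its bases are its nonzero elements. *)
Definition admissible (q : K) (v : fusion_maps) : Prop :=
  [/\ forall m n k, is_add m n k -> v m n k <> 0,
      forall m n p mn np k,
        is_add m n mn -> is_add n p np -> is_add mn p k ->
        v mn p k ∘ (v m n mn ⊠ idm (tpow g p)) =
        v m np k ∘ (idm (tpow g m) ⊠ v n p np)
          ∘ alpha (tpow g m) (tpow g n) (tpow g p)
    & forall m n k, is_add m n k ->
        v n m k ∘ braid (tpow g m) (tpow g n) = q ^+ (m * n) *: v m n k].

(* (v_{m,n} ⊗ id_{X ⊗ Y}) ∘ (id_{g^m} ⊗ sigma_{X, g^n} ⊗ id_Y), for X in C_m and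
   Y in C_n *)
Definition tau_hom (v : fusion_maps) (m n k : 'I_M) X Y :
    hom ((tpow g m ⊗ X) ⊗ (tpow g n ⊗ Y)) (tpow g k ⊗ (X ⊗ Y)) :=
  (v m n k ⊠ idm (X ⊗ Y))
    ∘ alphai (tpow g m) (tpow g n) (X ⊗ Y)
    ∘ (idm (tpow g m) ⊠
         (alpha (tpow g n) X Y ∘ (braid X (tpow g n) ⊠ idm Y)
            ∘ alphai X (tpow g n) Y))
    ∘ alpha (tpow g m) X (tpow g n ⊗ Y).

Section Functor.
Variable D : grading.

Definition shift_summand X (m : 'I_M) : C := tpow g m ⊗ hcomp D X m.

(* X |-> ⊕_m g^m ⊗ X_m *)
Definition shift : functor_data C C :=
  FunctorData (fobj := fun X => dsum (shift_summand X))
    (fun X Y f => \sum_(m < M)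
       dinj (shift_summand Y) m
         ∘ (idm (tpow g m) ⊠ (hproj D Y m ∘ f ∘ hinj D X m))
         ∘ dproj (shift_summand X) m).

Definition shift_tau (v : fusion_maps) : tensor_structure shift :=
  fun X Y => \sum_(m < M) \sum_(n < M) \sum_(k < M | is_add m n k)
    dinj (shift_summand (X ⊗ Y)) k
      ∘ (idm (tpow g k) ⊠
           (hproj D (X ⊗ Y) k ∘ (hinj D X m ⊠ hinj D Y n)))
      ∘ tau_hom v m n k (hcomp D X m) (hcomp D Y n)
      ∘ (dproj (shift_summand X) m ⊠ dproj (shift_summand Y) n).

(* For X in C_m this identifies F(X) with g^m ⊗ X. *)
Definition shift_homogeneous (m : 'I_M) X : hom (shift X) (tpow g m ⊗ X) :=
  (idm (tpow g m) ⊠ hinj D X m) ∘ dproj (shift_summand X) m.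

Definition shift_on_components (v : fusion_maps) : Prop :=
  [/\ forall (m : 'I_M) X, in_degree m X -> is_iso (shift_homogeneous m X),
      forall (m : 'I_M) X Y (f : hom X Y), in_degree m X -> in_degree m Y ->
        shift_homogeneous m Y ∘ fmor shift f =
        (idm (tpow g m) ⊠ f) ∘ shift_homogeneous m X
    & forall (m n k : 'I_M) X Y, in_degree m X -> in_degree n Y -> is_add m n k ->
        shift_homogeneous k (X ⊗ Y) ∘ shift_tau v X Y =
        tau_hom v m n k X Y
          ∘ (shift_homogeneous m X ⊠ shift_homogeneous n Y)].

End Functor.
End SimpleCurrent.

(* Main.v *)
From Pilot Require Import Defs.
From mathcomp Require Import all_boot all_order all_algebra.
From mathcomp Require Import complex reals trigo boolp zify ring lra.
(* [vector] exports another [hom]. *)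
Import Pilot.Defs.

(** Why the theorem holds.

    Equations between morphisms are proved as equations of string diagrams.  A
    tensor word acts on objects [W] by tensoring its letters on the left; words with
    the same letters act by convertible functions, and a morphism is determined by
    its action, so that associators and unitors can be erased ([strict_inj]) and
    braidings resolved into crossings of single strands ([hat_braid]).

    The double braiding of [X] with the invertible object [g] is an endomorphism
    [monodromy X] of [X], natural and multiplicative in [X], with [M]-th power the
    identity.  Its eigenspaces are the homogeneous components of [X]
    ([grading_exists]), and there are no morphisms between different degrees.

    As [g ^ M] is trivial, [q ^ (M * M) = 1] ([quad_order]); with [zeta ^ A = q ^ 2] and
    [A + 1] coprime to [M], this forces [q ^ M = 1] ([root_order]).  This is the obstruction to
    choosing the maps [v]: identifying [g ^ M] with the unit commutes with [g] up to
    the scalar [q ^ M] ([phi_rotate]), whence [admissible_exists].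

    As [g] has degree [A], the functor sends degree [m] to degree [(A + 1) m].  This
    permutes the degrees, so the functor is full and essentially surjective
    ([shift_equivalence]).  The structure maps [tau_hom] satisfy their associativity
    for all objects, as a diagrammatic consequence of the associativity of [v]
    ([interleave_assoc]); the functor being additive, this determines the behaviour
    of [shift_tau] ([tau_incl], [tau_assoc], [tau_iso]).

    On degrees [m] and [n] the braiding condition fails by the scalar
    [(q * zeta) ^ (m n)] ([tau_hom_braid]), and in degree [m] the pivotality condition
    fails by the dimension of [g ^ m] ([delta_pairing_homogeneous]).  For the latter,
    both sides of the condition become pairings of [F X] with [F (dual X)]
    ([pivotalE]), which are compared by sliding the strand of a power of [g].  By
    modularity the degrees that occur generate the integers modulo [M]: otherwise a
    proper power of [g] would centralise the category and be trivial
    ([degrees_generate]).  Hence the functor is pivotal exactly when [g] has dimension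
    1, and braided exactly when [M = 1] or [q * zeta = 1].  In the latter case [M]
    divides [A + 2] while [A] divides [M], which leaves [M <= 4] ([order_le4]) and the
    listed roots of unity. *)

Set Implicit Arguments.
Unset Strict Implicit.
Unset Printing Implicit Defensive.

Import GRing.Theory.
Local Open Scope ring_scope.
Local Open Scope tcat_scope.


(** * Linear and monoidal categories *)

Section Linear.
Variables (K : fieldType) (C : linCategory K).
Implicit Types X Y Z W : C.

Lemma compDr X Y Z (g : hom Y Z) (f f' : hom X Y) : g ∘ (f + f') = g ∘ f + g ∘ f'.
Proof. by have := @comp_linr _ C X Y Z g 1 f f'; rewrite !scale1r. Qed.

Lemma compDl X Y Z (g g' : hom Y Z) (f : hom X Y) : (g + g') ∘ f = g ∘ f + g' ∘ f.
Proof. by have := @comp_linl _ C X Y Z f 1 g g'; rewrite !scale1r. Qed.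

Lemma compm0 X Y Z (g : hom Y Z) : g ∘ (0 : hom X Y) = 0.
Proof. by apply: (addIr (g ∘ 0)); rewrite -compDr !add0r. Qed.

Lemma comp0m X Y Z (f : hom X Y) : (0 : hom Y Z) ∘ f = 0.
Proof. by apply: (addIr (0 ∘ f)); rewrite -compDl !add0r. Qed.

Lemma compZr X Y Z a (g : hom Y Z) (f : hom X Y) : g ∘ (a *: f) = a *: (g ∘ f).
Proof. by have := @comp_linr _ C X Y Z g a f 0; rewrite !addr0 compm0 addr0. Qed.

Lemma compZl X Y Z a (g : hom Y Z) (f : hom X Y) : (a *: g) ∘ f = a *: (g ∘ f).
Proof. by have := @comp_linl _ C X Y Z f a g 0; rewrite !addr0 comp0m addr0. Qed.

Lemma comp_sumr X Y Z (g : hom Y Z) (I : Type) (r : seq I) (P : pred I) (f : I -> hom X Y) :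
  g ∘ (\sum_(i <- r | P i) f i) = \sum_(i <- r | P i) g ∘ f i.
Proof. exact: (big_morph _ (compDr g) (compm0 _ g)). Qed.

Lemma comp_suml X Y Z (f : hom X Y) (I : Type) (r : seq I) (P : pred I) (g : I -> hom Y Z) :
  (\sum_(i <- r | P i) g i) ∘ f = \sum_(i <- r | P i) g i ∘ f.
Proof. exact: (big_morph _ (fun g g' => compDl g g' f) (comp0m _ f)). Qed.

Lemma compBl X Y Z (g g' : hom Y Z) (f : hom X Y) : (g - g') ∘ f = g ∘ f - g' ∘ f.
Proof. by rewrite compDl -scaleN1r compZl scaleN1r. Qed.

Lemma iso_epi X Y Z (f : hom X Y) (a b : hom Y Z) : is_iso f -> a ∘ f = b ∘ f -> a = b.
Proof.
move=> [f' [_ ff']] /(congr1 (fun u => u ∘ f')).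
by rewrite -!compA ff' !compm1.
Qed.

Lemma iso_mono X Y Z (f : hom X Y) (a b : hom Z X) : is_iso f -> f ∘ a = f ∘ b -> a = b.
Proof.
move=> [f' [f'f _]] /(congr1 (fun u => f' ∘ u)).
by rewrite !compA f'f !comp1m.
Qed.

Lemma iso_id X : is_iso (idm X).
Proof. by exists (idm X); split; rewrite comp1m. Qed.

Lemma iso_comp X Y Z (g : hom Y Z) (f : hom X Y) : is_iso g -> is_iso f -> is_iso (g ∘ f).
Proof.
move=> [g' [g'g gg']] [f' [f'f ff']]; exists (f' ∘ g'); split.
  by rewrite -compA (compA g') g'g comp1m.
by rewrite -compA (compA f) ff' comp1m.
Qed.

Lemma iso_scale X Y a (f : hom X Y) : a != 0 -> is_iso f -> is_iso (a *: f).
Proof.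
move=> a0 [f' [f'f ff']]; exists (a^-1 *: f').
by split; rewrite compZl compZr ?f'f ?ff' scalerA ?mulVf ?mulfV ?scale1r.
Qed.

Lemma iso_neq0 X Y (f : hom X Y) : is_iso f -> idm X <> 0 -> f <> 0.
Proof. by move=> [f' [f'f _]] X0 f0; apply: X0; rewrite -f'f f0 compm0. Qed.

End Linear.

Section Monoidal.
Variables (K : fieldType) (C : monoidalCategory K).
Implicit Types X Y Z W : C.

Lemma tensDl X X' Y Y' (f f' : hom X X') (h : hom Y Y') : (f + f') ⊠ h = f ⊠ h + f' ⊠ h.
Proof. by have := @tensm_linl _ C X X' Y Y' h 1 f f'; rewrite !scale1r. Qed.

Lemma tensDr X X' Y Y' (f : hom X X') (h h' : hom Y Y') : f ⊠ (h + h') = f ⊠ h + f ⊠ h'.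
Proof. by have := @tensm_linr _ C X X' Y Y' f 1 h h'; rewrite !scale1r. Qed.

Lemma tens0l X X' Y Y' (h : hom Y Y') : (0 : hom X X') ⊠ h = 0.
Proof. by apply: (addIr (0 ⊠ h)); rewrite -tensDl !add0r. Qed.

Lemma tens0r X X' Y Y' (f : hom X X') : f ⊠ (0 : hom Y Y') = 0.
Proof. by apply: (addIr (f ⊠ 0)); rewrite -tensDr !add0r. Qed.

Lemma tensZl X X' Y Y' a (f : hom X X') (h : hom Y Y') : (a *: f) ⊠ h = a *: (f ⊠ h).
Proof. by have := @tensm_linl _ C X X' Y Y' h a f 0; rewrite !addr0 tens0l addr0. Qed.

Lemma tensZr X X' Y Y' a (f : hom X X') (h : hom Y Y') : f ⊠ (a *: h) = a *: (f ⊠ h).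
Proof. by have := @tensm_linr _ C X X' Y Y' f a h 0; rewrite !addr0 tens0r addr0. Qed.

Lemma tens_suml X X' Y Y' (h : hom Y Y') (I : Type) (r : seq I) (P : pred I) (f : I -> hom X X') :
  (\sum_(i <- r | P i) f i) ⊠ h = \sum_(i <- r | P i) f i ⊠ h.
Proof. exact: (big_morph _ (fun f f' => tensDl f f' h) (tens0l _ _ h)). Qed.

Lemma tens_sumr X X' Y Y' (f : hom X X') (I : Type) (r : seq I) (P : pred I) (h : I -> hom Y Y') :
  f ⊠ (\sum_(i <- r | P i) h i) = \sum_(i <- r | P i) f ⊠ h i.
Proof. exact: (big_morph _ (tensDr f) (tens0r _ _ f)). Qed.

Lemma tens_compl X X' X'' Y (f' : hom X' X'') (f : hom X X') :
  (f' ∘ f) ⊠ idm Y = (f' ⊠ idm Y) ∘ (f ⊠ idm Y).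
Proof. by rewrite -tensm_comp compm1. Qed.

Lemma tens_compr X Y Y' Y'' (f' : hom Y' Y'') (f : hom Y Y') :
  idm X ⊠ (f' ∘ f) = (idm X ⊠ f') ∘ (idm X ⊠ f).
Proof. by rewrite -tensm_comp compm1. Qed.

Lemma iso_tens X X' Y Y' (f : hom X X') (h : hom Y Y') :
  is_iso f -> is_iso h -> is_iso (f ⊠ h).
Proof.
move=> [f' [f'f ff']] [h' [h'h hh']]; exists (f' ⊠ h').
by split; rewrite -tensm_comp ?f'f ?ff' ?h'h ?hh' tensm1.
Qed.

Lemma alphaK X Y Z : alphai X Y Z ∘ alpha X Y Z = idm _.
Proof. by case: (alpha_iso X Y Z). Qed.

Lemma alphaiK X Y Z : alpha X Y Z ∘ alphai X Y Z = idm _.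
Proof. by case: (alpha_iso X Y Z). Qed.

Lemma iso_alpha X Y Z : is_iso (alpha X Y Z).
Proof. by exists (alphai X Y Z); exact: alpha_iso. Qed.

Lemma iso_lambda X : is_iso (lambda X).
Proof. by exists (lambdai X); exact: lambda_iso. Qed.

Lemma iso_rho X : is_iso (rho X).
Proof. by exists (rhoi X); exact: rho_iso. Qed.

Lemma iso_sym X Y (f : hom X Y) f' : inverse_of f f' -> is_iso f'.
Proof. by case=> a b; exists f. Qed.

Lemma iso_alphai X Y Z : is_iso (alphai X Y Z).
Proof. exact: iso_sym (alpha_iso X Y Z). Qed.

Lemma tens1_inj X Y (f h : hom X Y) : f ⊠ idm one = h ⊠ idm one -> f = h.
Proof. by move=> e; apply: (iso_epi (iso_rho X)); rewrite -!rho_nat e. Qed.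

Lemma tens1l_inj X Y (f h : hom X Y) : idm one ⊠ f = idm one ⊠ h -> f = h.
Proof. by move=> e; apply: (iso_epi (iso_lambda X)); rewrite -!lambda_nat e. Qed.

(** Kelly's redundancy: the pentagon at (1, 1, X, W) and three triangles give
    this equation tensored by the unit on the left. *)
Lemma lambda_alpha X W : lambda (X ⊗ W) ∘ alpha one X W = lambda X ⊠ idm W.
Proof.
apply: tens1l_inj.
apply: (iso_epi (iso_alpha one (one ⊗ X) W)).
apply: (iso_epi (iso_tens (iso_alpha one one X) (iso_id W))).
transitivity ((idm one ⊠ lambda (X ⊗ W)) ∘ (alpha one one (X ⊗ W) ∘ alpha (one ⊗ one) X W)).
  by rewrite pentagon tens_compr -!compA.
rewrite compA triangle -(tensm1 X W) -alpha_nat -triangle tens_compl compA alpha_nat.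
by rewrite -!compA.
Qed.

End Monoidal.

(** * Coherence *)

(** A word is a bracketed tensor product of objects.  It acts on an object [W] by
    tensoring its letters one after the other on the left, so that both ways of
    bracketing a word act by convertible functions.  This makes the action of
    words a strictly associative substitute for the tensor product, without any
    equation between objects. *)
Section Words.
Variables (K : fieldType) (C : braidedFusionCategory K).

Inductive word := Letter of C | Empty | Cat of word & word.

Fixpoint wobj (a : word) : C :=
  match a with
  | Letter X => X
  | Empty => one
  | Cat a b => wobj a ⊗ wobj b
  end.

Fixpoint act (a : word) (W : C) : C :=
  match a with
  | Letter X => X ⊗ W
  | Empty => W
  | Cat a b => act a (act b W)
  end.

Fixpoint actm (a : word) (W W' : C) (f : hom W W') : hom (act a W) (act a W') :=
  match a with
  | Letter X => idm X ⊠ f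
  | Empty => f
  | Cat a b => actm a (actm b f)
  end.

(** The canonical isomorphism that rebrackets a word to the right around [W]. *)
Fixpoint nf (a : word) (W : C) : hom (wobj a ⊗ W) (act a W) :=
  match a with
  | Letter X => idm (X ⊗ W)
  | Empty => lambda W
  | Cat a b => nf a (act b W) ∘ (idm (wobj a) ⊠ nf b W) ∘ alpha (wobj a) (wobj b) W
  end.

Fixpoint nfi (a : word) (W : C) : hom (act a W) (wobj a ⊗ W) :=
  match a with
  | Letter X => idm (X ⊗ W)
  | Empty => lambdai W
  | Cat a b => alphai (wobj a) (wobj b) W ∘ (idm (wobj a) ⊠ nfi b W) ∘ nfi a (act b W)
  end.

Fact hat_key : unit. Proof. by []. Qed.

(** A morphism between words acts with a spectator [W].  The definition is locked
    because rewriting by associativity of the composition would otherwise unfold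
    it. *)
Definition hat (a b : word) (f : hom (wobj a) (wobj b)) (W : C) :
    hom (act a W) (act b W) :=
  locked_with hat_key (nf b W ∘ (f ⊠ idm W) ∘ nfi a W).

Lemma hatE a b (f : hom (wobj a) (wobj b)) W :
  hat f W = nf b W ∘ (f ⊠ idm W) ∘ nfi a W.
Proof. by rewrite /hat unlock. Qed.

Lemma actm1 a W : actm a (idm W) = idm (act a W).
Proof.
elim: a W => //= [X W|a IHa b IHb W]; first by rewrite tensm1.
by rewrite IHb IHa.
Qed.

Lemma actm_comp a W W' W'' (f' : hom W' W'') (f : hom W W') :
  actm a (f' ∘ f) = actm a f' ∘ actm a f.
Proof.
elim: a W W' W'' f' f => //= [X *|a IHa b IHb *]; first by rewrite tens_compr.
by rewrite IHb IHa.
Qed.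

Lemma nf_iso a W : inverse_of (nf a W) (nfi a W).
Proof.
elim: a W => [X|W|a IHa b IHb W] /=.
- by split; rewrite comp1m.
- exact: lambda_iso.
have [a1 a2] := IHa (act b W); have [b1 b2] := IHb W; split.
  rewrite -!compA (compA (nfi a _)) a1 comp1m (compA (_ ⊠ _) (_ ⊠ _)).
  by rewrite -tens_compr b1 tensm1 comp1m alphaK.
rewrite -!compA (compA (alpha _ _ _)) alphaiK comp1m (compA (_ ⊠ _) (_ ⊠ _)).
by rewrite -tens_compr b2 tensm1 comp1m a2.
Qed.

Lemma nfK a W : nfi a W ∘ nf a W = idm _. Proof. by case: (nf_iso a W). Qed.
Lemma nfiK a W : nf a W ∘ nfi a W = idm _. Proof. by case: (nf_iso a W). Qed.

Lemma nf_nat a W W' (f : hom W W') :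
  nf a W' ∘ (idm (wobj a) ⊠ f) = actm a f ∘ nf a W.
Proof.
elim: a W W' f => [X|W W' f|a IHa b IHb W W' f] /=.
- by move=> *; rewrite comp1m compm1.
- exact: lambda_nat.
rewrite -tensm1 -!compA alpha_nat (compA (_ ⊠ _) (_ ⊠ _)) -tens_compr IHb.
by rewrite tens_compr !compA IHa.
Qed.

Lemma nfi_nat a W W' (f : hom W W') :
  nfi a W' ∘ actm a f = (idm (wobj a) ⊠ f) ∘ nfi a W.
Proof.
apply: (iso_mono (f := nf a W')); first by exists (nfi a W'); exact: nf_iso.
rewrite !compA nfiK comp1m nf_nat -[RHS]compA nfiK.
by rewrite compm1.
Qed.

Lemma hat1 a W : hat (idm (wobj a)) W = idm (act a W) :> hom (act a W) (act a W).
Proof. by rewrite !hatE tensm1 compm1 nfiK. Qed.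

Lemma hat_comp a b c (f : hom (wobj b) (wobj c)) (h : hom (wobj a) (wobj b)) W :
  @hat a c (f ∘ h) W = @hat b c f W ∘ @hat a b h W.
Proof.
rewrite !hatE tens_compl -!compA; congr (_ ∘ (_ ∘ _)).
by rewrite !compA nfK comp1m.
Qed.

Lemma hatZ a b k (f : hom (wobj a) (wobj b)) W : @hat a b (k *: f) W = k *: @hat a b f W.
Proof. by rewrite !hatE tensZl compZr compZl. Qed.

Lemma hat_nat a b (f : hom (wobj a) (wobj b)) W W' (h : hom W W') :
  @hat a b f W' ∘ actm a h = actm b h ∘ @hat a b f W.
Proof.
rewrite !hatE -!compA nfi_nat (compA (f ⊠ _)) -tensm_comp compm1 comp1m.
by rewrite (compA (actm b h)) -nf_nat -!compA (compA (_ ⊠ _) (_ ⊠ _)) -tensm_comp comp1m compm1.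
Qed.

(** Already the spectator [W = one] loses nothing, by the unitors. *)
Lemma hat_inj a b (f h : hom (wobj a) (wobj b)) :
  (forall W, @hat a b f W = @hat a b h W) -> f = h.
Proof.
move=> /(_ one) e; apply: tens1_inj.
apply: (iso_mono (f := nf b one)); first by exists (nfi b one); exact: nf_iso.
apply: (iso_epi (f := nfi a one)); last by move: e; rewrite !hatE.
by exists (nf a one); case: (nf_iso a one).
Qed.

Lemma hat_tens a a' b b' (f : hom (wobj a) (wobj a')) (h : hom (wobj b) (wobj b')) W :
  @hat (Cat a b) (Cat a' b') (f ⊠ h) W = @hat a a' f (act b' W) ∘ actm a (@hat b b' h W).
Proof.
rewrite !hatE /= -!compA nfi_nat.
rewrite (compA (alpha _ _ _)) alpha_nat -!compA (compA (alpha _ _ _)) alphaiK comp1m.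
congr (_ ∘ _); rewrite !compA -!tensm_comp; congr (_ ∘ _).
by rewrite !comp1m !compm1.
Qed.

(** This is the pentagon. *)
Lemma hat_alpha a b c W :
  @hat (Cat (Cat a b) c) (Cat a (Cat b c)) (alpha (wobj a) (wobj b) (wobj c)) W = idm _.
Proof.
rewrite -(hat1 (Cat (Cat a b) c) W) !hatE /= tensm1 compm1; congr (_ ∘ _).
rewrite !tens_compr -tensm1 -!compA [in RHS](compA (alpha _ _ _)) alpha_nat.
by congr (_ ∘ _); rewrite -!compA; congr (_ ∘ _); rewrite pentagon !compA.
Qed.

Lemma hat_inv a b (f : hom (wobj a) (wobj b)) f' (fh : forall W, hom (act a W) (act b W))
   (fh' : forall W, hom (act b W) (act a W)) W :
  inverse_of f f' -> inverse_of (fh W) (fh' W) -> @hat a b f W = fh W -> @hat b a f' W = fh' W.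
Proof.
move=> [f'f ff'] [fh'fh fhfh'] e.
have : @hat b a f' W ∘ @hat a b f W = idm _ by rewrite -hat_comp f'f hat1.
rewrite e => /(congr1 (fun u => u ∘ fh' W)).
by rewrite -compA fhfh' compm1 comp1m.
Qed.

Lemma inv_id X : inverse_of (idm X) (idm X : hom X (X : C)).
Proof. by split; rewrite comp1m. Qed.

Lemma hat_alphai a b c W :
  @hat (Cat a (Cat b c)) (Cat (Cat a b) c) (alphai (wobj a) (wobj b) (wobj c)) W = idm _.
Proof.
exact: (@hat_inv (Cat (Cat a b) c) (Cat a (Cat b c)) _ _ (fun W => idm _) (fun W => idm _) W
  (alpha_iso _ _ _) (inv_id _) (hat_alpha _ _ _ _)).
Qed.

Lemma hat_lambda a W : @hat (Cat Empty a) a (lambda (wobj a)) W = idm _.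
Proof.
rewrite -(hat1 (Cat Empty a) W) !hatE /= tensm1 compm1; congr (_ ∘ _).
by rewrite lambda_nat -!compA lambda_alpha.
Qed.

Lemma hat_lambdai a W : @hat a (Cat Empty a) (lambdai (wobj a)) W = idm _.
Proof.
exact: (@hat_inv (Cat Empty a) a _ _ (fun W => idm _) (fun W => idm _) W
  (lambda_iso _) (inv_id _) (hat_lambda _ _)).
Qed.

Lemma hat_rho a W : @hat (Cat a Empty) a (rho (wobj a)) W = idm _.
Proof.
rewrite -(hat1 (Cat a Empty) W) !hatE /= tensm1 compm1; congr (_ ∘ _).
by rewrite -!compA triangle.
Qed.

Lemma hat_rhoi a W : @hat a (Cat a Empty) (rhoi (wobj a)) W = idm _.
Proof.
exact: (@hat_inv (Cat a Empty) a _ _ (fun W => idm _) (fun W => idm _) W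
  (rho_iso _) (inv_id _) (hat_rho _ _)).
Qed.

(** The two hexagons, with the associators erased. *)
Lemma hat_braid_catr a b c W :
  @hat (Cat a (Cat b c)) (Cat (Cat b c) a) (braid (wobj a) (wobj b ⊗ wobj c)) W =
  actm b (@hat (Cat a c) (Cat c a) (braid (wobj a) (wobj c)) W)
    ∘ @hat (Cat a b) (Cat b a) (braid (wobj a) (wobj b)) (act c W).
Proof.
have /(congr1 (fun f => @hat (Cat (Cat a b) c) (Cat b (Cat c a)) f W)) :=
  braid_hexagon1 (wobj a) (wobj b) (wobj c).
rewrite -compA (@hat_comp _ (Cat (Cat b c) a)) (@hat_comp _ (Cat a (Cat b c))).
rewrite !hat_alpha comp1m compm1 => ->.
rewrite (@hat_comp _ (Cat (Cat b a) c)) (@hat_comp _ (Cat b (Cat a c))) hat_alpha compm1.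
by rewrite !hat_tens !hat1 actm1 comp1m compm1.
Qed.

Lemma hat_braid_catl a b c W :
  @hat (Cat (Cat a b) c) (Cat c (Cat a b)) (braid (wobj a ⊗ wobj b) (wobj c)) W =
  @hat (Cat a c) (Cat c a) (braid (wobj a) (wobj c)) (act b W)
    ∘ actm a (@hat (Cat b c) (Cat c b) (braid (wobj b) (wobj c)) W).
Proof.
have /(congr1 (fun f => @hat (Cat a (Cat b c)) (Cat (Cat c a) b) f W)) :=
  braid_hexagon2 (wobj a) (wobj b) (wobj c).
rewrite -compA (@hat_comp _ (Cat c (Cat a b))) (@hat_comp _ (Cat (Cat a b) c)).
rewrite !hat_alphai comp1m compm1 => ->.
rewrite (@hat_comp _ (Cat a (Cat c b))) (@hat_comp _ (Cat (Cat a c) b)) hat_alphai compm1.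
by rewrite !hat_tens !hat1 actm1 comp1m compm1.
Qed.

Lemma hat_iso a b (f : hom (wobj a) (wobj b)) W : is_iso f -> is_iso (@hat a b f W).
Proof.
move=> [f' [f'f ff']]; exists (@hat b a f' W).
by split; rewrite -hat_comp ?f'f ?ff' hat1.
Qed.

Lemma iso_idem (X : C) (e : hom X X) : is_iso e -> e ∘ e = e -> e = idm X.
Proof. by move=> ie ee; apply: (iso_mono ie); rewrite ee compm1. Qed.

(** By a hexagon at two units, this invertible endomorphism is idempotent. *)
Lemma hat_braid_unitr a W : @hat (Cat a Empty) (Cat Empty a) (braid (wobj a) one) W = idm _.
Proof.
apply: iso_idem; first exact: (@hat_iso (Cat a Empty) (Cat Empty a) _ W (braid_iso _ _)).
have /(congr1 (fun f => @hat (Cat a (Cat Empty Empty)) (Cat Empty a) f W)) :=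
  braid_nat (idm (wobj a)) (lambda (one : C)).
rewrite (@hat_comp _ (Cat a Empty)) (@hat_comp _ (Cat (Cat Empty Empty) a)).
rewrite !hat_tens hat_lambda hat1 comp1m !actm1 (@hat_lambda Empty) !compm1 comp1m.
by rewrite hat_braid_catr /= => <-.
Qed.

Lemma hat_braid_unitl a W : @hat (Cat Empty a) (Cat a Empty) (braid one (wobj a)) W = idm _.
Proof.
apply: iso_idem; first exact: (@hat_iso (Cat Empty a) (Cat a Empty) _ W (braid_iso _ _)).
have /(congr1 (fun f => @hat (Cat (Cat Empty Empty) a) (Cat a Empty) f W)) :=
  braid_nat (lambda (one : C)) (idm (wobj a)).
rewrite (@hat_comp _ (Cat Empty a)) (@hat_comp _ (Cat a (Cat Empty Empty))).
rewrite !hat_tens hat_lambda hat1 comp1m !actm1 (@hat_lambda Empty) !compm1 actm1 comp1m.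
by rewrite hat_braid_catl comp1m => e; symmetry; exact: e.
Qed.

Fact cross_key : unit. Proof. by []. Qed.

Definition cross (X Y W : C) : hom (X ⊗ Y ⊗ W) (Y ⊗ X ⊗ W) :=
  locked_with cross_key (alpha Y X W ∘ (braid X Y ⊠ idm W) ∘ alphai X Y W).

Lemma crossE X Y W :
  cross X Y W = alpha Y X W ∘ (braid X Y ⊠ idm W) ∘ alphai X Y W.
Proof. by rewrite /cross unlock. Qed.

(** The braiding of two words as a composite of crossings of letters. *)
Fixpoint cross_word (X : C) (b : word) (W : C) : hom (X ⊗ act b W) (act b (X ⊗ W)) :=
  match b with
  | Letter Y => cross X Y W
  | Empty => idm _
  | Cat b c => actm b (cross_word X c W) ∘ cross_word X b (act c W)
  end.

Fixpoint braid_words (a b : word) (W : C) : hom (act a (act b W)) (act b (act a W)) :=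
  match a with
  | Letter X => cross_word X b W
  | Empty => idm _
  | Cat a a' => braid_words a b (act a' W) ∘ actm a (braid_words a' b W)
  end.

Lemma hat_braid a b W :
  @hat (Cat a b) (Cat b a) (braid (wobj a) (wobj b)) W = braid_words a b W.
Proof.
elim: a W => [X|W|a IHa a' IHa' W].
- elim: b => [Y|W|b IHb c IHc W].
  + by move=> W; rewrite hatE /= crossE !tensm1 !comp1m !compm1.
  + exact: (hat_braid_unitr (Letter X)).
  + apply: (etrans (hat_braid_catr (Letter X) b c W)).
    apply: (etrans (congr1 (fun u => actm b u ∘ _) (IHc W))).
    exact: (congr1 (fun u => _ ∘ u) (IHb (act c W))).
- exact: hat_braid_unitl.
- apply: (etrans (hat_braid_catl a a' b W)).
  apply: (etrans (congr1 (fun u => u ∘ _) (IHa (act a' W)))).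
  exact: (congr1 (fun u => _ ∘ actm a u) (IHa' W)).
Qed.

(** Syntax for morphisms built from arbitrary ones ([Atom]) by the structure of
    a braided linear category. *)
Inductive diagram : word -> word -> Type :=
  | Id a : diagram a a
  | Comp a b c of diagram b c & diagram a b : diagram a c
  | Tens a a' b b' of diagram a a' & diagram b b' : diagram (Cat a b) (Cat a' b')
  | Alpha a b c : diagram (Cat (Cat a b) c) (Cat a (Cat b c))
  | Alphai a b c : diagram (Cat a (Cat b c)) (Cat (Cat a b) c)
  | Lambda a : diagram (Cat Empty a) a
  | Lambdai a : diagram a (Cat Empty a)
  | Rho a : diagram (Cat a Empty) a
  | Rhoi a : diagram a (Cat a Empty)
  | Braid a b : diagram (Cat a b) (Cat b a)
  | Scale a b of K & diagram a b : diagram a b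
  | Atom a b of hom (wobj a) (wobj b) : diagram a b.

Fixpoint draw a b (d : diagram a b) : hom (wobj a) (wobj b) :=
  match d in diagram a b return hom (wobj a) (wobj b) with
  | Id a => idm (wobj a)
  | Comp _ _ _ d e => draw d ∘ draw e
  | Tens _ _ _ _ d e => draw d ⊠ draw e
  | Alpha _ _ _ => alpha _ _ _
  | Alphai _ _ _ => alphai _ _ _
  | Lambda _ => lambda _
  | Lambdai _ => lambdai _
  | Rho _ => rho _
  | Rhoi _ => rhoi _
  | Braid a b => braid (wobj a) (wobj b)
  | Scale _ _ k d => k *: draw d
  | Atom _ _ f => f
  end.

Fixpoint strict a b (d : diagram a b) (W : C) : hom (act a W) (act b W) :=
  match d in diagram a b return hom (act a W) (act b W) with
  | Id a => idm (act a W)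
  | Comp _ _ _ d e => strict d W ∘ strict e W
  | Tens a _ _ b' d e => strict d (act b' W) ∘ actm a (strict e W)
  | Alpha _ _ _ | Alphai _ _ _ | Lambda _ | Lambdai _ | Rho _ | Rhoi _ => idm _
  | Braid a b => braid_words a b W
  | Scale _ _ k d => k *: strict d W
  | Atom a b f => @hat a b f W
  end.

Lemma hat_draw a b (d : diagram a b) W : hat (draw d) W = strict d W.
Proof.
elim: d W => //=.
- exact: hat1.
- by move=> a' b' c d IHd e IHe W; rewrite hat_comp IHd IHe.
- by move=> a1 a1' b1 b1' d IHd e IHe W; rewrite hat_tens IHd IHe.
- exact: hat_alpha.
- exact: hat_alphai.
- exact: hat_lambda.
- exact: hat_lambdai.
- exact: hat_rho.
- exact: hat_rhoi.
- exact: hat_braid.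
- by move=> a' b' k d IHd W; rewrite hatZ IHd.
Qed.

(** Coherence: an equation between diagrams may be checked after erasing all
    associators and unitors and resolving each braiding into crossings of
    letters. *)
Theorem strict_inj a b (d e : diagram a b) :
  (forall W, strict d W = strict e W) -> draw d = draw e.
Proof. by move=> de; apply: hat_inj => W; rewrite !hat_draw. Qed.

Lemma strict_eq a b (d e : diagram a b) :
  draw d = draw e -> forall W, strict d W = strict e W.
Proof. by move=> de W; rewrite -!hat_draw de. Qed.

Lemma strict_nat a b (d : diagram a b) W W' (h : hom W W') :
  strict d W' ∘ actm a h = actm b h ∘ strict d W.
Proof. by rewrite -!hat_draw hat_nat. Qed.

End Words.

Arguments Empty {K C}.


(** * Rewriting with strict equations *)

Ltac word_of C X :=
  lazymatch X with
  | tens ?A ?B =>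
      let a := word_of C A in let b := word_of C B in constr:(Cat a b)
  | one => constr:(@Empty _ C)
  | _ => constr:(@Letter _ C X)
  end.

Ltac diagram_of C f a b :=
  lazymatch f with
  | @comp _ _ _ ?Y _ ?h ?k =>
      let c := word_of C Y in
      let d := diagram_of C h c b in
      let e := diagram_of C k a c in
      constr:(@Comp _ C a c b d e)
  | tensm ?h ?k =>
      lazymatch a with
      | Cat ?a1 ?a2 =>
          lazymatch b with
          | Cat ?b1 ?b2 =>
              let d := diagram_of C h a1 b1 in
              let e := diagram_of C k a2 b2 in
              constr:(Tens d e)
          end
      end
  | idm _ => constr:(Id a)
  | alpha _ _ _ =>
      lazymatch a with Cat (Cat ?x ?y) ?z => constr:(Alpha x y z) end
  | alphai _ _ _ =>
      lazymatch b with Cat (Cat ?x ?y) ?z => constr:(Alphai x y z) end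
  | lambda _ => constr:(Lambda b)
  | lambdai _ => constr:(Lambdai a)
  | rho _ => constr:(Rho b)
  | rhoi _ => constr:(Rhoi a)
  | braid _ _ => lazymatch a with Cat ?x ?y => constr:(Braid x y) end
  | GRing.scale ?k ?h =>
      let d := diagram_of C h a b in constr:(@Scale _ C a b k d)
  | _ => constr:(@Atom _ C a b f)
  end.

Ltac the_category k :=
  match goal with
  | C : modularCategory _ |- _ => k constr:(mod_br C)
  | C : braidedFusionCategory _ |- _ => k C
  end.

Ltac strict_cbn := cbn [strict act actm wobj braid_words cross_word].
Definition whiskE := (tens_compr, tensm1, comp1m, compm1, actm_comp, actm1).

Ltac strict_cbn_in H := cbn [strict act actm wobj braid_words cross_word] in H.

(** Turns a goal [f = h] into the equality of the actions of [f] and [h], with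
    associators and unitors erased and composites nested to the right. *)
Ltac strictify :=
  the_category ltac:(fun C =>
    lazymatch goal with
    | |- @eq ?T ?f ?h =>
        lazymatch T with context [@hom _ _ ?X ?Y] =>
          let a := word_of C X in let b := word_of C Y in
          let d := diagram_of C f a b in
          let e := diagram_of C h a b in
          refine (@strict_inj _ C a b d e _);
          let W := fresh "W" in intro W; strict_cbn; rewrite ?whiskE -?compA
        end
    end).

(** The detour through an evar allows rewriting under the quantifier over the
    spectator. *)
Ltac tidy_instance C p H' :=
  let T := fresh in
  evar (T : obj C -> Prop);
  assert (H' : forall W, T W);
  [ let W := fresh in let E := fresh in
    intro W; have E := p W; strict_cbn_in E;
    rewrite -?compA ?whiskE -?compA in E; exact E
  | subst T; cbn beta in H' ].

(** The same as [strictify], for a hypothesis [H]. *)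
Ltac strictify_eq H H' :=
  the_category ltac:(fun C =>
    lazymatch type of H with
    | @eq ?T ?f ?h =>
        lazymatch T with context [@hom _ _ ?X ?Y] =>
          let a := word_of C X in let b := word_of C Y in
          let d := diagram_of C f a b in
          let e := diagram_of C h a b in
          tidy_instance C constr:(@strict_eq _ C a b d e H) H'
        end
    end).

(** Names the interchange law for [f] and a morphism of the spectator. *)
Ltac strict_nat_of f H' :=
  the_category ltac:(fun C =>
    let T := type of f in
    lazymatch T with context [@hom _ _ ?X ?Y] =>
      let a := word_of C X in let b := word_of C Y in
      have H' := @hat_nat _ C a b f; strict_cbn_in H'
    end).

(** From a proof of [p = q], quantified, proofs of [p ∘ k = q ∘ k] for all [k],
    with composites nested to the right. *)
Ltac postcomposed e :=
  let T := type of e in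
  lazymatch T with
  | forall x : ?A, _ =>
      let y := fresh in
      constr:(fun y : A => ltac:(let r := postcomposed constr:(e y) in exact r))
  | @eq _ ?p ?q =>
      let V := fresh in let k := fresh in
      constr:(fun V (k : hom V _) => ltac:(
        let E := fresh in
        have E := congr1 (fun u => u ∘ k) e; cbn beta in E;
        rewrite -?compA in E; exact E))
  end.

Ltac reversed e :=
  let T := type of e in
  lazymatch T with
  | forall x : ?A, _ =>
      let y := fresh in
      constr:(fun y : A => ltac:(let r := reversed constr:(e y) in exact r))
  | _ => constr:(esym e)
  end.

(** From a proof of [p = q], quantified, proofs of [idm A ⊠ p = idm A ⊠ q], with
    both sides expanded. *)
Ltac whiskered A e :=
  let T := type of e in
  lazymatch T with
  | forall x : ?B, _ =>
      let y := fresh in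
      constr:(fun y : B => ltac:(let r := whiskered A constr:(e y) in exact r))
  | @eq _ ?p ?q =>
      constr:(ltac:(
        let E := fresh in
        have E := congr1 (fun u => idm A ⊠ u) e; cbn beta in E;
        rewrite ?whiskE -?compA in E; exact E))
  end.

Ltac rewrite_mid e :=
  first [ rewrite e | let r := postcomposed e in rewrite r ]; rewrite -?compA.

(** Rewriting in the middle of a composite nested to the right, possibly under
    a tensor product by [A] on the left. *)
Tactic Notation "crw" constr(e) := rewrite_mid e.
Tactic Notation "crw" "<-" constr(e) := let r := reversed e in rewrite_mid r.
Tactic Notation "crw" constr(e) "under" constr(A) :=
  let r := whiskered A e in rewrite_mid r.
Tactic Notation "crw" constr(e) "under" constr(A) constr(B) :=
  let r := whiskered B e in let r' := whiskered A r in rewrite_mid r'.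
Tactic Notation "crw" "<-" constr(e) "under" constr(A) :=
  let r := reversed e in let r' := whiskered A r in rewrite_mid r'.

(** * Interleaving two pairs of factors *)

Section Interleave.
Variables (K : fieldType) (C : braidedFusionCategory K).

Fact interleave_key : unit. Proof. by []. Qed.

(** The monoidal structure map of the shift functor, for an arbitrary [v]. *)
Definition interleave (A B E : C) (v : hom (A ⊗ B) E) (X Y : C) :
    hom ((A ⊗ X) ⊗ (B ⊗ Y)) (E ⊗ (X ⊗ Y)) :=
  locked_with interleave_key ((v ⊠ idm (X ⊗ Y)) ∘ alphai A B (X ⊗ Y)
    ∘ (idm A ⊠ (alpha B X Y ∘ (braid X B ⊠ idm Y) ∘ alphai X B Y))
    ∘ alpha A X (B ⊗ Y)).

Lemma interleaveE (A B E : C) (v : hom (A ⊗ B) E) (X Y : C) :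
  interleave v X Y = (v ⊠ idm (X ⊗ Y)) ∘ alphai A B (X ⊗ Y)
    ∘ (idm A ⊠ (alpha B X Y ∘ (braid X B ⊠ idm Y) ∘ alphai X B Y))
    ∘ alpha A X (B ⊗ Y).
Proof. by rewrite /interleave unlock. Qed.

Lemma cross_nat (X Y W W' : C) (h : hom W W') :
  cross X Y W' ∘ (idm X ⊠ (idm Y ⊠ h)) = (idm Y ⊠ (idm X ⊠ h)) ∘ cross X Y W.
Proof.
have := @strict_nat _ C _ _ (Braid (Letter X) (Letter Y)) W W' h.
by [].
Qed.

Lemma cross_slide (X A B E W : C) (v : hom (A ⊗ B) E) :
  cross X E W ∘ (idm X ⊠ @hat _ C (Cat (Letter A) (Letter B)) (Letter E) v W) =
  @hat _ C (Cat (Letter A) (Letter B)) (Letter E) v (X ⊗ W)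
    ∘ (idm A ⊠ cross X B W) ∘ cross X A (B ⊗ W).
Proof.
have e := braid_nat (idm X) v.
strictify_eq e e'.
by rewrite e' compA.
Qed.

(** The strands of [X] and [Y] cross those of [B] and [D] in either order, by the
    naturality of the braiding; only the associativity of [v] is left. *)
Lemma interleave_assoc (A B D AB BD E X Y Z : C) (v1 : hom (A ⊗ B) AB) (v2 : hom (AB ⊗ D) E)
    (w1 : hom (B ⊗ D) BD) (w2 : hom (A ⊗ BD) E) :
  v2 ∘ (v1 ⊠ idm D) = w2 ∘ (idm A ⊠ w1) ∘ alpha A B D ->
  (idm E ⊠ alpha X Y Z) ∘ interleave v2 (X ⊗ Y) Z ∘ (interleave v1 X Y ⊠ idm (D ⊗ Z)) =
  interleave w2 X (Y ⊗ Z) ∘ (idm (A ⊗ X) ⊠ interleave w1 Y Z) ∘ alpha (A ⊗ X) (B ⊗ Y) (D ⊗ Z).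
Proof.
move=> vw; strictify_eq vw vw'.
rewrite !interleaveE; strictify.
strict_nat_of v1 n1.
crw <- n1; crw <- n1; crw vw'; congr (_ ∘ _).
rewrite [RHS]compA -[in RHS]tens_compr cross_slide !whiskE -!compA; congr (_ ∘ (_ ∘ _)).
by rewrite -!tens_compr cross_nat.
Qed.

(** The braiding of [A ⊗ X] with [B ⊗ Y] has four crossings.  Those of [X] with [B]
    and of [X] with [Y] occur on the right-hand side; that of [A] with [B] is
    absorbed by [v'] at the cost of [x]; that of [A] with [Y] forms a double
    braiding with the crossing in [interleave v' Y X], at the cost of [y]. *)
Lemma interleave_braid (A B E X Y : C) (v : hom (A ⊗ B) E) (v' : hom (B ⊗ A) E) (x y : K) :
  v' ∘ braid A B = x *: v ->
  braid Y A ∘ braid A Y = y *: idm (A ⊗ Y) ->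
  interleave v' Y X ∘ braid (A ⊗ X) (B ⊗ Y) =
  (x * y) *: ((idm E ⊠ braid X Y) ∘ interleave v X Y).
Proof.
move=> vx dy; strictify_eq vx vx'; strictify_eq dy dy'.
rewrite !interleaveE; strictify.
have dB V : (idm B ⊠ cross Y A V) ∘ (idm B ⊠ cross A Y V) = y *: idm _.
  by rewrite -tens_compr dy' tensZr tensm1.
crw dB; rewrite compZl comp1m compZr.
strict_nat_of v n.
crw vx'; rewrite compZl. rewrite scalerA mulrC; congr (_ *: _); by crw n.
Qed.

Lemma interleave_nat (A B E X X' Y Y' : C) (v : hom (A ⊗ B) E) (f : hom X X') (h : hom Y Y') :
  interleave v X' Y' ∘ ((idm A ⊠ f) ⊠ (idm B ⊠ h)) = (idm E ⊠ (f ⊠ h)) ∘ interleave v X Y.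
Proof.
have e := braid_nat f (idm B); strictify_eq e e'.
rewrite !interleaveE; strictify.
strict_nat_of v v_nat; strict_nat_of f f_nat; strict_nat_of h h_nat.
crw e' under A.
crw <- v_nat; crw <- v_nat; congr (_ ∘ (_ ∘ _)).
by rewrite -!tens_compr cross_nat.
Qed.

Lemma interleave_iso (A B E X Y : C) (v : hom (A ⊗ B) E) : is_iso v -> is_iso (interleave v X Y).
Proof.
move=> iv; rewrite !interleaveE.
by do ?[exact: iso_id | exact: iso_alpha | exact: iso_alphai | exact: braid_iso | exact: iv
       | apply: iso_comp | apply: iso_tens].
Qed.

End Interleave.


(** * Isomorphisms and invertible objects *)

Lemma dep_choice (I : Type) (T : I -> Type) (P : forall i, T i -> Prop) :
  (forall i, exists x, P i x) -> exists f : forall i, T i, forall i, P i (f i).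
Proof. by move=> ex; exists (fun i => sval (cid (ex i))) => i; exact: svalP. Qed.

Lemma scale_cancel (K : fieldType) (V : lmodType K) (a b : K) (T : V) :
  a *: T = b *: T -> T <> 0 -> a = b.
Proof.
move=> /eqP; rewrite -subr_eq0 -scalerBl scaler_eq0 subr_eq0.
by case/orP => /eqP.
Qed.

Lemma scale_fixed (K : fieldType) (V : lmodType K) (c : K) (T : V) :
  T = c *: T -> T <> 0 -> c = 1.
Proof. by move=> e; apply: scale_cancel; rewrite scale1r. Qed.

Section Isomorphic.
Variables (K : fieldType) (C : linCategory K).
Implicit Types X Y Z g : C.

Lemma isomorphic_refl X : X ≅ X.
Proof. by exists (idm X); exact: iso_id. Qed.

Lemma isomorphic_sym X Y : X ≅ Y -> Y ≅ X.
Proof. by case=> f [f' [f'f ff']]; exists f'; exists f. Qed.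

Lemma isomorphic_trans Y X Z : X ≅ Y -> Y ≅ Z -> X ≅ Z.
Proof. by move=> [f fi] [h hi]; exists (h ∘ f); exact: iso_comp. Qed.

End Isomorphic.

Lemma isomorphic_tens (K : fieldType) (C : monoidalCategory K) (X X' Y Y' : C) :
  X ≅ X' -> Y ≅ Y' -> X ⊗ Y ≅ X' ⊗ Y'.
Proof. by move=> [f fi] [h hi]; exists (f ⊠ h); exact: iso_tens. Qed.

Section Invertible.
Variables (K : fieldType) (C : braidedFusionCategory K).
Implicit Types X Y Z g : C.

Lemma id_one_neq0 : idm (@one _ C) <> 0.
Proof.
move=> e; have := end_one C; suff -> : {: hom (@one _ C) one}%VS = 0%VS by rewrite dimv0.
apply/eqP; rewrite -subv0; apply/subvP => f _.
by rewrite -(compm1 f) e compm0 mem0v.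
Qed.

Lemma end_one_scalar (f : hom (@one _ C) one) : exists c, f = c *: idm one.
Proof.
suff : (f \in <[idm (@one _ C)]>)%VS by move/vlineP.
suff -> : (<[idm (@one _ C)]> = fullv)%VS by rewrite memvf.
apply/eqP; rewrite eqEdim subvf end_one dim_vline.
by have /eqP -> := id_one_neq0.
Qed.

Lemma invertible_one : @invertible K C one.
Proof. by exists one; split; exists (lambda one); exact: iso_lambda. Qed.

Lemma invertible_tens X Y : invertible X -> invertible Y -> invertible (X ⊗ Y).
Proof.
have half (A B A' B' : C) : A ⊗ A' ≅ one -> B ⊗ B' ≅ one ->
    (A ⊗ B) ⊗ (B' ⊗ A') ≅ one.
  move=> AA BB.
  apply: (@isomorphic_trans _ C (A ⊗ (B ⊗ (B' ⊗ A')))).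
    by exists (alpha A B (B' ⊗ A')); exact: iso_alpha.
  apply: isomorphic_trans AA; apply: isomorphic_tens; first exact: isomorphic_refl.
  apply: (@isomorphic_trans _ C ((B ⊗ B') ⊗ A')).
    by exists (alphai B B' A'); exact: iso_alphai.
  apply: (@isomorphic_trans _ C (one ⊗ A')).
    by apply: isomorphic_tens => //; exact: isomorphic_refl.
  by exists (lambda A'); exact: iso_lambda.
move=> [X' [XX' X'X]] [Y' [YY' Y'Y]]; exists (Y' ⊗ X').
by split; apply: half.
Qed.

Lemma invertible_tpow g m : invertible g -> invertible (tpow g m).
Proof.
move=> ig; elim: m => [|m IH] /=; first exact: invertible_one.
exact: invertible_tens.
Qed.

(** Tensoring further by an inverse of [g] returns to tensoring by the unit. *)
Lemma tens_inj g X Y (f h : hom X Y) :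
  invertible g -> f ⊠ idm g = h ⊠ idm g -> f = h.
Proof.
move=> [g' [[i [i' [i'i ii']]] _]] e; apply: tens1_inj.
have ei : is_iso (idm X ⊠ i) by apply: iso_tens; [exact: iso_id | exists i'].
apply: (iso_epi ei); rewrite -!tensm_comp !compm1 !comp1m.
rewrite -(comp1m f) -(comp1m h) -(compm1 i) !tensm_comp; congr (_ ∘ _).
apply: (iso_epi (iso_alpha X g g')).
by rewrite -!tensm1 -!alpha_nat e.
Qed.

(** Conjugating [f ⊠ idm g'] by the isomorphism of [g ⊗ g'] with the unit gives [f'];
    that [f' ⊠ idm g] is [f] is checked after tensoring by [g']. *)
Lemma tens_full g X Y (f : hom (X ⊗ g) (Y ⊗ g)) :
  invertible g -> exists f' : hom X Y, f = f' ⊠ idm g.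
Proof.
move=> [g' [[i [i' [i'i ii']]] gg']].
pose f' : hom X Y := rho Y ∘ (idm Y ⊠ i) ∘ alpha Y g g' ∘ (f ⊠ idm g')
  ∘ alphai X g g' ∘ (idm X ⊠ i') ∘ rhoi X.
exists f'; apply: (@tens_inj g').
  by exists g; split=> //; exists i; exists i'.
strictify_eq i'i i'i'; strictify_eq ii' ii''.
rewrite /f'; strictify.
strict_nat_of i i_nat; strict_nat_of i' i'_nat; strict_nat_of f f_nat.
have -> : @hat _ C Empty (Cat (Letter g) (Letter g')) i' (g ⊗ g' ⊗ W) =
    idm g ⊠ (idm g' ⊠ @hat _ C Empty (Cat (Letter g) (Letter g')) i' W).
  apply: iso_epi (i'_nat _ _ _).
  by exists (@hat _ C (Cat (Letter g) (Letter g')) Empty i W); split; rewrite ?i'i' ?ii''.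
crw f_nat; crw i_nat under Y; crw i'i' under Y.
by rewrite comp1m.
Qed.

Lemma tens_inj_l g X Y (f h : hom X Y) :
  invertible g -> idm g ⊠ f = idm g ⊠ h -> f = h.
Proof.
move=> ig e; apply: (tens_inj ig); apply: (iso_mono (braid_iso Y g)).
by rewrite !braid_nat e.
Qed.

Lemma tens_full_l g X Y (f : hom (g ⊗ X) (g ⊗ Y)) :
  invertible g -> exists f' : hom X Y, f = idm g ⊠ f'.
Proof.
move=> ig; have [r [rb br]] := braid_iso g X.
have [h eh] := tens_full (braid g Y ∘ f ∘ r) ig; exists h.
apply: (iso_mono (braid_iso g Y)); rewrite braid_nat -eh -!compA rb.
by rewrite compm1.
Qed.

(** Fullness of the tensor product by [X] reduces this to the endomorphisms of the
    unit. *)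
Lemma end_invertible X (f : hom X X) : invertible X -> exists c, f = c *: idm X.
Proof.
move=> iX.
have [f' e] := tens_full (lambdai X ∘ f ∘ lambda X) iX.
have [c ec] := end_one_scalar f'; exists c.
have [l'l ll'] := lambda_iso X.
apply: (iso_epi (iso_lambda X)); apply: (iso_mono (iso_sym (lambda_iso X))).
by rewrite compA e ec tensZl tensm1 compZl comp1m compZr l'l.
Qed.

Lemma invertible_id_neq0 X : invertible X -> idm X <> 0.
Proof.
move=> iX e; apply: id_one_neq0.
by apply: (tens_inj iX); rewrite e !tens0r.
Qed.

Lemma hom_invertible X Y (f h : hom X Y) :
  invertible X -> is_iso h -> exists c, f = c *: h.
Proof.
move=> iX [h' [h'h hh']]; have [c e] := end_invertible (h' ∘ f) iX; exists c.
by rewrite -[f]comp1m -hh' -compA e compZr compm1.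
Qed.

Lemma neq0_iso X Y (f : hom X Y) : invertible X -> X ≅ Y -> f <> 0 -> is_iso f.
Proof.
move=> iX [h ih]; have [c ->] := hom_invertible f iX ih => c0.
by apply: iso_scale => //; apply/eqP => c1; apply: c0; rewrite c1 scale0r.
Qed.

Lemma invertible_iso X Y : X ≅ Y -> invertible X -> invertible Y.
Proof.
move=> XY [X' [XX X'X]]; exists X'; split.
  apply: isomorphic_trans XX; apply: isomorphic_tens; last exact: isomorphic_refl.
  exact: isomorphic_sym.
apply: isomorphic_trans X'X; apply: isomorphic_tens; first exact: isomorphic_refl.
exact: isomorphic_sym.
Qed.

End Invertible.


(** * Pairings with dual objects *)

Section Duals.
Variables (K : fieldType) (C : braidedFusionCategory K).
Implicit Types X Y Z : C.

(** A zigzag identity recovers [a] from its pairing with [X]. *)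
Lemma ev_inj Z X (a b : hom Z (dual X)) :
  ev X ∘ (a ⊠ idm X) = ev X ∘ (b ⊠ idm X) -> a = b.
Proof.
move=> ab; have [_ zig] := dualP X.
strictify_eq ab ab'; strictify_eq zig zig'.
strictify.
strict_nat_of a a_nat; strict_nat_of b b_nat.
rewrite -[LHS]comp1m -[RHS]comp1m -(zig' W) -!compA -a_nat -b_nat.
by crw ab'.
Qed.

Lemma ev_curry Z X (p : hom (Z ⊗ X) one) : ev X ∘ (curry_dual p ⊠ idm X) = p.
Proof.
have [zig _] := dualP X; strictify_eq zig zig'.
rewrite /curry_dual; strictify.
strict_nat_of p p_nat.
crw <- p_nat; crw zig' under Z.
by rewrite compm1.
Qed.

End Duals.

(** * The monodromy with an invertible object *)

Section Monodromy.
Variables (K : fieldType) (C : braidedFusionCategory K) (g : C) (ig : invertible g).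
Implicit Types X Y Z : C.

(** The double braiding of [X] with [g], read as an endomorphism of [X]; such an
    endomorphism exists because tensoring by [g] is full. *)
Definition monodromy X : hom X X :=
  sval (cid (tens_full (braid g X ∘ braid X g) ig)).

Lemma monodromyE X : monodromy X ⊠ idm g = braid g X ∘ braid X g.
Proof. by rewrite /monodromy; case: cid. Qed.

Lemma monodromy_nat X Y (f : hom X Y) : monodromy Y ∘ f = f ∘ monodromy X.
Proof.
apply: (tens_inj ig); rewrite !tens_compl !monodromyE -compA braid_nat !compA.
by rewrite braid_nat.
Qed.

Lemma monodromy_tens X Y : monodromy (X ⊗ Y) = monodromy X ⊠ monodromy Y.
Proof.
have eX := monodromyE X; have eY := monodromyE Y.
strictify_eq eX eX'; strictify_eq eY eY'.
apply: (tens_inj ig); rewrite monodromyE; strictify.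
crw <- eX'; strict_nat_of (monodromy X) X_nat; crw <- X_nat.
by crw <- eY' under X.
Qed.

Lemma monodromy_one : monodromy one = idm one.
Proof. by apply: (tens_inj ig); rewrite monodromyE; strictify. Qed.

Lemma monodromy_scale X Y (f : hom X Y) x y :
  monodromy X = x *: idm X -> monodromy Y = y *: idm Y -> x != y -> f = 0.
Proof.
move=> ex ey xy; have := monodromy_nat f; rewrite ex ey compZl compZr comp1m compm1.
move/eqP; rewrite -subr_eq0 -scalerBl scaler_eq0 subr_eq0 eq_sym (negPf xy) /=.
by move/eqP.
Qed.

Definition monodromy_pow X n : hom X X := iter n (fun f => monodromy X ∘ f) (idm X).

Lemma monodromy_pow_nat X Y (f : hom X Y) n :
  monodromy_pow Y n ∘ f = f ∘ monodromy_pow X n.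
Proof.
elim: n => [|n IH] /=; first by rewrite comp1m compm1.
by rewrite -compA IH !compA monodromy_nat.
Qed.

Lemma monodromy_pow_scale X x n :
  monodromy X = x *: idm X -> monodromy_pow X n = x ^+ n *: idm X.
Proof.
move=> e; elim: n => [|n IH] /=; first by rewrite expr0 scale1r.
by rewrite IH e compZl compZr comp1m scalerA exprS.
Qed.

(** By the hexagons, each factor [g] of the power contributes one monodromy. *)
Lemma double_braid_tpow X n :
  braid (tpow g n) X ∘ braid X (tpow g n) = monodromy_pow X n ⊠ idm (tpow g n).
Proof.
elim: n => [|n IH] /=; first by strictify.
have eX := monodromyE X; strictify_eq eX eX'; strictify_eq IH IH'.
strictify.
crw IH' under g.
have e := braid_nat (monodromy_pow X n) (idm g); strictify_eq e e'.
by crw <- e'; crw <- eX'.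
Qed.

Lemma monodromy_pow_order X M : tpow g M ≅ one -> monodromy_pow X M = idm X.
Proof.
move=> [f fi]; apply: (tens_inj (invertible_tpow M ig)); rewrite -double_braid_tpow.
apply: (iso_mono (iso_tens (iso_id X) fi)).
rewrite tensm1 compm1 compA -braid_nat -compA -braid_nat compA.
have -> : braid one X ∘ braid X one = idm (X ⊗ one) by strictify.
by rewrite comp1m.
Qed.

(** The monodromy of [dual X ⊗ X] is trivial after [ev X], by naturality. *)
Lemma monodromy_dual X x y :
  monodromy X = x *: idm X -> x * y = 1 -> monodromy (dual X) = y *: idm (dual X).
Proof.
move=> ex xy; apply: ev_inj.
have := monodromy_nat (ev X); rewrite monodromy_one comp1m monodromy_tens ex => e.
by rewrite tensZl tensm1 compZr compm1 {2}e tensZr compZr scalerA mulrC xy scale1r.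
Qed.

End Monodromy.

Section Split.
Variables (K : fieldType) (C : abelianCategory K).

(** A kernel of [1 - e] splits an idempotent [e]. *)
Lemma idempotent_split (X : C) (e : hom X X) : e ∘ e = e ->
  exists (N : C) (i : hom N X) (p : hom X N), p ∘ i = idm N /\ i ∘ p = e.
Proof.
move=> ee; have [N [i [ki uk]]] := has_kernels (idm X - e).
have e0 : (idm X - e) ∘ e = 0 by rewrite compBl comp1m ee subrr.
have [p [ip _]] := uk _ e e0; exists N, i, p; split=> //.
have [q [_ uq]] := uk _ i ki.
have ei : e ∘ i = i.
  by apply/esym/eqP; rewrite -subr_eq0 -{1}(comp1m i) -compBl ki.
by rewrite -(uq (p ∘ i)) ?(uq (idm N)) ?compm1 // compA ip.
Qed.

End Split.

(** * The grading by degrees *)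

Section Degrees.
Variables (K : fieldType) (C : modularCategory K) (g : C) (M : nat) (zeta : K).
Hypotheses (ig : invertible g) (order_g : has_order g M).
Hypothesis zeta_prim : M.-primitive_root zeta.
Implicit Types X Y Z : C.

Lemma in_degreeP m X : in_degree g zeta m X <-> monodromy ig X = zeta ^+ m *: idm X.
Proof.
rewrite /in_degree -(monodromyE ig); split=> [e|->]; last by rewrite tensZl tensm1.
by apply: (tens_inj ig); rewrite e tensZl tensm1.
Qed.

Lemma hom_degree0 (m n : 'I_M) X Y (f : hom X Y) :
  in_degree g zeta m X -> in_degree g zeta n Y -> m != n -> f = 0.
Proof.
move=> /in_degreeP ex /in_degreeP ey mn; apply: (monodromy_scale f ex ey).
by rewrite (eq_prim_root_expr zeta_prim) !modn_small.
Qed.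

Lemma in_degree_modn m n X : m = n %[mod M] ->
  in_degree g zeta m X -> in_degree g zeta n X.
Proof.
move=> mn; rewrite /in_degree => ->; congr (_ *: _).
by apply/eqP; rewrite (eq_prim_root_expr zeta_prim) mn.
Qed.

Lemma in_degree_one : in_degree g zeta 0 (one : C).
Proof. by apply/in_degreeP; rewrite monodromy_one expr0 scale1r. Qed.

Lemma in_degree_tens m n X Y :
  in_degree g zeta m X -> in_degree g zeta n Y -> in_degree g zeta (m + n) (X ⊗ Y).
Proof.
move=> /in_degreeP ex /in_degreeP ey; apply/in_degreeP.
by rewrite monodromy_tens ex ey tensZl tensZr tensm1 scalerA exprD.
Qed.

Lemma in_degree_dual m n X : m + n = 0 %[mod M] ->
  in_degree g zeta m X -> in_degree g zeta n (dual X).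
Proof.
move=> mn /in_degreeP ex; apply/in_degreeP; apply: monodromy_dual ex _.
by rewrite -exprD -(expr0 zeta); apply/eqP; rewrite (eq_prim_root_expr zeta_prim) mn.
Qed.

Lemma in_degree_iso m X Y : X ≅ Y -> in_degree g zeta m X -> in_degree g zeta m Y.
Proof.
move=> [f fi] /in_degreeP ex; apply/in_degreeP; apply: (iso_epi fi).
by rewrite monodromy_nat ex compZr compm1 compZl comp1m.
Qed.

Hypothesis M_unit : M%:R != 0 :> K.

(** The projection onto the eigenvalue [zeta ^+ m] of the monodromy, whose order
    divides [M]. *)
Definition degree_proj m X : hom X X :=
  M%:R^-1 *: \sum_(k < M) zeta ^- (m * k) *: monodromy_pow ig X k.

Lemma M_gt0 : (0 < M)%N. Proof. exact: prim_order_gt0 zeta_prim. Qed.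

Lemma zeta_neq0 : zeta != 0.
Proof.
apply/eqP => z0; have := prim_expr_order zeta_prim.
by rewrite z0 expr0n gtn_eqF ?M_gt0 // => /eqP; rewrite eq_sym oner_eq0.
Qed.

Lemma degree_proj_eigen m X Y (f : hom Y X) :
  monodromy ig X ∘ f = zeta ^+ m *: f -> degree_proj m X ∘ f = f.
Proof.
move=> ef; have pf k : monodromy_pow ig X k ∘ f = zeta ^+ (m * k) *: f.
  elim: k => [|k IH] /=; first by rewrite comp1m muln0 scale1r.
  by rewrite -compA IH compZr ef scalerA -exprD mulnS addnC.
rewrite /degree_proj compZl comp_suml.
under eq_bigr do rewrite compZl pf scalerA mulVf ?expf_neq0 ?zeta_neq0 // scale1r.
by rewrite sumr_const card_ord -scaler_nat scalerA mulVf ?scale1r.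
Qed.

Lemma monodromy_degree_proj m X :
  monodromy ig X ∘ degree_proj m X = zeta ^+ m *: degree_proj m X.
Proof.
have [_ oM _] := order_g.
have powM : monodromy_pow ig X M = idm X by exact: monodromy_pow_order.
rewrite /degree_proj compZr scalerA mulrC -scalerA; congr (_ *: _).
rewrite comp_sumr scaler_sumr.
have zM k : zeta ^+ (k * M) = 1 by rewrite mulnC exprM (prim_expr_order zeta_prim) expr1n.
have := M_gt0; case: M powM zM => // M' powM zM _.
rewrite big_ord_recr big_ord_recl /= addrC; congr (_ + _).
  rewrite compZr -[X in _ *: X]/(monodromy_pow ig X M'.+1) powM scalerA; congr (_ *: _).
  rewrite muln0 expr0 invr1 mulr1; apply/eqP.
  rewrite -(inj_eq (mulIf (expf_neq0 (m * M') zeta_neq0))) mulVf ?expf_neq0 ?zeta_neq0 //.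
  by rewrite -exprD -mulnS zM.
apply: eq_bigr => i _; rewrite compZr /bump /= scalerA; congr (_ *: _).
by rewrite mulnS exprD invfM mulrA mulfV ?mul1r // expf_neq0 ?zeta_neq0.
Qed.

Lemma sum_degree_proj X : \sum_(m < M) degree_proj m X = idm X.
Proof.
rewrite /degree_proj -scaler_sumr exchange_big /=.
have e0 (k : 'I_M) : \sum_(m < M) zeta ^- (m * k) = if k == 0%N :> nat then M%:R else 0.
  case: eqP => [->|/eqP k0].
    under eq_bigr do rewrite muln0 expr0 invr1.
    by rewrite sumr_const card_ord.
  have z1 : zeta ^- k != 1.
    by rewrite invr_eq1 -(prim_order_dvd zeta_prim) gtnNdvd ?lt0n.
  under eq_bigr do rewrite mulnC exprM -exprVn.
  (* A geometric sum, telescoping after multiplication by its ratio minus 1. *)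
  apply: (mulfI (x := zeta ^- k - 1)); first by rewrite subr_eq0.
  rewrite -subrX1 exprVn -exprM mulnC exprM (prim_expr_order zeta_prim) expr1n.
  by rewrite invr1 subrr mulr0.
under eq_bigr => k _ do rewrite -scaler_suml e0.
rewrite (bigD1 (Ordinal M_gt0)) //= big1 ?addr0 => [|k].
  by rewrite scalerA mulVf ?scale1r.
by rewrite -val_eqE /= => /negPf ->; rewrite scale0r.
Qed.

Lemma in_degree_split m X N (i : hom N X) (p : hom X N) :
  p ∘ i = idm N -> i ∘ p = degree_proj m X -> in_degree g zeta m N.
Proof.
move=> pi ip; apply/in_degreeP.
have ti : monodromy ig X ∘ i = zeta ^+ m *: i.
  have -> : i = degree_proj m X ∘ i by rewrite -ip -compA pi compm1.
  by rewrite compA monodromy_degree_proj compZl.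
by rewrite -[monodromy _ _]comp1m -pi -compA -monodromy_nat ti compZr.
Qed.

(** The monodromy of [X] has order dividing [M], so its spectral projections sum to
    the identity; splitting them gives the homogeneous components. *)
Theorem grading_exists : inhabited (grading g M zeta).
Proof.
have split (Xm : C * 'I_M) : exists N : {N : C & (hom N Xm.1 * hom Xm.1 N)%type},
    (projT2 N).2 ∘ (projT2 N).1 = idm (projT1 N) /\
    (projT2 N).1 ∘ (projT2 N).2 = degree_proj Xm.2 Xm.1.
  have [|N [i [p ip]]] := @idempotent_split _ C Xm.1 (degree_proj Xm.2 Xm.1).
    by apply: degree_proj_eigen; exact: monodromy_degree_proj.
  by exists (existT _ N (i, p)).
have [N NP] := dep_choice split.
have deg X (m : 'I_M) : in_degree g zeta m (projT1 (N (X, m))).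
  by have [pi ip] := NP (X, m); exact: in_degree_split pi ip.
split; apply: (@Grading _ C g M zeta (fun X m => projT1 (N (X, m)))
  (fun X m => (projT2 (N (X, m))).1) (fun X m => (projT2 (N (X, m))).2) deg) => X; split.
- by move=> m; case: (NP (X, m)).
- by move=> m n mn; apply: (@hom_degree0 n m); rewrite // eq_sym.
by rewrite -[RHS]sum_degree_proj; apply: eq_bigr => m _; case: (NP (X, m)).
Qed.

End Degrees.

Arguments in_degreeP {K C g zeta} ig {m X}.


(** * The degrees that occur generate the integers modulo M *)

Section Transparent.
Variables (K : fieldType) (C : modularCategory K) (g : C) (M : nat) (zeta : K).
Hypotheses (ig : invertible g) (order_g : has_order g M).
Hypothesis zeta_prim : M.-primitive_root zeta.
Implicit Types X Y Z : C.

(** The composite [i ∘ p] is a scalar, as [X] is invertible, and fixes [i]. *)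
Lemma invertible_dsum_one X n :
  invertible X -> X ≅ dsum (fun _ : 'I_n => one : C) -> X ≅ one.
Proof.
move=> iX [f [f' [f'f ff']]].
case: n f f' f'f ff' => [|n] f f' f'f ff'.
  have [_ _ S0] := dsumP (fun _ : 'I_0 => one : C).
  case: (invertible_id_neq0 iX); rewrite -f'f -[f]comp1m -S0 big_ord0 comp0m.
  by rewrite compm0.
have [pi _ _] := dsumP (fun _ : 'I_n.+1 => one : C).
pose i : hom one X := f' ∘ dinj (fun _ : 'I_n.+1 => one : C) ord0.
pose p : hom X one := dproj (fun _ : 'I_n.+1 => one : C) ord0 ∘ f.
have pi1 : p ∘ i = idm one.
  by rewrite /p /i -compA (compA f) ff' comp1m pi.
exists p; exists i; split=> //.
have [c e] := end_invertible (i ∘ p) iX; rewrite e.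
suff -> : c = 1 by rewrite scale1r.
apply: (@scale_fixed _ _ _ i) => [|i0]; last by apply: (@id_one_neq0 _ C); rewrite -pi1 i0 compm0.
by rewrite -[in RHS](comp1m i) -compZl -e -compA pi1 compm1.
Qed.

Variable D : grading g M zeta.

(** The hypothesis makes the double braiding of [g ^ n] with every homogeneous
    component trivial, so [g ^ n] lies in the symmetric centre; by modularity it is
    a multiple of the unit, and it is invertible. *)
Lemma tpow_trivial n :
  (forall (m : 'I_M) X, in_degree g zeta m X -> idm X <> 0 -> zeta ^+ (m * n) = 1) ->
  tpow g n ≅ one.
Proof.
move=> triv.
have pow1 X : monodromy_pow ig X n = idm X.
  have [_ _ sX] := hcomp_sum D X.
  rewrite -[LHS]compm1 -sX comp_sumr; apply: eq_bigr => m _.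
  rewrite compA monodromy_pow_nat.
  have deg := hcomp_degree D X m.
  have [i0|i0] := pselect (idm (hcomp D X m) = 0).
    by rewrite -(compm1 (hinj D X m)) i0 !(compm0, comp0m).
  have e : monodromy ig (hcomp D X m) = zeta ^+ m *: idm _ by apply/in_degreeP.
  by rewrite (monodromy_pow_scale _ e) -exprM (triv _ _ deg i0) scale1r compm1.
have dbl X : braid (tpow g n) X ∘ braid X (tpow g n) = idm _.
  by rewrite (double_braid_tpow ig) pow1 tensm1.
have [X|k] := @trivial_centre _ C (tpow g n).
  have [s [sb bs]] := braid_iso X (tpow g n).
  suff -> : braid (tpow g n) X = s by rewrite bs.
  by rewrite -[LHS]compm1 -bs compA dbl comp1m.
by apply: invertible_dsum_one; exact: invertible_tpow.
Qed.

(** Otherwise some prime [p] divides the order of [x], hence [M] and, being prime,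
    every degree that occurs; then [g ^ (M / p)] is trivial, against the order of
    [g]. *)
Lemma degrees_generate (x : K) : x ^+ M = 1 ->
  (forall (m : 'I_M) X, in_degree g zeta m X -> idm X <> 0 -> x ^+ (m * m) = 1) ->
  x = 1.
Proof.
move=> xM sq; have M0 : (0 < M)%N := prim_order_gt0 zeta_prim.
have [e ex eM] := prim_order_exists M0 xM.
have [e1|e1] := eqVneq e 1%N; first by rewrite -(prim_expr_order ex) e1 expr1.
have e_gt1 : (1 < e)%N.
  by rewrite ltn_neqAle eq_sym e1 (prim_order_gt0 ex).
have pp := pdiv_prime e_gt1; set p := pdiv e in pp.
have pM : (p %| M)%N := dvdn_trans (pdiv_dvd e) eM.
have [_ _ minM] := order_g.
case: (minM (M %/ p)%N).
  by rewrite divn_gt0 ?prime_gt0 // dvdn_leq //= ltn_Pdiv ?prime_gt1.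
apply: tpow_trivial => m X deg X0.
have pm : (p %| m)%N.
  have := dvdn_trans (pdiv_dvd e) (etrans (prim_order_dvd ex _) (introT eqP (sq m X deg X0))).
  by rewrite Euclid_dvdM // orbb.
rewrite -(divnK pm) -mulnA [(p * _)%N]mulnC divnK // mulnC exprM.
by rewrite (prim_expr_order zeta_prim) expr1n.
Qed.

End Transparent.

(** * The self-braiding of powers of g *)

Section SelfBraiding.
Variables (K : fieldType) (C : braidedFusionCategory K) (g : C) (q : K).
Hypotheses (ig : invertible g) (q_def : braid g g = q *: idm (g ⊗ g)).
Implicit Types X Y : C.

Lemma self_braid_tens X Y a b c :
  braid X X = a *: idm _ -> braid Y Y = b *: idm _ ->
  braid X Y ∘ braid Y X = c *: idm _ ->
  braid (X ⊗ Y) (X ⊗ Y) = (a * b * c) *: idm _.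
Proof.
move=> ea eb ec; strictify_eq ea ea'; strictify_eq eb eb'; strictify_eq ec ec'.
strictify.
rewrite ea' eb' !(tensZr, tensm1) !(compZl, compZr) !comp1m.
rewrite -tens_compr ec' tensZr tensm1 !scalerA; congr (_ *: _).
by rewrite [b * a]mulrC.
Qed.

Lemma monodromy_tpow n : monodromy ig (tpow g n) = (q ^+ 2) ^+ n *: idm _.
Proof.
elim: n => [|n IH] /=; first by rewrite monodromy_one expr0 scale1r.
rewrite monodromy_tens IH.
have -> : monodromy ig g = q ^+ 2 *: idm g.
  apply: (tens_inj ig); rewrite monodromyE q_def compZl compZr comp1m scalerA.
  by rewrite tensZl tensm1.
by rewrite tensZl tensZr tensm1 scalerA -?exprS -?exprSr.
Qed.

Lemma self_braid_tpow n : braid (tpow g n) (tpow g n) = q ^+ (n * n) *: idm _.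
Proof.
elim: n => [|n IH] /=; first by rewrite expr0 scale1r; strictify.
rewrite (self_braid_tens q_def IH (c := (q ^+ 2) ^+ n)).
  congr (_ *: _); rewrite -exprM -exprS -exprD; congr (_ ^+ _).
  by lia.
by rewrite -(monodromyE ig) monodromy_tpow tensZl tensm1.
Qed.

(** The unit braids trivially with itself, and [g ^ M] is isomorphic to it. *)
Lemma quad_order M : tpow g M ≅ one -> q ^+ (M * M) = 1.
Proof.
move=> [f fi]; have := braid_nat f f.
have -> : braid one one = idm (one ⊗ one : C) by strictify.
rewrite self_braid_tpow comp1m compZr compm1 => e.
have ff0 : f ⊠ f <> 0.
  apply: iso_neq0; first exact: iso_tens.
  by apply: invertible_id_neq0; apply: invertible_tens; exact: invertible_tpow.
exact: scale_fixed e ff0.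
Qed.

End SelfBraiding.

(** Both [q ^ (2 M)] and [q ^ (M * M)] are trivial, which settles the odd case.  If
    [M] is even then [A = M / r] is even, [A + 1] being coprime to [M], so that
    [M] is a multiple of twice the order [r] of [q ^ 2]. *)
Lemma root_order (K : fieldType) (q zeta : K) (M r : nat) :
  M.-primitive_root zeta -> r.-primitive_root (q ^+ 2) ->
  zeta ^+ (M %/ r) = q ^+ 2 -> coprime (M %/ r + 1) M -> q ^+ (M * M) = 1 ->
  q ^+ M = 1.
Proof.
move=> zM rq zq cop qq.
have q2M : (q ^+ 2) ^+ M = 1.
  by rewrite -zq -exprM mulnC exprM (prim_expr_order zM) expr1n.
have rM : (r %| M)%N by rewrite (prim_order_dvd rq) q2M.
have [oM|eM] := boolP (odd M).
  have e : (M * M = M + 2 * (M * M./2))%N.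
    by have := odd_double_half M; rewrite oM -muln2 /=; nia.
  by move: qq; rewrite e exprD !exprM q2M expr1n mulr1.
have eA : ~~ odd (M %/ r).
  apply/negP => oA; have : (2 %| gcdn (M %/ r + 1) M)%N.
    by rewrite dvdn_gcd !dvdn2 oddD oA eM.
  by rewrite (eqP cop).
have -> : M = (2 * (r * (M %/ r)./2))%N.
  have := divnK rM; have := odd_double_half (M %/ r); rewrite (negPf eA).
  by rewrite -muln2 add0n; nia.
by rewrite !exprM (prim_expr_order rq) expr1n.
Qed.


(** * Fusion maps between the powers of g *)

Section FusionMaps.
Variables (K : fieldType) (C : braidedFusionCategory K) (g : C) (M' : nat) (q : K).
Let M := M'.+1.
Hypothesis q_def : braid g g = q *: idm (g ⊗ g).
Hypothesis qM : q ^+ M = 1.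
Variable phi : hom (g ⊗ tpow g M') one.
Hypothesis phi_iso : is_iso phi.
Notation pw := (tpow g).

Definition tpow_cast m n (e : m = n) : hom (pw m) (pw n) :=
  ecast i (hom (pw m) (pw i)) e (idm (pw m)).

(** The identity for [k' = k + 1] and [phi] for [k = M - 1], [k' = 0]; keeping [k'] as
    an index avoids transporting along [k' = k + 1 mod M].  Zero is a default. *)
Definition step (k k' : nat) : hom (g ⊗ pw k) (pw k') :=
  match k.+1 =P k' with
  | ReflectT e => tpow_cast e
  | ReflectF _ =>
    match k =P M', 0%N =P k' with
    | ReflectT e, ReflectT e' => tpow_cast e' ∘ phi ∘ (idm g ⊠ tpow_cast e)
    | _, _ => 0
    end
  end.

(** The factors [g] of [g ^ m] are multiplied into [g ^ n] one by one, the last first,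
    applying [phi] each time [M] factors have been gathered. *)
Fixpoint fuse (m n k : nat) : hom (pw m ⊗ pw n) (pw k) :=
  match m with
  | 0 => if n =P k is ReflectT e then tpow_cast e ∘ lambda (pw n) else 0
  | m'.+1 => step ((m' + n) %% M) k ∘ (idm g ⊠ fuse m' n ((m' + n) %% M))
               ∘ alpha g (pw m') (pw n)
  end.

Lemma tpow_castE m (e : m = m) : tpow_cast e = idm (pw m).
Proof. by rewrite (eq_irrelevance e erefl). Qed.

Lemma stepS k : step k k.+1 = idm (pw k.+1).
Proof. by rewrite /step; case: eqP => // e; rewrite tpow_castE. Qed.

Lemma step_wrap : step M' 0 = phi.
Proof.
rewrite /step; case: eqP => // _; case: eqP => // e; case: eqP => // e'.
by rewrite !tpow_castE tensm1 compm1 comp1m.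
Qed.

Lemma fuse0 n : fuse 0 n n = lambda (pw n).
Proof. by rewrite /=; case: eqP => // e; rewrite tpow_castE comp1m. Qed.

Lemma fuseS m n j k : j = ((m + n) %% M)%N ->
  fuse m.+1 n k = step j k ∘ (idm g ⊠ fuse m n j) ∘ alpha g (pw m) (pw n).
Proof. by move=> ->. Qed.

Lemma fusem0 m : (m < M)%N -> fuse m 0 m = rho (pw m).
Proof.
elim: m => [|m IH] mM; first by rewrite fuse0; cbn [tpow]; strictify.
rewrite (@fuseS m 0 m) ?addn0 ?modn_small //; try exact: ltnW.
rewrite stepS IH; last exact: ltnW.
by cbn [tpow]; strictify.
Qed.

(** The canonical reassociation, without any braiding. *)
Fixpoint rotate m : hom (pw m ⊗ g) (g ⊗ pw m) :=
  match m with
  | 0 => rhoi g ∘ lambda g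
  | m'.+1 => (idm g ⊠ rotate m') ∘ alpha g (pw m') g
  end.

(** No wrapping occurs between [p] and [p + 1], so one factor of [g] may be counted
    on either side. *)
Lemma fuse_shift m p k : (p.+1 < M)%N -> k = ((m + p.+1) %% M)%N ->
  fuse m p.+1 k ∘ alpha (pw m) g (pw p) = fuse m.+1 p k ∘ (rotate m ⊠ idm (pw p)).
Proof.
move=> pM; elim: m k => [|m IH] k ek.
  rewrite ek add0n modn_small // fuse0 (@fuseS 0 p p) ?modn_small //; last exact: ltnW.
  by rewrite stepS fuse0; cbn [tpow rotate]; strictify.
have e := IH _ erefl.
rewrite (@fuseS m p.+1 _ k erefl) (@fuseS m.+1 p ((m + p.+1) %% M) k) ?addSnnS //.
move: e; set j := ((m + p.+1) %% M)%N; cbn [tpow rotate] => e.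
strictify_eq e e'; strictify.
by crw e' under g.
Qed.

Lemma rotate_braid m : braid (pw m) g = q ^+ m *: rotate m.
Proof.
elim: m => [|m IH]; first by rewrite expr0 scale1r; cbn [tpow rotate]; strictify.
cbn [tpow rotate]; strictify_eq IH IH'; strictify_eq q_def q_def'; strictify.
by rewrite IH' q_def' tensZr compZl compZr comp1m scalerA exprS.
Qed.

Lemma braid_rotate m : rotate m ∘ braid g (pw m) = q ^+ m *: idm (g ⊗ pw m).
Proof.
elim: m => [|m IH]; first by rewrite expr0 scale1r; cbn [tpow rotate]; strictify.
cbn [tpow rotate]; strictify_eq IH IH'; strictify_eq q_def q_def'; strictify.
by rewrite compA -tens_compr IH' q_def' tensZr compZl compZr compm1 scalerA tensm1 exprSr.
Qed.

(** Moving [phi] past [g] without braiding costs the scalar [q ^ M], that is,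
    nothing: this is where the associator of the powers of [g] is trivial. *)
Lemma phi_rotate : (idm g ⊠ phi) ∘ rotate M = rhoi g ∘ lambda g ∘ (phi ⊠ idm g).
Proof.
have -> : rotate M = braid (pw M) g by rewrite rotate_braid qM scale1r.
rewrite -[X in X ∘ _ = _]/(idm g ⊠ phi) -braid_nat.
by congr (_ ∘ _); strictify.
Qed.

(** By definition [fuse M p p] applies [phi] to the last [M] of the [M + p] factors
    [g].  In an induction on [p], [phi_rotate] moves [phi] by one factor to the left. *)
Lemma fuse_wrap p : (p < M)%N -> fuse M p p = lambda (pw p) ∘ (phi ⊠ idm (pw p)).
Proof.
elim: p => [|p IH] pM.
  rewrite (@fuseS M' 0 M') ?addn0 ?modn_small // step_wrap fusem0 //.
  by rewrite /M; cbn [tpow]; strictify.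
apply: (iso_epi (iso_alpha (pw M) g (pw p))).
rewrite fuse_shift // ?modnDl ?modn_small //.
rewrite (@fuseS M p p) ?modnDl ?modn_small ?(ltnW pM) // stepS IH ?(ltnW pM) //.
have e := phi_rotate; rewrite ?/M in e |- *; cbn [tpow rotate] in e |- *.
strictify_eq e e'; strictify.
by crw e'.
Qed.

(** This is the definition of [fuse] unless [j + 1 = M], and [fuse_wrap] then. *)
Lemma fuse_step j p j' l k : (j < M)%N -> (p < M)%N ->
  j' = (j.+1 %% M)%N -> l = ((j + p) %% M)%N -> k = ((j + p).+1 %% M)%N ->
  fuse j' p k ∘ (step j j' ⊠ idm (pw p)) =
  step l k ∘ (idm g ⊠ fuse j p l) ∘ alpha g (pw j) (pw p).
Proof.
move=> jM pM -> el ek; rewrite -(fuseS k el).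
have [jM'|] := ltnP j.+1 M; first by rewrite modn_small // stepS tensm1 compm1.
rewrite ltnS => Mj; have ej : j = M' by apply/eqP; rewrite eqn_leq Mj -ltnS jM.
rewrite {}ej in el ek *; rewrite modnn step_wrap.
have -> : k = p by rewrite ek -addSn modnDl modn_small.
by rewrite fuse0 fuse_wrap.
Qed.

Lemma fuse_assoc m n p mn np k : (n < M)%N -> (p < M)%N ->
  mn = ((m + n) %% M)%N -> np = ((n + p) %% M)%N -> k = ((mn + p) %% M)%N ->
  fuse mn p k ∘ (fuse m n mn ⊠ idm (pw p)) =
  fuse m np k ∘ (idm (pw m) ⊠ fuse n p np) ∘ alpha (pw m) (pw n) (pw p).
Proof.
move=> nM pM; elim: m mn k => [|m IH] mn k emn enp ek.
  have -> : k = np by rewrite ek enp emn modnDml.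
  have -> : mn = n by rewrite emn add0n modn_small.
  by rewrite !fuse0; cbn [tpow]; strictify.
pose j := ((m + n) %% M)%N; pose l := ((j + p) %% M)%N.
have jM : (j < M)%N by rewrite ltn_mod.
have el : l = ((m + np) %% M)%N by rewrite /l /j enp modnDml modnDmr addnA.
have emn' : mn = (j.+1 %% M)%N by rewrite emn /j -[in RHS]addn1 modnDml addn1.
have ek' : k = ((j + p).+1 %% M)%N by rewrite ek emn' modnDml.
rewrite (@fuseS m n j mn erefl) (@fuseS m np l k el).
have e1 := fuse_step jM pM emn' erefl ek'.
have e2 := IH j l erefl enp erefl.
rewrite -/l in e1; cbn [tpow] in e1, e2 |- *.
strictify_eq e1 e1'; strictify_eq e2 e2'; strictify.
by crw e1'; crw e2' under g.
Qed.

(** Each factor of [g ^ m] contributes [q ^ n] by [braid_rotate]. *)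
Lemma fuse_braid m n k : (m < M)%N -> (n < M)%N -> k = ((m + n) %% M)%N ->
  fuse n m k ∘ braid (pw m) (pw n) = q ^+ (m * n) *: fuse m n k.
Proof.
elim: m k => [|m IH] k mM nM ek.
  rewrite ek add0n modn_small // fuse0 fusem0 // mul0n expr0 scale1r.
  by cbn [tpow]; strictify.
have mM' := ltnW mM; pose j := ((m + n) %% M)%N.
have e := IH j mM' nM erefl.
have shift : fuse n m.+1 k ∘ alpha (pw n) g (pw m) =
    step j k ∘ (idm g ⊠ fuse n m j) ∘ alpha g (pw n) (pw m) ∘ (rotate n ⊠ idm (pw m)).
  by rewrite fuse_shift ?(@fuseS n m j k) // 1?addnC // ek addnC.
have r := braid_rotate n.
rewrite (@fuseS m n j k erefl); cbn [tpow] in shift |- *.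
strictify_eq e e'; strictify_eq shift shift'; strictify_eq r r'; strictify.
crw shift'; crw r'; rewrite !(compZl, compZr) comp1m; crw e' under g.
by rewrite tensZr !(compZl, compZr) scalerA -exprD mulSn.
Qed.

Lemma step_iso j k : (j < M)%N -> k = (j.+1 %% M)%N -> is_iso (step j k).
Proof.
move=> jM ->; have [jM'|] := ltnP j.+1 M.
  by rewrite modn_small // stepS; exact: iso_id.
rewrite ltnS => Mj; have -> : j = M' by apply/eqP; rewrite eqn_leq Mj -ltnS jM.
by rewrite modnn step_wrap.
Qed.

Lemma fuse_iso m n k : (n < M)%N -> k = ((m + n) %% M)%N -> is_iso (fuse m n k).
Proof.
move=> nM; elim: m k => [|m IH] k ek.
  by rewrite ek add0n modn_small // fuse0; exact: iso_lambda.
rewrite (@fuseS m n _ k erefl).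
apply: iso_comp (iso_alpha _ _ _); apply: iso_comp.
  by apply: step_iso; rewrite ?ltn_mod // ek -[in RHS]addn1 modnDml addn1.
by apply: iso_tens; [exact: iso_id | exact: IH].
Qed.

End FusionMaps.

Lemma admissible_exists (K : fieldType) (C : modularCategory K) (g : C) (M : nat) (q : K) :
  invertible g -> has_order g M -> braid g g = q *: idm (g ⊗ g) -> q ^+ M = 1 ->
  exists v : fusion_maps g M, admissible q v.
Proof.
move=> ig [M0 [phi phi_iso] _] q_def qM; case: M M0 phi phi_iso qM => // M' _ phi phi_iso qM.
exists (fun m n k : 'I_M'.+1 => @fuse _ _ g M' phi m n k).
have addE (m n k : 'I_M'.+1) : is_add m n k -> k = ((m + n) %% M'.+1)%N :> nat by move/eqP.
split=> [m n k /addE e | m n p mn np k /addE e1 /addE e2 /addE e3 | m n k /addE e].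
- apply: iso_neq0; first exact: fuse_iso.
  by apply: invertible_id_neq0; apply: invertible_tens; exact: invertible_tpow.
- exact: (fuse_assoc q_def).
exact: (fuse_braid q_def).
Qed.


(** * The shift functor *)

Lemma sum_only (V : nmodType) (I : finType) (n : I) (f : I -> V) :
  (forall i, i != n -> f i = 0) -> \sum_i f i = f n.
Proof. by move=> f0; rewrite (bigD1 n) //= big1 ?addr0. Qed.

Section DirectSums.
Variables (K : fieldType) (C : monoidalCategory K).

Lemma direct_sum_ext n (Xs : 'I_n -> C) (S Y : C) (inj : forall i, hom (Xs i) S) proj
    (a b : hom S Y) :
  is_direct_sum inj proj -> (forall i, a ∘ inj i = b ∘ inj i) -> a = b.
Proof.
move=> [_ _ s1] ab; rewrite -(compm1 a) -(compm1 b) -s1 !comp_sumr.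
by apply: eq_bigr => i _; rewrite !compA ab.
Qed.

Lemma direct_sum_tens_ext n (Xs : 'I_n -> C) (S Y : C) (inj : forall i, hom (Xs i) S) proj
    n' (Xs' : 'I_n' -> C) (S' : C) (inj' : forall i, hom (Xs' i) S') proj'
    (a b : hom (S ⊗ S') Y) :
  is_direct_sum inj proj -> is_direct_sum inj' proj' ->
  (forall i j, a ∘ (inj i ⊠ inj' j) = b ∘ (inj i ⊠ inj' j)) -> a = b.
Proof.
move=> [_ _ s1] [_ _ s1'] ab; rewrite -(compm1 a) -(compm1 b) -tensm1 -s1 -s1'.
rewrite tens_suml !comp_sumr; apply: eq_bigr => i _.
rewrite tens_sumr !comp_sumr; apply: eq_bigr => j _.
by rewrite tensm_comp !compA ab.
Qed.

Lemma direct_sum_tens3_ext n (Xs : 'I_n -> C) (S Y : C) (inj : forall i, hom (Xs i) S) proj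
    n' (Xs' : 'I_n' -> C) (S' : C) (inj' : forall i, hom (Xs' i) S') proj'
    n'' (Xs'' : 'I_n'' -> C) (S'' : C) (inj'' : forall i, hom (Xs'' i) S'') proj''
    (a b : hom ((S ⊗ S') ⊗ S'') Y) :
  is_direct_sum inj proj -> is_direct_sum inj' proj' -> is_direct_sum inj'' proj'' ->
  (forall i j k, a ∘ ((inj i ⊠ inj' j) ⊠ inj'' k) = b ∘ ((inj i ⊠ inj' j) ⊠ inj'' k)) ->
  a = b.
Proof.
move=> [_ _ s1] [_ _ s1'] [_ _ s1''] ab; rewrite -(compm1 a) -(compm1 b) -!tensm1.
rewrite -s1 !tens_suml !comp_sumr; apply: eq_bigr => i _.
rewrite -s1' tens_sumr !tens_suml !comp_sumr; apply: eq_bigr => j _.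
rewrite -s1'' tens_sumr !comp_sumr; apply: eq_bigr => k _.
by rewrite !tensm_comp !compA ab.
Qed.

End DirectSums.

Section Shift.
Variables (K : fieldType) (C : modularCategory K) (g : C) (M : nat) (zeta : K).
Hypothesis ig : invertible g.
Hypothesis zeta_prim : M.-primitive_root zeta.
Variable D : grading g M zeta.
Implicit Types X Y Z W V : C.
Notation pw := (tpow g).
Notation deg := (in_degree g zeta).
Notation F := (shift D).
Notation dinjF X := (dinj (shift_summand D X)).
Notation dprojF X := (dproj (shift_summand D X)).

Lemma hproj_deg0 (m n : 'I_M) W X (f : hom W X) : deg m W -> m != n -> hproj D X n ∘ f = 0.
Proof. by move=> dW mn; exact: (hom_degree0 ig zeta_prim _ dW (hcomp_degree D X n) mn). Qed.

Lemma hinj_deg0 (m n : 'I_M) W X (p : hom X W) : deg m W -> m != n -> p ∘ hinj D X n = 0.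
Proof.
rewrite eq_sym => dW mn.
exact: (hom_degree0 ig zeta_prim _ (hcomp_degree D X n) dW mn).
Qed.

Lemma hproj_degK (m : 'I_M) W X (f : hom W X) :
  deg m W -> hinj D X m ∘ (hproj D X m ∘ f) = f.
Proof.
move=> dW; have [_ _ s1] := hcomp_sum D X.
rewrite -[RHS]comp1m -s1 comp_suml (bigD1 m) //= big1 ?addr0 ?compA // => n nm.
by rewrite -compA (hproj_deg0 (m := m)) ?compm0 // eq_sym.
Qed.

Fact incl_key : unit. Proof. by []. Qed.

(** For [W] of degree [m] this is the image of [f], with [g ^ m ⊗ W] in the place of
    the isomorphic [shift D W].  The lemmas [shift_incl] and [tau_incl] below compute
    with such morphisms without mentioning components, and by [shift_ext] they
    suffice to compare morphisms out of [shift D X].  Locked like [hat]. *)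
Definition incl (m : 'I_M) W X (f : hom W X) : hom (pw m ⊗ W) (F X) :=
  locked_with incl_key (dinjF X m ∘ (idm (pw m) ⊠ (hproj D X m ∘ f))).

Lemma inclE (m : 'I_M) W X (f : hom W X) :
  incl m f = dinjF X m ∘ (idm (pw m) ⊠ (hproj D X m ∘ f)).
Proof. by rewrite /incl unlock. Qed.

Lemma incl_comp m V W X (f : hom W X) (h : hom V W) :
  incl m (f ∘ h) = incl m f ∘ (idm (pw m) ⊠ h).
Proof. by rewrite !inclE -compA -tens_compr compA. Qed.

Lemma incl_hinj m X : incl m (hinj D X m) = dinjF X m.
Proof. by rewrite !inclE; case: (hcomp_sum D X) => -> _ _; rewrite tensm1 compm1. Qed.

Lemma dproj_incl m W X (f : hom W X) :
  dprojF X m ∘ incl m f = idm (pw m) ⊠ (hproj D X m ∘ f).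
Proof. by rewrite !inclE compA; case: (dsumP (shift_summand D X)) => -> _ _; rewrite comp1m. Qed.

Lemma dproj_incl0 m n W X (f : hom W X) : m != n -> dprojF X m ∘ incl n f = 0.
Proof.
by move=> mn; rewrite !inclE compA; case: (dsumP (shift_summand D X)) => _ -> //; rewrite comp0m.
Qed.

Lemma shift_homogeneous_incl (m : 'I_M) W X (f : hom W X) :
  deg m W -> shift_homogeneous D m X ∘ incl m f = idm (pw m) ⊠ f.
Proof. by move=> dW; rewrite /shift_homogeneous -compA dproj_incl -tens_compr hproj_degK. Qed.

Lemma shift_homogeneous_incl0 m n W X (f : hom W X) :
  m != n -> shift_homogeneous D m X ∘ incl n f = 0.
Proof. by move=> mn; rewrite /shift_homogeneous -compA dproj_incl0 ?compm0. Qed.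

Lemma shift_homogeneous_incl_orth (k m : 'I_M) W W' X (f : hom W X) (p : hom X W') :
  deg m W -> p ∘ f = 0 ->
  (idm (pw k) ⊠ p) ∘ (shift_homogeneous D k X ∘ incl m f) = 0.
Proof.
move=> dW pf; have [->|km] := eqVneq k m.
  by rewrite shift_homogeneous_incl // -tens_compr pf tens0r.
by rewrite shift_homogeneous_incl0 // compm0.
Qed.

Lemma shift_incl (m : 'I_M) W X Y (a : hom X Y) (f : hom W X) :
  deg m W -> fmor F a ∘ incl m f = incl m (a ∘ f).
Proof.
move=> dW; rewrite /= comp_suml (bigD1 m) //= big1 ?addr0 => [|n nm]; last first.
  by rewrite -compA dproj_incl0 ?compm0.
rewrite -compA dproj_incl -compA -tens_compr !inclE; congr (_ ∘ (_ ⊠ _)).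
by rewrite -!compA hproj_degK.
Qed.

Lemma shift_ext X Y (a b : hom (F X) Y) :
  (forall m : 'I_M, a ∘ incl m (hinj D X m) = b ∘ incl m (hinj D X m)) -> a = b.
Proof.
move=> ab; apply: (direct_sum_ext (dsumP (shift_summand D X))) => m.
by have := ab m; rewrite incl_hinj.
Qed.

Lemma shift_tens_ext X X' Y (a b : hom (F X ⊗ F X') Y) :
  (forall (m n : 'I_M), a ∘ (incl m (hinj D X m) ⊠ incl n (hinj D X' n)) =
     b ∘ (incl m (hinj D X m) ⊠ incl n (hinj D X' n))) -> a = b.
Proof.
move=> ab.
apply: (direct_sum_tens_ext (dsumP (shift_summand D X)) (dsumP (shift_summand D X'))) => m n.
by have := ab m n; rewrite !incl_hinj.
Qed.

Lemma shift_tens3_ext X X' X'' Y (a b : hom ((F X ⊗ F X') ⊗ F X'') Y) :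
  (forall (m n p : 'I_M),
     a ∘ ((incl m (hinj D X m) ⊠ incl n (hinj D X' n)) ⊠ incl p (hinj D X'' p)) =
     b ∘ ((incl m (hinj D X m) ⊠ incl n (hinj D X' n)) ⊠ incl p (hinj D X'' p))) -> a = b.
Proof.
move=> ab; apply: (direct_sum_tens3_ext (dsumP (shift_summand D X))
  (dsumP (shift_summand D X')) (dsumP (shift_summand D X''))) => m n p.
by have := ab m n p; rewrite !incl_hinj.
Qed.

Lemma shift_linear : is_linear_functor F.
Proof.
split=> [X | X Y Z h f | X Y a f h].
- apply: shift_ext => m; rewrite shift_incl ?comp1m //; exact: hcomp_degree.
- apply: shift_ext => m; have dm := hcomp_degree D X m.
  by rewrite -compA !shift_incl // compA.
apply: shift_ext => m; have dm := hcomp_degree D X m.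
rewrite compDl compZl !shift_incl // !inclE compDl compZl compDr compZr tensDr tensZr.
by rewrite compDr compZr.
Qed.

Lemma shift_homogeneousK (m : 'I_M) X : deg m X ->
  inverse_of (shift_homogeneous D m X) (incl m (idm X)).
Proof.
move=> dX; split; last by rewrite shift_homogeneous_incl // tensm1.
apply: shift_ext => n; have dn := hcomp_degree D X n; rewrite comp1m -compA.
have [mn|mn] := eqVneq m n.
  by subst n; rewrite shift_homogeneous_incl // -incl_comp comp1m.
rewrite shift_homogeneous_incl0 // compm0 -[hinj D X n]comp1m (hinj_deg0 (m := m)) //.
by rewrite !inclE compm0 tens0r compm0.
Qed.

Lemma shift_homogeneous_nat (m : 'I_M) X Y (f : hom X Y) :
  shift_homogeneous D m Y ∘ fmor F f = (idm (pw m) ⊠ f) ∘ shift_homogeneous D m X.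
Proof.
apply: shift_ext => n; have dn := hcomp_degree D X n; rewrite -compA shift_incl // -[RHS]compA.
have [mn|mn] := eqVneq m n.
  by subst n; rewrite !shift_homogeneous_incl // tens_compr.
by rewrite !shift_homogeneous_incl0 // compm0.
Qed.

(** In a degree other than [k] both sides vanish, as [p] does. *)
Lemma shift_factor (k : 'I_M) W X Y (f : hom W Y) (p : hom X W) : deg k W ->
  fmor F (f ∘ p) = incl k f ∘ (idm (pw k) ⊠ p) ∘ shift_homogeneous D k X.
Proof.
move=> dW; apply: shift_ext => n; have dn := hcomp_degree D X n.
rewrite shift_incl // -[RHS]compA; have [kn|kn] := eqVneq k n.
  by subst n; rewrite shift_homogeneous_incl // -[RHS]compA -tens_compr -incl_comp compA.
rewrite shift_homogeneous_incl0 // compm0 -compA (hinj_deg0 (m := k)) //.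
by rewrite !inclE !compm0 tens0r compm0.
Qed.

Section Tau.
Variable v : fusion_maps g M.
Notation tau := (shift_tau D v).

Lemma tau_homE m n k X Y : tau_hom v m n k X Y = interleave (v m n k) X Y.
Proof. by rewrite interleaveE. Qed.

Lemma tau_incl (m n k : 'I_M) W X Z Y (f : hom W X) (h : hom Z Y) :
  deg m W -> deg n Z -> is_add m n k ->
  tau X Y ∘ (incl m f ⊠ incl n h) = incl k (f ⊠ h) ∘ tau_hom v m n k W Z.
Proof.
move=> dW dZ mnk; rewrite /shift_tau comp_suml (bigD1 m) //= [X in _ + X]big1 ?addr0 => [|m' mm]; last first.
  rewrite comp_suml big1 // => n' _; rewrite comp_suml big1 // => k' _.
  by rewrite -compA -tensm_comp dproj_incl0 // tens0l compm0.
rewrite comp_suml (bigD1 n) //= [X in _ + X]big1 ?addr0 => [|n' nn]; last first.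
  rewrite comp_suml big1 // => k' _.
  by rewrite -compA -tensm_comp (dproj_incl0 h nn) tens0r compm0.
rewrite (big_pred1 k) => [|k']; last first.
  by rewrite /is_add; move: mnk => /eqP <-.
rewrite -[LHS]compA -tensm_comp !dproj_incl !tau_homE -[LHS]compA interleave_nat !inclE -!compA.
congr (_ ∘ _).
by rewrite compA -tens_compr -(compA (hproj _ _ _)) -tensm_comp !hproj_degK.
Qed.

End Tau.
End Shift.


(** * The shift functor is an equivalence *)

Lemma fully_faithful_equivalence (K : fieldType) (C E : linCategory K) (F : functor_data C E) :
  is_linear_functor F ->
  (forall X Y (f h : hom X Y), fmor F f = fmor F h -> f = h) ->
  (forall X Y (h : hom (F X) (F Y)), exists f, fmor F f = h) ->
  (forall Y, exists X, F X ≅ Y) ->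
  is_linear_equivalence F.
Proof.
move=> linF inj full es; split=> //; have [F1 Fc Fl] := linF.
have es' Y : exists N : {X : C & (hom (F X) Y * hom Y (F X))%type},
    inverse_of (projT2 N).1 (projT2 N).2.
  by have [X [f [f' ff']]] := es Y; exists (existT _ X (f, f')).
pose N Y := sval (cid (es' Y)); pose G0 Y := projT1 (N Y).
pose e Y : hom (F (G0 Y)) Y := (projT2 (N Y)).1.
pose e' Y : hom Y (F (G0 Y)) := (projT2 (N Y)).2.
have eP Y : inverse_of (e Y) (e' Y) := svalP (cid (es' Y)).
have e'e Y : e' Y ∘ e Y = idm _ by case: (eP Y).
have ee' Y : e Y ∘ e' Y = idm _ by case: (eP Y).
pose pre X Y (h : hom (F X) (F Y)) := sval (cid (full X Y h)).
have preP X Y (h : hom (F X) (F Y)) : fmor F (pre X Y h) = h := svalP (cid (full X Y h)).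
pose G := @FunctorData _ _ _ G0 (fun X Y (f : hom X Y) => pre _ _ (e' Y ∘ f ∘ e X)).
have FG X Y (f : hom X Y) : fmor F (fmor G f) = e' Y ∘ f ∘ e X by exact: preP.
have e_iso Y : is_iso (e Y) by exists (e' Y).
have e'_iso Y : is_iso (e' Y) by exists (e Y).
exists G; split; [split|split].
- by move=> X; apply: inj; rewrite FG F1 compm1.
- move=> X Y Z h f; apply: inj; rewrite Fc !FG -!compA; congr (_ ∘ (_ ∘ _)).
  by rewrite (compA (e Y)) ee' comp1m.
- move=> X Y a f h; apply: inj; rewrite Fl !FG.
  by rewrite compDr compZr compDl compZl.
- exists (fun X => pre _ _ (e' (F X))); split=> [X | X Y f].
    exists (pre _ _ (e (F X))).
    by split; apply: inj; rewrite Fc !preP F1.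
  by apply: inj; rewrite !Fc FG !preP -!compA ee' compm1.
exists e; split=> // X Y f.
by rewrite FG -compA (compA (e Y)) ee' comp1m.
Qed.

Section LinearFunctors.
Variables (K : fieldType) (C E : linCategory K) (F : functor_data C E).
Hypothesis linF : is_linear_functor F.
Variables X Y : C.

Lemma fmorD (f h : hom X Y) : fmor F (f + h) = fmor F f + fmor F h.
Proof. by case: linF => _ _ /(_ X Y 1 f h) /=; rewrite !scale1r. Qed.

Lemma fmor0 : fmor F (0 : hom X Y) = 0.
Proof. by apply: (addIr (fmor F 0)); rewrite -fmorD !add0r. Qed.

Lemma fmor_sum (I : Type) (r : seq I) (P : pred I) (f : I -> hom X Y) :
  fmor F (\sum_(i <- r | P i) f i) = \sum_(i <- r | P i) fmor F (f i).
Proof. exact: (big_morph _ fmorD fmor0). Qed.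

End LinearFunctors.

Lemma tpow_fusion (K : fieldType) (C : braidedFusionCategory K) (g : C) M (m n : nat) :
  tpow g M ≅ one -> (n < M)%N -> tpow g m ⊗ tpow g n ≅ tpow g ((m + n) %% M).
Proof.
case: M => // M' [phi phi_iso] nM.
by exists (@fuse _ C g M' phi m n ((m + n) %% M'.+1)); exact: fuse_iso.
Qed.

Section Equivalence.
Variables (K : fieldType) (C : modularCategory K) (g : C) (M : nat) (zeta q : K) (A : nat).
Hypothesis ig : invertible g.
Hypothesis q_def : braid g g = q *: idm (g ⊗ g).
Hypothesis zeta_prim : M.-primitive_root zeta.
Hypothesis zeta_q : zeta ^+ A = q ^+ 2.
Hypothesis A_coprime : coprime (A + 1) M.
Variable D : grading g M zeta.
Implicit Types X Y Z W : C.
Notation pw := (tpow g).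
Notation deg := (in_degree g zeta).
Notation F := (shift D).

Lemma deg_tpow n : deg (A * n) (pw n).
Proof. by apply/(in_degreeP ig); rewrite (monodromy_tpow ig q_def) -zeta_q exprM. Qed.

Lemma deg_shift m W : deg m W -> deg ((A + 1) * m) (pw m ⊗ W).
Proof. by move=> dW; rewrite mulnDl mul1n; apply: in_degree_tens dW => //; exact: deg_tpow. Qed.

Definition shift_degree (m : 'I_M) : 'I_M :=
  Ordinal (ltn_pmod ((A + 1) * m) (leq_ltn_trans (leq0n m) (ltn_ord m))).

Lemma shift_degree_inj : injective shift_degree.
Proof.
move=> m n /(congr1 val) /= e; apply: val_inj => /=.
wlog mn : m n e / (m <= n)%N.
  by move=> H; case/orP: (leq_total m n) => ?; [exact: H | apply/esym; exact: H].
apply/eqP; rewrite eqn_leq mn /= -subn_eq0.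
have : (M %| n - m)%N.
  rewrite -(@Gauss_dvdr _ (A + 1)) 1?coprime_sym // mulnBr -eqn_mod_dvd ?leq_mul //.
  by apply/eqP.
by rewrite /dvdn modn_small // (leq_ltn_trans (leq_subr _ _)).
Qed.

(** Tensoring the degree [m] part by [g ^ m] multiplies degrees by [A + 1]; as
    this is injective modulo [M], no new morphisms appear. *)
Lemma shift_hom0 (m n : 'I_M) W W' (f : hom (pw m ⊗ W) (pw n ⊗ W')) :
  deg m W -> deg n W' -> m != n -> f = 0.
Proof.
move=> dW dW' mn; apply: (@hom_degree0 _ _ _ _ _ ig zeta_prim (shift_degree m) (shift_degree n)).
- by apply: (in_degree_modn zeta_prim _ (deg_shift dW)); rewrite /= modn_mod.
- by apply: (in_degree_modn zeta_prim _ (deg_shift dW')); rewrite /= modn_mod.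
by rewrite (inj_eq shift_degree_inj).
Qed.

Lemma shift_faithful X Y (f h : hom X Y) : fmor F f = fmor F h -> f = h.
Proof.
move=> fh; apply: (direct_sum_ext (hcomp_sum D X)) => m.
have dm := hcomp_degree D X m.
apply: (tens_inj_l (invertible_tpow m ig)).
have := congr1 (fun u => shift_homogeneous D m Y ∘ (u ∘ incl D m (hinj D X m))) fh.
by rewrite /= !(shift_incl ig) // !(shift_homogeneous_incl ig).
Qed.

Lemma shift_full X Y (h : hom (F X) (F Y)) : exists f, fmor F f = h.
Proof.
have ex (m : 'I_M) : exists f : hom (hcomp D X m) (hcomp D Y m),
    dproj (shift_summand D Y) m ∘ h ∘ dinj (shift_summand D X) m = idm (pw m) ⊠ f.
  by apply: tens_full_l; exact: invertible_tpow.
have [f fP] := dep_choice ex.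
exists (\sum_(m < M) hinj D Y m ∘ f m ∘ hproj D X m).
apply: (direct_sum_ext (dsumP (shift_summand D X))) => m.
have dm := hcomp_degree D X m.
rewrite -(incl_hinj D) (shift_incl ig) // comp_suml.
have [piX pX0 _] := hcomp_sum D X.
rewrite (bigD1 m) //= big1 ?addr0 => [|n nm]; last by rewrite -compA pX0 ?compm0.
rewrite -compA piX compm1 incl_comp !incl_hinj.
have [pi p0 s1] := dsumP (shift_summand D Y).
have -> : h ∘ dinj (shift_summand D X) m = dinj (shift_summand D Y) m
    ∘ (dproj (shift_summand D Y) m ∘ h ∘ dinj (shift_summand D X) m).
  rewrite -[LHS]comp1m -s1 comp_suml (bigD1 m) //= big1 ?addr0 ?compA // => n nm.
  rewrite -!compA.
  rewrite (shift_hom0 (dproj _ n ∘ (h ∘ dinj _ m)) dm (hcomp_degree D Y n)) ?compm0 //.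
  by rewrite eq_sym.
by rewrite fP.
Qed.

(** An object of degree [n] comes from degree [m], where [(A + 1) m = n], after
    tensoring by an inverse of [g ^ m]. *)
Lemma shift_homogeneous_surj (n : 'I_M) Y : deg n Y ->
  exists (m : 'I_M) X, deg m X /\ pw m ⊗ X ≅ Y.
Proof.
move=> dY; pose m := invF shift_degree_inj n.
have mn : (A + 1) * m = n %[mod M].
  have /(congr1 val) /= := f_invF shift_degree_inj n.
  by rewrite -/m => ->; rewrite modn_small.
have [h [gh hg]] := invertible_tpow m ig.
have e : pw m ⊗ h ⊗ Y ≅ Y.
  apply: (@isomorphic_trans _ _ ((pw m ⊗ h) ⊗ Y)).
    by exists (alphai _ _ _); exact: iso_alphai.
  apply: (@isomorphic_trans _ _ (one ⊗ Y)).
    by apply: isomorphic_tens gh _; exact: isomorphic_refl.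
  by exists (lambda Y); exact: iso_lambda.
exists m, (h ⊗ Y); split=> //.
have /(in_degreeP ig) : deg n (pw m ⊗ h ⊗ Y).
  by apply: in_degree_iso dY; first exact: ig; exact: isomorphic_sym.
rewrite monodromy_tens (monodromy_tpow ig q_def) -zeta_q -exprM tensZl => e'.
apply/(in_degreeP ig); apply: (tens_inj_l (invertible_tpow m ig)).
apply: (scalerI (a := zeta ^+ (A * m))); first by rewrite expf_neq0 ?(zeta_neq0 zeta_prim).
rewrite e' tensZr tensm1 scalerA -exprD; congr (_ *: _); apply/eqP.
by rewrite (eq_prim_root_expr zeta_prim) -mn mulnDl mul1n.
Qed.

(** Additivity reduces this to homogeneous objects. *)
Lemma shift_surj Y : exists X, F X ≅ Y.
Proof.
have [m ex] := choice (fun n => shift_homogeneous_surj (hcomp_degree D Y n)).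
have [Xs XsP] := choice ex.
have dX n : deg (m n) (Xs n) by case: (XsP n).
have [f f_iso] := dep_choice (fun n => proj2 (XsP n)).
have [f' ff'_inv] := dep_choice f_iso.
have f'f n : f' n ∘ f n = idm _ by case: (ff'_inv n).
have ff' n : f n ∘ f' n = idm _ by case: (ff'_inv n).
have [F1 Fc _] := shift_linear ig zeta_prim D.
have [pi p0 s1] := dsumP Xs; have [piY pY0 sY] := hcomp_sum D Y.
have [s [i [is_id si_id]]] : exists (s : forall n, hom (F (Xs n)) (pw (m n) ⊗ Xs n))
    (i : forall n, hom (pw (m n) ⊗ Xs n) (F (Xs n))),
    (forall n, i n ∘ s n = idm _) /\ (forall n, s n ∘ i n = idm _).
  exists (fun n => shift_homogeneous D (m n) (Xs n)), (fun n => incl D (m n) (idm (Xs n))).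
  by split=> n; case: (shift_homogeneousK ig zeta_prim D (dX n)).
exists (dsum Xs).
exists (\sum_n hinj D Y n ∘ f n ∘ s n ∘ fmor F (dproj Xs n)).
exists (\sum_n fmor F (dinj Xs n) ∘ i n ∘ f' n ∘ hproj D Y n).
split.
  rewrite comp_suml; transitivity (\sum_n fmor F (dinj Xs n ∘ dproj Xs n)).
    apply: eq_bigr => n _; rewrite comp_sumr (sum_only (n := n)) => [|n' nn].
      rewrite Fc -!compA; congr (_ ∘ _).
      rewrite (compA (hproj _ _ _)) piY comp1m (compA (f' n)) f'f comp1m.
      by rewrite compA is_id comp1m.
    by rewrite -!compA (compA (hproj _ _ _)) pY0 1?eq_sym // comp0m !compm0.
  by rewrite -F1 -s1 (fmor_sum (shift_linear ig zeta_prim D)).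
rewrite comp_suml -sY; apply: eq_bigr => n _.
rewrite comp_sumr (sum_only (n := n)) => [|n' nn].
  rewrite -!compA; congr (_ ∘ _); rewrite (compA (fmor _ _)) -Fc pi F1 comp1m.
  by rewrite (compA (s n)) si_id comp1m compA ff' comp1m.
rewrite -!compA (compA (fmor _ _)) -Fc p0 1?eq_sym //.
by rewrite (fmor0 (shift_linear ig zeta_prim D)) comp0m !compm0.
Qed.

Lemma shift_equivalence : is_linear_equivalence F.
Proof.
apply: fully_faithful_equivalence.
- exact: (shift_linear ig zeta_prim).
- exact: shift_faithful.
- exact: shift_full.
exact: shift_surj.
Qed.

End Equivalence.


(** * The monoidal structure *)

Section Tau.
Variables (K : fieldType) (C : modularCategory K) (g : C) (M : nat) (zeta q : K).
Hypotheses (ig : invertible g) (order_g : has_order g M).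
Hypothesis zeta_prim : M.-primitive_root zeta.
Variable D : grading g M zeta.
Notation F := (shift D).
Variable v : fusion_maps g M.
Variable tau : tensor_structure F.
Hypothesis adm : admissible q v.
Implicit Types X Y Z W : C.
Notation pw := (tpow g).
Notation deg := (in_degree g zeta).

Definition add_deg (m n : 'I_M) : 'I_M :=
  Ordinal (ltn_pmod (m + n) (leq_ltn_trans (leq0n m) (ltn_ord m))).

Lemma add_degP m n : is_add m n (add_deg m n).
Proof. exact: eqxx. Qed.

Lemma v_iso (m n k : 'I_M) : is_add m n k -> is_iso (v m n k).
Proof.
move=> mnk; have [v0 _ _] := adm; have [_ gM _] := order_g.
apply: neq0_iso (v0 _ _ _ mnk).
  by apply: invertible_tens; exact: invertible_tpow.
by rewrite (eqP mnk); apply: tpow_fusion.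
Qed.

Lemma tau_hom_iso (m n k : 'I_M) X Y : is_add m n k -> is_iso (tau_hom v m n k X Y).
Proof. by move=> mnk; rewrite tau_homE; apply: interleave_iso; exact: v_iso. Qed.

Lemma deg_tens (m n k : 'I_M) X Y : is_add m n k -> deg m X -> deg n Y -> deg k (X ⊗ Y).
Proof.
move=> mnk dX dY; apply: (in_degree_modn zeta_prim _ (in_degree_tens ig dX dY)).
by rewrite (eqP mnk) modn_mod.
Qed.

(** The maps [tau] enter only through this equation, which [tau_incl] proves for
    [shift_tau]; abstracting from them keeps their defining sums folded. *)
Hypothesis tauI : forall (m n k : 'I_M) W X Z Y (f : hom W X) (h : hom Z Y),
  deg m W -> deg n Z -> is_add m n k ->
  tau X Y ∘ (incl D m f ⊠ incl D n h) = incl D k (f ⊠ h) ∘ tau_hom v m n k W Z.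

Lemma tau_nat X X' Y Y' (f : hom X X') (h : hom Y Y') :
  fmor F (f ⊠ h) ∘ tau X Y = tau X' Y' ∘ (fmor F f ⊠ fmor F h).
Proof.
apply: (shift_tens_ext (D := D)) => m n.
have dm := hcomp_degree D X m; have dn := hcomp_degree D Y n.
have mn := add_degP m n; have dmn := deg_tens mn dm dn.
rewrite -!compA -tensm_comp !(shift_incl ig) // !(tauI _ _ _ _ mn) //.
by rewrite compA (shift_incl ig) // -tensm_comp.
Qed.

Lemma tau_assoc X Y Z :
  fmor F (alpha X Y Z) ∘ tau (X ⊗ Y) Z ∘ (tau X Y ⊠ idm (F Z)) =
  tau X (Y ⊗ Z) ∘ (idm (F X) ⊠ tau Y Z) ∘ alpha (F X) (F Y) (F Z).
Proof.
apply: (shift_tens3_ext (D := D)) => m n p.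
pose f := hinj D X m; pose h := hinj D Y n; pose l := hinj D Z p.
have dm := hcomp_degree D X m; have dn := hcomp_degree D Y n.
have dp := hcomp_degree D Z p; rewrite -/f -/h -/l.
have mn := add_degP m n; have dmn := deg_tens mn dm dn.
have np := add_degP n p; have dnp := deg_tens np dn dp.
set mn0 := add_deg m n in mn dmn; set np0 := add_deg n p in np dnp.
have mnp := add_degP mn0 p; set k := add_deg mn0 p in mnp.
have mnp' : is_add m np0 k by rewrite /is_add /= modnDml modnDmr addnA.
rewrite -compA -tensm_comp comp1m (tauI _ _ _ _ mn) //.
rewrite -[in LHS](compm1 (incl D p l)) tensm_comp -compA (compA (tau _ _)) (tauI _ _ _ _ mnp) //.
rewrite -compA compA (shift_incl ig) ?alpha_nat //; last exact: deg_tens mnp dmn dp.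
rewrite -[RHS]compA alpha_nat [RHS]compA -[in RHS](compA (tau _ _)) -tensm_comp comp1m.
rewrite (tauI _ _ _ _ np) // -[in RHS](compm1 (incl D m f)) tensm_comp [in RHS](compA (tau _ _)).
rewrite (tauI _ _ _ _ mnp') // !tau_homE incl_comp -!compA; congr (_ ∘ _).
rewrite compA (@interleave_assoc _ _ _ _ _ _ _ _ _ _ _ _ _ (v n p np0) (v m np0 k)) -?compA //.
by case: adm => _ va _; rewrite (va _ _ _ _ np0) ?compA.
Qed.

(** The inverse is assembled from the inverses of [tau_hom] on components. *)
Lemma tau_iso X Y : is_iso (tau X Y).
Proof.
have [inv invP] := dep_choice (fun mn : 'I_M * 'I_M =>
  tau_hom_iso (hcomp D X mn.1) (hcomp D Y mn.2) (add_degP mn.1 mn.2)).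
have [s sE] : exists s : forall k : 'I_M, hom (F (X ⊗ Y)) (pw k ⊗ (X ⊗ Y)),
    forall k, s k = shift_homogeneous D k (X ⊗ Y) by exists (fun k => shift_homogeneous D k _).
exists (\sum_m \sum_n (incl D m (hinj D X m) ⊠ incl D n (hinj D Y n)) ∘ inv (m, n)
  ∘ (idm (pw (add_deg m n)) ⊠ (hproj D X m ⊠ hproj D Y n)) ∘ s (add_deg m n)).
have [piX p0X sX] := hcomp_sum D X; have [piY p0Y sY] := hcomp_sum D Y.
split.
  apply: (shift_tens_ext (D := D)) => m n; rewrite comp1m -compA.
  have dm := hcomp_degree D X m; have dn := hcomp_degree D Y n.
  have mn := add_degP m n; have dmn := deg_tens mn dm dn.
  rewrite (tauI _ _ _ _ mn) // comp_suml (sum_only (n := m)) => [|m' mm].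
    rewrite comp_suml (sum_only (n := n)) => [|n' nn].
      rewrite -!compA (compA (s _)) sE (shift_homogeneous_incl ig) //.
      rewrite (compA (_ ⊠ (hproj D _ _ ⊠ _))) -tensm_comp comp1m -tensm_comp piX piY !tensm1 comp1m.
      by case: (invP (m, n)) => -> _; rewrite compm1.
    rewrite -!compA (compA (s _)) sE (compA (_ ⊠ (hproj D _ _ ⊠ _))).
    rewrite (shift_homogeneous_incl_orth ig) ?comp0m ?compm0 //.
    by rewrite -tensm_comp p0Y // tens0r.
  rewrite comp_suml big1 // => n' _.
  rewrite -!compA (compA (s _)) sE (compA (_ ⊠ (hproj D _ _ ⊠ _))).
  rewrite (shift_homogeneous_incl_orth ig) ?comp0m ?compm0 //.
  by rewrite -tensm_comp p0X // tens0l.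
have [F1 _ _] := shift_linear ig zeta_prim D.
rewrite -F1 -[in RHS]tensm1 -sX -sY tens_suml (fmor_sum (shift_linear ig zeta_prim D)).
rewrite comp_sumr; apply: eq_bigr => m _.
rewrite tens_sumr (fmor_sum (shift_linear ig zeta_prim D)) comp_sumr; apply: eq_bigr => n _.
have mn := add_degP m n.
have dmn := deg_tens mn (hcomp_degree D X m) (hcomp_degree D Y n).
rewrite sE tensm_comp (shift_factor ig zeta_prim D _ _ dmn) !compA; congr (_ ∘ _ ∘ _).
rewrite (tauI _ _ (hcomp_degree D X m) (hcomp_degree D Y n) mn) -2!compA (compA _ (inv (m, n))).
by case: (invP (m, n)) => _ ->; rewrite comp1m.
Qed.

End Tau.


(** * The braiding condition *)

Lemma ev_neq0 (K : fieldType) (C : braidedFusionCategory K) (X : C) :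
  idm X <> 0 -> ev X <> 0.
Proof.
move=> X0 e; apply: X0; apply: (iso_epi (iso_lambda X)); rewrite comp0m comp1m.
by have [<- _] := dualP X; rewrite e tens0r compm0 !comp0m.
Qed.

Section Braided.
Variables (K : fieldType) (C : modularCategory K) (g : C) (M : nat) (zeta q : K).
Hypotheses (ig : invertible g) (order_g : has_order g M).
Hypothesis zeta_prim : M.-primitive_root zeta.
Variable D : grading g M zeta.
Notation F := (shift D).
Variable v : fusion_maps g M.
Hypothesis adm : admissible q v.
Implicit Types X Y Z W : C.
Notation pw := (tpow g).
Notation deg := (in_degree g zeta).
Notation tau := (shift_tau D v).

Let tauI := @tau_incl _ _ _ _ _ ig zeta_prim D v.

Lemma shift_components : shift_on_components D v.
Proof.
split=> [m X dX | m X Y f dX dY | m n k X Y dX dY mnk].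
- exists (incl D m (idm X)); exact: shift_homogeneousK.
- exact: shift_homogeneous_nat.
have i1 : is_iso (incl D m (idm X) ⊠ incl D n (idm Y)).
  by apply: iso_tens; apply: iso_sym; exact: shift_homogeneousK.
apply: (iso_epi i1); rewrite -compA (tauI _ _ dX dY mnk) -[RHS]compA -tensm_comp.
rewrite !(shift_homogeneous_incl ig) // !tensm1 compm1 compA.
rewrite shift_homogeneous_incl ?tensm1 ?comp1m //.
exact: (deg_tens ig zeta_prim mnk).
Qed.

Lemma shift_monoidal A : braid g g = q *: idm (g ⊗ g) ->
  zeta ^+ A = q ^+ 2 -> coprime (A + 1) M -> monoidal_autoequivalence tau.
Proof.
move=> q_def zq cop; split.
- exact: (shift_equivalence ig q_def zeta_prim zq cop).
- exact: (tau_iso ig order_g zeta_prim adm tauI).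
- exact: (tau_nat ig zeta_prim tauI).
exact: (tau_assoc ig zeta_prim adm tauI).
Qed.

(** The scalar is [q ^ (m n)] for the braiding of [g ^ m] with [g ^ n], times
    [zeta ^ (m n)] for the double braiding of [g ^ m] with [Y]. *)
Lemma tau_hom_braid (m n k : 'I_M) X Y : is_add m n k -> deg n Y ->
  tau_hom v n m k Y X ∘ braid (pw m ⊗ X) (pw n ⊗ Y) =
  (q * zeta) ^+ (m * n) *: ((idm (pw k) ⊠ braid X Y) ∘ tau_hom v m n k X Y).
Proof.
move=> mnk /(in_degreeP ig) dY; rewrite !tau_homE exprMn.
apply: interleave_braid; first by case: adm => _ _ ->.
have e := double_braid_tpow ig Y m.
rewrite (monodromy_pow_scale _ dY) tensZl tensm1 -exprM mulnC in e.
apply: (iso_epi (braid_iso Y (pw m))).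
by rewrite -compA e compZr compm1 compZl comp1m.
Qed.

Lemma shift_braided_if :
  (forall m n : 'I_M, (q * zeta) ^+ (m * n) = 1) -> braided_functor tau.
Proof.
move=> x1 X Y; apply: (shift_tens_ext (D := D)) => m n.
have dm := hcomp_degree D X m; have dn := hcomp_degree D Y n.
have mn := add_degP m n; have dmn := deg_tens ig zeta_prim mn dm dn.
have nm : is_add n m (add_deg m n) by rewrite /is_add /= addnC.
rewrite -compA (tauI _ _ dm dn mn) compA (shift_incl ig) // -[RHS]compA !braid_nat.
rewrite compA (tauI _ _ dn dm nm) incl_comp -[LHS]compA -[RHS]compA; congr (_ ∘ _).
by rewrite (tau_hom_braid _ mn) // x1 scale1r.
Qed.

(** By [tau_hom_braid], the braiding condition at an object [X] of degree [m] and its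
    dual, of degree [- m], forces [(q * zeta) ^+ (m * m) = 1], the tensor product of
    [X] with its dual being nonzero. *)
Lemma shift_braided_only_if : q ^+ M = 1 -> braided_functor tau -> q * zeta = 1.
Proof.
move=> qM br; have xM : (q * zeta) ^+ M = 1.
  by rewrite exprMn qM (prim_expr_order zeta_prim) mulr1.
apply: (degrees_generate ig order_g zeta_prim D xM) => m X dX X0.
have M0 : (0 < M)%N := leq_ltn_trans (leq0n m) (ltn_ord m).
pose n : 'I_M := Ordinal (ltn_pmod (M - m) M0).
have mn0 : m + n = 0 %[mod M] by rewrite /= modnDmr subnKC ?modnn ?mod0n // ltnW.
have dY := in_degree_dual ig zeta_prim mn0 dX.
suff e : (q * zeta) ^+ (m * n) = 1.
  have : (q * zeta) ^+ (m * m + m * n) = 1.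
    have d : (M %| m * m + m * n)%N by rewrite -mulnDr dvdn_mull // /dvdn mn0 mod0n.
    by rewrite -(divnK d) mulnC exprM xM expr1n.
  by rewrite exprD e mulr1.
have mn := add_degP m n; set k := add_deg m n in mn.
have nm : is_add n m k by rewrite /is_add /= addnC.
have dk := deg_tens ig zeta_prim nm dY dX.
have : fmor F (braid X (dual X)) ∘ tau X (dual X) ∘ (incl D m (idm X) ⊠ incl D n (idm (dual X)))
    = tau (dual X) X ∘ braid (F X) (F (dual X)) ∘ (incl D m (idm X) ⊠ incl D n (idm (dual X))).
  by rewrite br.
rewrite -compA (tauI _ _ dX dY mn) compA (shift_incl ig) //; last exact: deg_tens mn dX dY.
rewrite -(compA (tau _ _)) (braid_nat (incl D m _)) compA (tauI _ _ dY dX nm).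
rewrite -(compA (incl D k _)) (tau_hom_braid _ mn) // tensm1 compm1.
rewrite -(comp1m (braid X (dual X))) incl_comp comp1m -tensm1 -(compA (incl D k _)) compZr.
set T := _ ∘ (_ ∘ _) => TE; apply: (scale_fixed TE) => T0.
have i1 : is_iso (incl D k (idm (dual X) ⊠ idm X)).
  by rewrite tensm1; apply: iso_sym; apply: shift_homogeneousK.
have : (idm (pw k) ⊠ braid X (dual X)) ∘ tau_hom v m n k X (dual X) = 0.
  by apply: (iso_mono i1); rewrite -/T T0 compm0.
rewrite -(comp0m _ (tau_hom v m n k X (dual X))) => /(iso_epi (tau_hom_iso ig order_g adm _ _ mn)).
rewrite -(tens0r _ _ (idm (pw k))) => /(tens_inj_l (invertible_tpow k ig)) b0.
apply: (ev_neq0 X0); rewrite -(compm1 (ev X)).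
have [s [_ bs]] := braid_iso X (dual X).
by rewrite -bs b0 comp0m compm0.
Qed.

End Braided.


(** * Dual morphisms, left evaluations and dimensions *)

Section DualMorphisms.
Variables (K : fieldType) (C : braidedFusionCategory K).
Implicit Types X Y Z A B G H : C.

Lemma ev_dualm X Y (f : hom X Y) :
  ev X ∘ (dualm f ⊠ idm X) = ev Y ∘ (idm (dual Y) ⊠ f).
Proof. exact: ev_curry. Qed.

(** A zigzag identity recovers [a] from the pairing of its second factor with [X]. *)
Lemma coev_ext Z X Y (a b : hom Z (Y ⊗ dual X)) :
  (idm Y ⊠ ev X) ∘ alpha Y (dual X) X ∘ (a ⊠ idm X) =
  (idm Y ⊠ ev X) ∘ alpha Y (dual X) X ∘ (b ⊠ idm X) -> a = b.
Proof.
move=> ab; have [_ zig] := dualP X; strictify_eq ab ab'; strictify_eq zig zig'.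
strictify; strict_nat_of a a_nat; strict_nat_of b b_nat.
rewrite -[LHS]comp1m -[RHS]comp1m -tensm1 -(zig' W) !whiskE -!compA -a_nat -b_nat.
by crw ab'.
Qed.

Lemma coev_dualm X Y (f : hom X Y) :
  (f ⊠ idm (dual X)) ∘ coev X = (idm Y ⊠ dualm f) ∘ coev Y.
Proof.
apply: coev_ext; have e := ev_dualm f.
have [zX _] := dualP X; have [zY _] := dualP Y.
strictify_eq e e'; strictify_eq zX zX'; strictify_eq zY zY'; strictify.
strict_nat_of f f_nat; strict_nat_of (@coev _ C Y) c_nat.
crw e' under Y; rewrite -c_nat; crw zY'.
by crw <- f_nat; crw zX'; rewrite comp1m compm1.
Qed.

(** The inner pairing [r] is nested inside [p], as in the duality of a tensor product. *)
Definition nest A A' B B' (p : hom (A ⊗ A') one) (r : hom (B ⊗ B') one) :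
    hom ((A ⊗ B) ⊗ (B' ⊗ A')) one :=
  p ∘ (idm A ⊠ (lambda A' ∘ (r ⊠ idm A') ∘ alphai B B' A')) ∘ alpha A B (B' ⊗ A').

Definition conest A A' B B' (p : hom one (A ⊗ A')) (r : hom one (B ⊗ B')) :
    hom one ((A ⊗ B) ⊗ (B' ⊗ A')) :=
  alphai A B (B' ⊗ A') ∘ (idm A ⊠ (alpha B B' A' ∘ (r ⊠ idm A') ∘ lambdai A')) ∘ p.

Lemma ev_dual_tens A B :
  ev (A ⊗ B) ∘ (dual_tens A B ⊠ idm (A ⊗ B)) = nest (ev B) (ev A).
Proof. by rewrite ev_curry /nest !tens_compr -!compA. Qed.

Lemma coev_tens A B :
  coev (A ⊗ B) = (idm (A ⊗ B) ⊠ dual_tens A B) ∘ conest (coev A) (coev B).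
Proof.
apply: coev_ext.
have e := ev_dual_tens A B; rewrite /nest in e.
have [zA _] := dualP A; have [zB _] := dualP B; have [zAB _] := dualP (A ⊗ B).
strictify_eq e e'; strictify_eq zA zA'; strictify_eq zB zB'; strictify_eq zAB zAB'.
rewrite /conest; strictify.
rewrite zAB'.
crw e' under A B.
strict_nat_of (@coev _ C B) c_nat.
crw <- c_nat under A; crw zB' under A.
by rewrite comp1m; crw zA'.
Qed.

Lemma dual_neq0 X : idm X <> 0 -> idm (dual X) <> 0.
Proof.
move=> X0 e; apply: (ev_neq0 X0).
by rewrite -[LHS]compm1 -tensm1 e tens0l compm0.
Qed.

(** The hypothesis is a zigzag identity that exhibits [G] and [H] as dual to each
    other, up to inverting [w]. *)
Lemma coev_curry G H (w : hom (G ⊗ H) one) (w' : hom (H ⊗ G) one) :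
  lambda G ∘ (w ⊠ idm G) = rho G ∘ (idm G ⊠ w') ∘ alpha G H G ->
  idm G ⊠ curry_dual w' = coev G ∘ w.
Proof.
move=> ww; apply: coev_ext; have e := ev_curry w'; have [zG _] := dualP G.
strictify_eq ww ww'; strictify_eq e e'; strictify_eq zG zG'.
strictify; crw zG'; rewrite ww' comp1m.
by rewrite -tens_compr e'.
Qed.

End DualMorphisms.

Section LeftEv.
Variables (K : fieldType) (C : modularCategory K).
Implicit Types X Y Z A B : C.

(** The evaluation on the other side, obtained from the pivotal structure. *)
Definition left_ev X : hom (X ⊗ dual X) one := ev (dual X) ∘ (psi X ⊠ idm (dual X)).

Lemma left_ev_nat X Y (f : hom X Y) :
  left_ev Y ∘ (f ⊠ idm (dual Y)) = left_ev X ∘ (idm X ⊠ dualm f).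
Proof.
rewrite /left_ev -!compA -!tensm_comp psi_nat !comp1m !compm1.
transitivity (ev (dual Y) ∘ (dualm (dualm f) ⊠ idm (dual Y)) ∘ (psi X ⊠ idm (dual Y))).
  by rewrite -compA -tens_compl.
by rewrite ev_dualm -compA -tensm_comp comp1m compm1.
Qed.

(** This is where the monoidality of the pivotal structure enters. *)
Lemma left_ev_tens A B :
  left_ev (A ⊗ B) ∘ (idm (A ⊗ B) ⊠ dual_tens A B) = nest (left_ev A) (left_ev B).
Proof.
rewrite /left_ev -compA -tensm_comp compm1 comp1m.
transitivity (ev (dual (A ⊗ B)) ∘ (idm _ ⊠ dual_tens A B) ∘ (psi (A ⊗ B) ⊠ idm _)).
  by rewrite -compA -tensm_comp comp1m compm1.
rewrite -ev_dualm -compA -tens_compl psi_tens tens_compl compA ev_dual_tens.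
rewrite /nest; strictify; strict_nat_of (psi A) p_nat.
by crw <- p_nat.
Qed.

Lemma left_ev_neq0 X : idm X <> 0 -> left_ev X <> 0.
Proof.
move=> X0 e; apply: (ev_neq0 (dual_neq0 X0)).
apply: (iso_epi (iso_tens (psi_iso X) (iso_id (dual X)))).
by rewrite comp0m.
Qed.

Lemma has_dimE X d : has_dim X d = (left_ev X ∘ coev X = d *: idm one).
Proof. by []. Qed.

Lemma has_dim_exists X : exists d, has_dim X d.
Proof. exact: end_one_scalar. Qed.

Lemma has_dim_unique X d d' : has_dim X d -> has_dim X d' -> d = d'.
Proof.
rewrite /has_dim => -> /eqP; rewrite -subr_eq0 -scalerBl scaler_eq0 subr_eq0.
by case/orP => [/eqP // | /eqP /id_one_neq0].
Qed.

(** [left_ev] and [coev] are dinatural. *)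
Lemma has_dim_iso X Y d : X ≅ Y -> has_dim X d -> has_dim Y d.
Proof.
move=> [f [f' [f'f ff']]]; rewrite !has_dimE => <-.
have e := left_ev_nat f.
have c := coev_dualm f.
transitivity (left_ev Y ∘ (f ⊠ idm _) ∘ (f' ⊠ idm _) ∘ coev Y).
  by rewrite -(compA (left_ev Y)) -tens_compl ff' tensm1 compm1.
rewrite e -!compA (compA (idm X ⊠ _)) -tensm_comp comp1m compm1.
rewrite -[f' in LHS]compm1 -[dualm f in LHS]comp1m tensm_comp -compA -c compA -compA.
by rewrite (compA (f' ⊠ _)) -tens_compl f'f tensm1 comp1m.
Qed.

Lemma has_dim_tens A B a b : has_dim A a -> has_dim B b -> has_dim (A ⊗ B) (a * b).
Proof.
rewrite !has_dimE coev_tens compA left_ev_tens => ea eb.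
strictify_eq ea ea'; strictify_eq eb eb'; rewrite /nest /conest; strictify.
by crw eb' under A; rewrite tensZr tensm1 compZl comp1m compZr ea' scalerA mulrC.
Qed.

End LeftEv.


(** * The pivotality condition *)

Section PivotalPairing.
Variables (K : fieldType) (C : modularCategory K).
Variables (F : functor_data C C) (tau : tensor_structure F) (u : hom (F one) one).
Hypothesis linF : is_linear_functor F.
Hypothesis tau_nat : forall X X' Y Y' (f : hom X X') (h : hom Y Y'),
  fmor F (f ⊠ h) ∘ tau X Y = tau X' Y' ∘ (fmor F f ⊠ fmor F h).
Implicit Types X Y Z : C.

Definition image_pairing X : hom (F X ⊗ F (dual X)) one :=
  u ∘ fmor F (left_ev X) ∘ tau X (dual X).

Definition delta_pairing X : hom (F X ⊗ F (dual X)) one :=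
  left_ev (F X) ∘ (idm (F X) ⊠ delta tau u X).

Lemma tau_natl X X' Y (f : hom X X') :
  fmor F (f ⊠ idm Y) ∘ tau X Y = tau X' Y ∘ (fmor F f ⊠ idm (F Y)).
Proof. by case: linF => F1 _ _; rewrite tau_nat F1. Qed.

Lemma tau_natr X Y Y' (h : hom Y Y') :
  fmor F (idm X ⊠ h) ∘ tau X Y = tau X Y' ∘ (idm (F X) ⊠ fmor F h).
Proof. by case: linF => F1 _ _; rewrite tau_nat F1. Qed.

(** Pairing with [F (dual X)], the pivotality condition at [X] compares two left
    evaluations of [F X]: the image of that of [X], and that of the target
    transported along [delta]. *)
Lemma pivotalE X :
  delta tau u (dual X) ∘ fmor F (psi X) = dualm (delta tau u X) ∘ psi (F X) <->
  image_pairing X = delta_pairing X.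
Proof.
have [F1 Fc _] := linF.
have e1 : ev (F (dual X)) ∘ ((delta tau u (dual X) ∘ fmor F (psi X)) ⊠ idm _) =
    image_pairing X.
  rewrite tens_compl compA ev_curry -!compA -tau_natl !compA.
  by rewrite /image_pairing /left_ev Fc compA.
have e2 : ev (F (dual X)) ∘ ((dualm (delta tau u X) ∘ psi (F X)) ⊠ idm _) =
    delta_pairing X.
  rewrite tens_compl compA ev_dualm -compA -tensm_comp comp1m compm1.
  by rewrite /delta_pairing /left_ev -compA -tensm_comp comp1m compm1.
split=> [e|e]; first by rewrite -e1 e e2.
by apply: ev_inj; rewrite e1 e2.
Qed.

Lemma delta_nat X Y (f : hom X Y) :
  dualm (fmor F f) ∘ delta tau u Y = delta tau u X ∘ fmor F (dualm f).
Proof.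
have [F1 Fc _] := linF.
have eY : ev (F Y) ∘ (delta tau u Y ⊠ idm _) = _ := ev_curry _.
have eX : ev (F X) ∘ (delta tau u X ⊠ idm _) = _ := ev_curry _.
move: (delta tau u X) (delta tau u Y) eX eY => dX dY eX eY.
move: (dualm (fmor F f)) (ev_dualm (fmor F f)) => Ff eFf.
apply: ev_inj; rewrite [in LHS]tens_compl [in RHS]tens_compl !compA eFf eX.
rewrite -[LHS]compA -tensm_comp comp1m compm1.
transitivity (ev (F Y) ∘ (dY ⊠ idm _) ∘ (idm _ ⊠ fmor F f)).
  by rewrite -compA -tensm_comp comp1m compm1.
by rewrite eY -!compA -tau_natr -tau_natl !compA -!(compA u) -!Fc ev_dualm.
Qed.

Lemma image_pairing_nat X Y (f : hom X Y) :
  image_pairing Y ∘ (fmor F f ⊠ idm _) = image_pairing X ∘ (idm _ ⊠ fmor F (dualm f)).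
Proof.
have [F1 Fc _] := linF.
rewrite /image_pairing -!compA -tau_natr -tau_natl !compA -!(compA u) -!Fc.
by rewrite left_ev_nat.
Qed.

Lemma delta_pairing_nat X Y (f : hom X Y) :
  delta_pairing Y ∘ (fmor F f ⊠ idm _) = delta_pairing X ∘ (idm _ ⊠ fmor F (dualm f)).
Proof.
rewrite /delta_pairing -[RHS]compA -tens_compr -delta_nat -[LHS]compA -tensm_comp comp1m compm1.
transitivity (left_ev (F Y) ∘ (fmor F f ⊠ idm _) ∘ (idm _ ⊠ delta tau u Y)).
  by rewrite -compA -tensm_comp comp1m compm1.
by rewrite left_ev_nat -compA -tens_compr.
Qed.

(** Both pairings are dinatural, hence determined by the summands of [X]. *)
Lemma pairing_direct_sum n (Xs : 'I_n -> C) X (inj : forall i, hom (Xs i) X) proj :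
  is_direct_sum inj proj ->
  (forall i, image_pairing (Xs i) = delta_pairing (Xs i)) ->
  image_pairing X = delta_pairing X.
Proof.
move=> [_ _ s1] e; have [F1 Fc _] := linF.
rewrite -[LHS]compm1 -[RHS]compm1 -tensm1 -F1 -s1 (fmor_sum linF) tens_suml !comp_sumr.
apply: eq_bigr => i _; rewrite Fc tens_compl [LHS]compA [RHS]compA.
by rewrite image_pairing_nat delta_pairing_nat e.
Qed.

End PivotalPairing.

Section Slides.
Variables (K : fieldType) (C : modularCategory K).
Implicit Types X G H : C.

Lemma tens_split (X X' Y Y' : C) (f : hom X X') (h : hom Y Y') :
  f ⊠ h = (idm X' ⊠ h) ∘ (f ⊠ idm Y).
Proof. by rewrite -tensm_comp comp1m compm1. Qed.

Lemma tens_split' (X X' Y Y' : C) (f : hom X X') (h : hom Y Y') :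
  f ⊠ h = (f ⊠ idm Y') ∘ (idm X ⊠ h).
Proof. by rewrite -tensm_comp comp1m compm1. Qed.

Lemma interleaveZ (A B E X Y : C) c (w : hom (A ⊗ B) E) :
  interleave (c *: w) X Y = c *: interleave w X Y.
Proof. by rewrite !interleaveE tensZl !compZl. Qed.

Lemma interleave_lambda (B Y : C) c :
  (idm B ⊠ lambda Y) ∘ interleave (c *: lambda B) one Y =
  lambda (B ⊗ Y) ∘ ((c *: lambda one) ⊠ idm (B ⊗ Y)).
Proof. by rewrite interleaveZ tensZl !compZr; congr (_ *: _); rewrite interleaveE; strictify. Qed.

Lemma interleave_rho (A X : C) c :
  (idm A ⊠ rho X) ∘ interleave (c *: rho A) X one =
  rho (A ⊗ X) ∘ (idm (A ⊗ X) ⊠ (c *: lambda one)).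
Proof. by rewrite interleaveZ tensZr !compZr; congr (_ *: _); rewrite interleaveE; strictify. Qed.

(** Both sides pair [H] with [G] across the strand of [dual X]: the naturality of the
    braiding for [w], whose target is the unit, removes the crossings. *)
Lemma slide_dual G H X (w : hom (H ⊗ G) one) :
  lambda one ∘ (idm one ⊠ ev X) ∘ interleave w (dual X) X ∘ (braid (dual X) H ⊠ idm (G ⊗ X)) =
  nest (ev X) (ev G) ∘ ((idm (dual X) ⊠ curry_dual w) ⊠ idm (G ⊗ X)).
Proof.
have e := ev_curry w; have s := braid_nat (idm (dual X)) w.
strictify_eq e e'; strictify_eq s s'.
rewrite interleaveE /nest; strictify.
by crw <- s'; crw e' under (dual X).
Qed.

(** The pair [X ⊗ dual X] may be closed before or after the strand of [H] crosses
    it, by the naturality of the braiding for [left_ev X]. *)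
Lemma slide_left_ev G H X (w : hom (G ⊗ H) one) (k : hom H (dual G)) d :
  left_ev G ∘ (idm G ⊠ k) = d *: w ->
  nest (left_ev G) (left_ev X) ∘ (idm (G ⊗ X) ⊠ (idm (dual X) ⊠ k)) =
  d *: (lambda one ∘ (idm one ⊠ left_ev X) ∘ interleave w X (dual X)
          ∘ (idm (G ⊗ X) ⊠ braid (dual X) H)).
Proof.
move=> e; have s := braid_nat (left_ev X) (idm H).
strictify_eq e e'; strictify_eq s s'.
rewrite interleaveE /nest; strictify.
strict_nat_of w w_nat; strict_nat_of (left_ev X) l_nat.
crw l_nat under G; crw e'; rewrite compZl; congr (_ *: _).
by crw <- w_nat; crw <- s' under G.
Qed.

End Slides.

Section ShiftPivotal.
Variables (K : fieldType) (C : modularCategory K) (g : C) (M : nat) (zeta q : K).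
Hypotheses (ig : invertible g) (order_g : has_order g M).
Hypothesis zeta_prim : M.-primitive_root zeta.
Variable D : grading g M zeta.
Notation F := (shift D).
Variable v : fusion_maps g M.
Hypothesis adm : admissible q v.
Variable tau : tensor_structure F.
Implicit Types X Y Z W : C.
Notation pw := (tpow g).
Notation deg := (in_degree g zeta).
Hypothesis tauI : forall (m n k : 'I_M) W X Z Y (f : hom W X) (h : hom Z Y),
  deg m W -> deg n Z -> is_add m n k ->
  tau X Y ∘ (incl D m f ⊠ incl D n h) = incl D k (f ⊠ h) ∘ tau_hom v m n k W Z.

Let M0 : (0 < M)%N. Proof. exact: prim_order_gt0 zeta_prim. Qed.
Definition deg0 : 'I_M := Ordinal M0.

Lemma is_add0l m : is_add deg0 m m.
Proof. by rewrite /is_add /= add0n modn_small. Qed.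

Lemma is_add0r m : is_add m deg0 m.
Proof. by rewrite /is_add /= addn0 modn_small. Qed.

(** Each such component is a multiple of a unitor, hom spaces between powers of [g]
    being lines; associativity at triples with two zeros makes the scalars equal. *)
Lemma v_unit : exists2 c, c != 0 & forall m : 'I_M,
  v deg0 m m = c *: lambda (pw m) /\ v m deg0 m = c *: rho (pw m).
Proof.
have [v0 va _] := adm.
have exl (m : 'I_M) : exists c, v deg0 m m = c *: lambda (pw m).
  apply: hom_invertible (iso_lambda _).
  by apply: invertible_tens; [exact: invertible_one | exact: invertible_tpow].
have exr (m : 'I_M) : exists c, v m deg0 m = c *: rho (pw m).
  apply: hom_invertible (iso_rho _).
  by apply: invertible_tens; [exact: invertible_tpow | exact: invertible_one].
have [c ec] := exl deg0.
have c0 : c != 0.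
  by apply/eqP => c0; apply: (v0 deg0 deg0 deg0 (is_add0l _)); rewrite ec c0 scale0r.
have nz (m : 'I_M) W (f : hom W (pw m)) : is_iso f -> f <> 0.
  by move=> [f' [_ ff']] f0; apply: (invertible_id_neq0 (invertible_tpow m ig)); rewrite -ff' f0 comp0m.
exists c => // m; split.
  have [d ed] := exl m.
  have := va deg0 deg0 m deg0 m m (is_add0l _) (is_add0l _) (is_add0l _).
  rewrite ec ed tensZl tensZr !(compZl, compZr) !scalerA.
  have -> : (lambda (pw m) ∘ (idm (pw deg0) ⊠ lambda (pw m))
      ∘ alpha (pw deg0) (pw deg0) (pw m) : hom ((one ⊗ one) ⊗ pw m) (pw m)) =
      lambda (pw m) ∘ (lambda (pw deg0) ⊠ idm (pw m)).
    by cbn [tpow nat_of_ord deg0]; strictify.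
  move=> e; have <- : c = d.
    have d0 : d != 0.
      by apply/eqP => d0; apply: (v0 deg0 m m (is_add0l _)); rewrite ed d0 scale0r.
    apply: (mulIf d0); apply: (scale_cancel e); apply: nz.
    by apply: iso_comp (iso_lambda _) _; apply: iso_tens (iso_id _); exact: iso_lambda.
  by [].
have [d ed] := exr m; rewrite ed.
have := va m deg0 deg0 m deg0 m (is_add0r _) (is_add0l _) (is_add0r _).
rewrite ec ed tensZl tensZr !(compZl, compZr) !scalerA.
have -> : (rho (pw m) ∘ (idm (pw m) ⊠ lambda (pw deg0))
    ∘ alpha (pw m) (pw deg0) (pw deg0) : hom ((pw m ⊗ one) ⊗ one) (pw m)) =
    rho (pw m) ∘ (rho (pw m) ⊠ idm (pw deg0)).
  by cbn [tpow nat_of_ord deg0]; strictify.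
move=> e; have <- : d = c; last by [].
have d0 : d != 0.
  by apply/eqP => d0; apply: (v0 m deg0 m (is_add0r _)); rewrite ed d0 scale0r.
apply: (mulIf d0); apply: (scale_cancel e); apply: nz.
by apply: iso_comp (iso_rho _) _; apply: iso_tens (iso_id _); exact: iso_rho.
Qed.

Variable c : K.
Hypothesis c0 : c != 0.
Hypothesis v_lambda : forall m : 'I_M, v deg0 m m = c *: lambda (pw m).
Hypothesis v_rho : forall m : 'I_M, v m deg0 m = c *: rho (pw m).

(** By [v_unit], [tau] is compatible with the unitors for this identification of
    [shift D one], which has [g ^ 0 ⊗ one] for its only nonzero summand. *)
Definition unit_map : hom (F one) one :=
  c *: (lambda one ∘ shift_homogeneous D deg0 one).

Lemma deg_one : deg deg0 one.
Proof. exact: in_degree_one. Qed.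

Lemma unit_map_incl : unit_map ∘ incl D deg0 (idm one) = c *: lambda one.
Proof.
have d1 := deg_one.
by rewrite /unit_map compZl -compA (shift_homogeneous_incl ig) // tensm1 compm1.
Qed.

Lemma unit_map_iso : is_iso unit_map.
Proof.
apply: iso_scale => //; apply: iso_comp; first exact: iso_lambda.
by exists (incl D deg0 (idm one)); exact: (shift_homogeneousK ig zeta_prim D deg_one).
Qed.

Lemma shift_one_ext X Y (a b : hom (F one ⊗ F X) Y) :
  (forall m : 'I_M, a ∘ (incl D deg0 (idm one) ⊠ incl D m (hinj D X m)) =
                    b ∘ (incl D deg0 (idm one) ⊠ incl D m (hinj D X m))) -> a = b.
Proof.
move=> ab; apply: (shift_tens_ext (D := D)) => j m.
have [e|j0] := eqVneq deg0 j; last first.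
  rewrite -[hinj D one j]comp1m (hinj_deg0 ig zeta_prim D (idm one) deg_one j0).
  by rewrite inclE compm0 tens0r compm0 tens0l !compm0.
subst j; rewrite -[hinj D one deg0]comp1m incl_comp.
rewrite -[incl D m _]compm1 tensm_comp.
by rewrite [LHS]compA [RHS]compA ab.
Qed.

Lemma shift_one_extr X Y (a b : hom (F X ⊗ F one) Y) :
  (forall m : 'I_M, a ∘ (incl D m (hinj D X m) ⊠ incl D deg0 (idm one)) =
                    b ∘ (incl D m (hinj D X m) ⊠ incl D deg0 (idm one))) -> a = b.
Proof.
move=> ab; apply: (shift_tens_ext (D := D)) => m j.
have [e|j0] := eqVneq deg0 j; last first.
  rewrite -[hinj D one j]comp1m (hinj_deg0 ig zeta_prim D (idm one) deg_one j0).
  by rewrite [X in _ ⊠ X]inclE compm0 tens0r compm0 tens0r !compm0.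
subst j; rewrite -[hinj D one deg0]comp1m incl_comp.
rewrite -[incl D m _]compm1 tensm_comp.
by rewrite [LHS]compA [RHS]compA ab.
Qed.

Lemma unit_map_constraint : unit_constraint tau unit_map.
Proof.
have d1 := deg_one.
split; first exact: unit_map_iso.
- move=> X; apply: shift_one_ext => m; have dm := hcomp_degree D X m.
  have a0 := is_add0l m.
  rewrite -compA (tauI _ _ d1 dm a0) compA (shift_incl ig) //; last exact: (deg_tens ig zeta_prim a0).
  rewrite lambda_nat incl_comp -compA -[RHS]compA -tensm_comp comp1m unit_map_incl.
  rewrite tau_homE v_lambda interleave_lambda (tens_split _ (incl D m _)) compA.
  by rewrite lambda_nat compA.
move=> X; apply: shift_one_extr => m; have dm := hcomp_degree D X m.
have a0 := is_add0r m.
rewrite -compA (tauI _ _ dm d1 a0) compA (shift_incl ig) //; last exact: (deg_tens ig zeta_prim a0).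
rewrite rho_nat incl_comp -compA -[RHS]compA -tensm_comp comp1m unit_map_incl.
rewrite tau_homE v_rho interleave_rho (tens_split' (incl D m _)) compA.
by rewrite rho_nat compA.
Qed.

(** [shift D one] is invertible, so [u] is determined by its tensor product with it. *)
Lemma unit_map_unique u : unit_constraint tau u -> u = unit_map.
Proof.
move=> [ui ul _]; have [_ ml _] := unit_map_constraint.
have iF : invertible (F one).
  by apply: (invertible_iso _ (@invertible_one _ C)); apply: isomorphic_sym; exists u.
apply: (tens_inj iF); apply: (iso_mono (iso_lambda _)).
by rewrite -ul ml.
Qed.

Lemma tau_pairing (m n : 'I_M) Y Z (p : hom (Y ⊗ Z) one) :
  deg m Y -> deg n Z -> is_add m n deg0 ->
  unit_map ∘ fmor F p ∘ tau Y Z ∘ (incl D m (idm Y) ⊠ incl D n (idm Z)) =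
  lambda one ∘ (idm one ⊠ p) ∘ interleave (c *: v m n deg0) Y Z.
Proof.
move=> dY dZ mn; have d1 := deg_one.
rewrite -compA (tauI _ _ dY dZ mn) tensm1 -compA (compA (fmor F p)).
rewrite (shift_incl ig) //; last exact: (deg_tens ig zeta_prim mn).
rewrite compm1 -[p in incl _ _ p]comp1m incl_comp -!(compA (incl _ _ _)) compA unit_map_incl.
by rewrite compZl interleaveZ !compZr compA tau_homE.
Qed.

Section Homogeneous.
Variables (m n : 'I_M) (X : C) (d : K).
Hypotheses (dX : deg m X) (mn : is_add m n deg0).
Hypothesis dim_d : has_dim (pw m) d.

Let nm : is_add n m deg0. Proof. by rewrite /is_add addnC. Qed.

Let dY : deg n (dual X).
Proof. by apply: (in_degree_dual ig zeta_prim _ dX); rewrite mod0n -(eqP mn). Qed.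

Let w : hom (pw m ⊗ pw n) one := c *: v m n deg0.
Let w' : hom (pw n ⊗ pw m) one := c *: v n m deg0.
Let pair := lambda one ∘ (idm one ⊠ left_ev X) ∘ interleave w X (dual X).

Lemma v_mutual : lambda (pw m) ∘ (w ⊠ idm (pw m)) =
  rho (pw m) ∘ (idm (pw m) ⊠ w') ∘ alpha (pw m) (pw n) (pw m).
Proof.
have [_ va _] := adm.
have := va m n m deg0 deg0 m mn nm (is_add0l m).
by rewrite v_lambda v_rho /w /w' tensZl tensZr !(compZl, compZr).
Qed.

Lemma image_pairing_homogeneous :
  image_pairing tau unit_map X ∘ (incl D m (idm X) ⊠ incl D n (idm (dual X))) = pair.
Proof. exact: tau_pairing. Qed.

(** On homogeneous objects [delta] carries [g ^ n ⊗ dual X] to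
    [dual X ⊗ dual (g ^ m)] by moving [g ^ n] across [dual X] and identifying it with
    the dual of [g ^ m] by [w']; the crossing is written here on the other side of
    the equation. *)
Lemma delta_homogeneous :
  dualm (incl D m (idm X)) ∘ delta tau unit_map X ∘ incl D n (idm (dual X))
    ∘ braid (dual X) (pw n) =
  dual_tens (pw m) X ∘ (idm (dual X) ⊠ curry_dual w').
Proof.
have ej := ev_dualm (incl D m (idm X)).
have ed : ev (F X) ∘ (delta tau unit_map X ⊠ idm _) = _ := ev_curry _.
move: (dualm (incl D m (idm X))) (delta tau unit_map X) ej ed => j' dl ej ed.
apply: ev_inj; rewrite [in RHS]tens_compl [RHS]compA ev_dual_tens -slide_dual.
rewrite 3!tens_compl.
rewrite !compA ej; congr (_ ∘ _).
rewrite -(tau_pairing _ dY dX nm) -ed -!compA; congr (_ ∘ _).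
by rewrite -!tensm_comp !comp1m !compm1.
Qed.

(** Closing the strand of [g ^ m] contributes its dimension, by [coev_curry]. *)
Lemma delta_pairing_homogeneous :
  delta_pairing tau unit_map X ∘ (incl D m (idm X) ⊠ incl D n (idm (dual X))) = d *: pair.
Proof.
have dw : left_ev (pw m) ∘ (idm (pw m) ⊠ curry_dual w') = d *: w.
  have e := dim_d; rewrite has_dimE in e.
  by rewrite (coev_curry v_mutual) compA e compZl comp1m.
apply: (iso_epi (iso_tens (iso_id (pw m ⊗ X)) (braid_iso (dual X) (pw n)))).
rewrite compZl -(slide_left_ev X dw) -left_ev_tens -[RHS]compA -tens_compr.
rewrite -delta_homogeneous /delta_pairing.
have lj := left_ev_nat (incl D m (idm X)).
move: (delta tau unit_map X) (dualm (incl D m (idm X))) lj => dl j' lj.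
rewrite -(compA (left_ev _)) -[LHS]compA -2!tensm_comp !comp1m !compm1.
have -> : j' ∘ dl ∘ incl D n (idm (dual X)) ∘ braid (dual X) (pw n) =
    j' ∘ (dl ∘ incl D n (idm (dual X)) ∘ braid (dual X) (pw n)) by rewrite -!compA.
by rewrite tens_compr [RHS]compA -lj -[RHS]compA -tensm_comp comp1m compm1.
Qed.

Lemma pair_neq0 : idm X <> 0 -> pair <> 0.
Proof.
move=> X0 p0; apply: (left_ev_neq0 X0).
have wi : is_iso w by apply: iso_scale => //; exact: (v_iso ig order_g adm mn).
apply: tens1l_inj; apply: (iso_mono (iso_lambda one)).
apply: (iso_epi (interleave_iso X (dual X) wi)).
by rewrite -/pair p0 tens0r compm0 comp0m.
Qed.

Lemma incl_pair_iso : is_iso (incl D m (idm X) ⊠ incl D n (idm (dual X))).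
Proof. by apply: iso_tens; apply: iso_sym; exact: (shift_homogeneousK ig zeta_prim D). Qed.

Lemma pivotal_homogeneous_if : d = 1 ->
  image_pairing tau unit_map X = delta_pairing tau unit_map X.
Proof.
move=> d1; apply: (iso_epi incl_pair_iso).
by rewrite image_pairing_homogeneous delta_pairing_homogeneous d1 scale1r.
Qed.

Lemma pivotal_homogeneous_only_if : idm X <> 0 ->
  image_pairing tau unit_map X = delta_pairing tau unit_map X -> d = 1.
Proof.
move=> X0 e; apply: scale_fixed (pair_neq0 X0).
by rewrite -delta_pairing_homogeneous -e image_pairing_homogeneous.
Qed.

End Homogeneous.

Lemma has_dim_tpow d e k : has_dim g d -> has_dim (one : C) e -> has_dim (pw k) (d ^+ k * e).
Proof.
move=> dg d1; elim: k => [|k IH] /=; first by rewrite expr0 mul1r.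
by rewrite exprS -mulrA; exact: has_dim_tens.
Qed.

Lemma opp_degP (m : 'I_M) : exists n : 'I_M, is_add m n deg0.
Proof.
exists (Ordinal (ltn_pmod (M - m) M0)).
by rewrite /is_add /= modnDmr subnKC ?modnn // ltnW.
Qed.

Lemma shift_linF : is_linear_functor F. Proof. exact: (shift_linear ig zeta_prim). Qed.

Lemma shift_tau_nat X X' Y Y' (f : hom X X') (h : hom Y Y') :
  fmor F (f ⊠ h) ∘ tau X Y = tau X' Y' ∘ (fmor F f ⊠ fmor F h).
Proof. exact: (tau_nat ig zeta_prim tauI). Qed.

(** On an object of degree [m] the pivotality condition says that [g ^ m] has
    dimension 1, by the two lemmas on homogeneous objects. *)
Lemma shift_pivotal : pivotal_functor tau <-> has_dim g 1.
Proof.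
have [e de] := has_dim_exists (one : C).
split=> [[u [uc piv]] | dg].
  rewrite (unit_map_unique uc) in piv.
  have pairs X : image_pairing tau unit_map X = delta_pairing tau unit_map X.
    by apply/(pivotalE unit_map shift_linF shift_tau_nat); exact: piv.
  have [d dg] := has_dim_exists g.
  have dim1 (m : 'I_M) X : deg m X -> idm X <> 0 -> d ^+ m * e = 1.
    move=> dX X0; have [n mn] := opp_degP m.
    exact: (pivotal_homogeneous_only_if dX mn (has_dim_tpow m dg de) X0 (pairs X)).
  have e1 : e = 1 by have := dim1 _ _ deg_one (@id_one_neq0 _ C); rewrite expr0 mul1r.
  suff d1 : d = 1 by rewrite -d1.
  have [_ gM _] := order_g.
  apply: (degrees_generate ig order_g zeta_prim D) => [|m X dX X0].
    have := has_dim_tpow M dg de; rewrite e1 mulr1 => dM.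
    by apply: (has_dim_unique (has_dim_iso gM dM)); rewrite -e1.
  by have := dim1 m X dX X0; rewrite e1 mulr1 exprM => ->; rewrite expr1n.
have e1 : e = 1.
  have g1 : g ⊗ one ≅ g by exists (rho g); exact: iso_rho.
  have := has_dim_unique (has_dim_iso g1 (has_dim_tens dg de)) dg.
  by rewrite mul1r.
exists unit_map; split; first exact: unit_map_constraint.
move=> X; apply/(pivotalE unit_map shift_linF shift_tau_nat).
apply: (pairing_direct_sum shift_linF shift_tau_nat (hcomp_sum D X)) => m.
have [n mn] := opp_degP m.
apply: (pivotal_homogeneous_if (hcomp_degree D X m) mn (has_dim_tpow m dg de)).
by rewrite expr1n mul1r.
Qed.

End ShiftPivotal.


Import Num.Theory.
Local Open Scope complex_scope.


(** * Roots of unity and the theorem *)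

(** Here [zeta ^+ (A + 2) = (q * zeta) ^+ 2 = 1] for [A = M / r], so that [M] divides
    [A + 2]; as [A] divides [M], it divides 2. *)
Lemma order_le4 (K : fieldType) (q zeta : K) (M r : nat) :
  M.-primitive_root zeta -> r.-primitive_root (q ^+ 2) ->
  zeta ^+ (M %/ r) = q ^+ 2 -> q * zeta = 1 ->
  [\/ M = 1%N, M = 2%N, M = 3%N | M = 4%N].
Proof.
move=> zM rq zq qz; have M0 := prim_order_gt0 zM.
have rM : (r %| M)%N.
  by rewrite (prim_order_dvd rq) -zq -exprM mulnC exprM (prim_expr_order zM) expr1n.
have d : (M %| M %/ r + 2)%N.
  by rewrite (prim_order_dvd zM) exprD zq -exprMn qz expr1n.
have A2 : (M %/ r <= 2)%N.
  apply: dvdn_leq => //.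
  by rewrite -(dvdn_addr _ (dvdnn (M %/ r))); apply: dvdn_trans d; exact: dvdn_div.
have M4 : (M <= 4)%N by apply: leq_trans (dvdn_leq _ d) _; rewrite ?addn2 // leq_add2r.
by move: M4 M0; case: (M) => [//|[|[|[|[|]]]]] // _ _;
  [constructor 1|constructor 2|constructor 3|constructor 4].
Qed.

Section Roots.
Variable R : realType.

(** The triple angle formula at a third of a full turn leaves [cos x = 1], excluded by
    the sign of the sine, or [cos x = - 1/2]. *)
Lemma cos_2pi3 : cos (2 * pi / 3) = - 2^-1 :> R.
Proof.
set x := 2 * pi / 3 : R.
have x3 : x + x + x = pi *+ 2 by rewrite /x mulr2n; field.
have s0 : 0 < sin x.
  apply: sin_gt0_pi; have := pi_gt0 R; rewrite /x => ?; apply/andP; split; lra.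
have cs := cos2Dsin2 x.
have : cos (x + x + x) = 1 by rewrite x3 cos2pi.
rewrite cosD cosD sinD => e.
have {e} : (cos x - 1) * (2 * cos x + 1) ^+ 2 = 0.
  have ss : sin x * sin x = 1 - cos x * cos x by rewrite -!expr2; lra.
  transitivity ((cos x * cos x - sin x * sin x) * cos x - 2 * cos x * (sin x * sin x) - 1).
    by rewrite ss; ring.
  by rewrite -[X in _ - X]e; ring.
move/eqP; rewrite mulf_eq0 sqrf_eq0 => /orP[] /eqP c1.
  have c1' : cos x = 1 by lra.
  move: cs; rewrite c1' => cs; have : sin x ^+ 2 = 0 by lra.
  by move/eqP; rewrite sqrf_eq0 (negPf (lt0r_neq0 s0)).
by lra.
Qed.

Let omega : R[i] := cos (2 * pi / 3) +i* sin (2 * pi / 3).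
Let omega' : R[i] := cos (2 * pi / 3) -i* sin (2 * pi / 3).

Lemma omegaM : omega * omega' = 1.
Proof.
apply/eqP; rewrite eq_complex /omega /omega' /=; apply/andP; split; apply/eqP.
  by rewrite -[RHS](cos2Dsin2 (2 * pi / 3)); ring.
by ring.
Qed.

Lemma omegaD : omega + omega' = -1.
Proof.
apply/eqP; rewrite eq_complex /omega /omega' /=; apply/andP; split; apply/eqP.
  by rewrite cos_2pi3; field.
by ring.
Qed.

Lemma inv_pair (K : fieldType) (a b q z : K) :
  a * b = 1 -> q * z = 1 -> z = a \/ z = b -> q = b /\ z = a \/ q = a /\ z = b.
Proof.
move=> ab qz [] ez; [left | right]; split=> //; subst z.
  by rewrite -[q]mulr1 -ab mulrA qz mul1r.
by rewrite -[q]mulr1 -ab [a * b]mulrC mulrA qz mul1r.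
Qed.

Lemma prim_root3 (z : R[i]) : 3.-primitive_root z -> z = omega \/ z = omega'.
Proof.
move=> z3; have e : (z - omega) * (z - omega') = 0.
  have -> : (z - omega) * (z - omega') = z ^+ 2 - (omega + omega') * z + omega * omega' by ring.
  rewrite omegaM omegaD.
  have z1 : z - 1 != 0.
    by rewrite subr_eq0 -[z]expr1 -(prim_order_dvd z3).
  apply: (mulfI z1); rewrite mulr0.
  have -> : (z - 1) * (z ^+ 2 - -1 * z + 1) = z ^+ 3 - 1 by ring.
  by rewrite (prim_expr_order z3) subrr.
by move/eqP: e; rewrite mulf_eq0 !subr_eq0 => /orP[] /eqP; [left | right].
Qed.

Lemma prim_root4 (z : R[i]) : 4.-primitive_root z -> z = 0 +i* 1 \/ z = - (0 +i* 1).
Proof.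
move=> z4; have z2 : z ^+ 2 = -1.
  have z21 : z ^+ 2 - 1 != 0 by rewrite subr_eq0 -(prim_order_dvd z4).
  apply/eqP; rewrite -subr_eq0 opprK; apply/eqP; apply: (mulfI z21); rewrite mulr0.
  have -> : (z ^+ 2 - 1) * (z ^+ 2 + 1) = z ^+ 4 - 1 by ring.
  by rewrite (prim_expr_order z4) subrr.
have i2 : (0 +i* 1 : R[i]) ^+ 2 = -1.
  by rewrite expr2; apply/eqP; rewrite eq_complex /=; apply/andP; split; apply/eqP; ring.
have : z ^+ 2 == (0 +i* 1) ^+ 2 by rewrite z2 i2.
by rewrite eqf_sqr => /orP[] /eqP; [left | right].
Qed.

End Roots.

Theorem theorem1p1 (R : realType) (C : modularCategory R[i]) (g : C)
  (M : nat) (q : R[i]) (r : nat) (zeta : R[i])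
  (g_inv : invertible g) (g_order : has_order g M)
  (q_def : braid g g = q *: idm (g ⊗ g))
  (r_def : r.-primitive_root (q ^+ 2))
  (zeta_prim : M.-primitive_root zeta)
  (zeta_q : zeta ^+ (M %/ r) = q ^+ 2)
  (A_coprime : coprime (M %/ r + 1) M) :
  inhabited (grading g M zeta) /\
  (exists v : fusion_maps g M, admissible q v) /\
  forall (D : grading g M zeta) (v : fusion_maps g M), admissible q v ->
    let tau := shift_tau D v in
    let i : R[i] := 0 +i* 1 in
    let omega : R[i] := cos (2 * pi / 3) +i* sin (2 * pi / 3) in
    let omega' : R[i] := cos (2 * pi / 3) -i* sin (2 * pi / 3) in
    [/\ monoidal_autoequivalence tau /\ shift_on_components D v,
        braided_functor tau <->
          [\/ [/\ M = 1%N, q = 1 & zeta = 1],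
              [/\ M = 2%N, q = -1 & zeta = -1],
              M = 3%N /\ (q = omega /\ zeta = omega' \/
                          q = omega' /\ zeta = omega)
            | M = 4%N /\ (q = i /\ zeta = - i \/ q = - i /\ zeta = i)]
      & pivotal_functor tau <-> has_dim g 1].
Proof.
have M0 := prim_order_gt0 zeta_prim.
have gM : tpow g M ≅ one by case: g_order.
have qM : q ^+ M = 1.
  exact: (root_order zeta_prim r_def zeta_q A_coprime (quad_order g_inv q_def gM)).
split; first by apply: grading_exists; rewrite // pnatr_eq0 -lt0n.
split; first exact: admissible_exists.
move=> D v adm tau i omega omega'.
have br : braided_functor tau <-> M = 1%N \/ q * zeta = 1.
  split=> [br | M1qz].
    by right; exact: (shift_braided_only_if g_inv g_order zeta_prim adm qM br).
  apply: (shift_braided_if g_inv zeta_prim D adm) => m n.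
  case: M1qz => [M1 | ->]; last by rewrite expr1n.
  by have -> : nat_of_ord m = 0%N by case: m => m /=; rewrite {1}M1 ltnS leqn0 => /eqP.
have ii : i * - i = 1.
  by apply/eqP; rewrite eq_complex /=; apply/andP; split; apply/eqP; ring.
have ww : omega * omega' = 1 := omegaM R.
split.
- split; last exact: shift_components.
  exact: (shift_monoidal g_inv g_order zeta_prim D adm q_def zeta_q A_coprime).
- rewrite br; split=> [M1qz | ]; last first.
    case=> [[-> _ _] | [_ -> ->] | [_ []] [-> ->] | [_ []] [-> ->]]; [by left | right ..].
    + by rewrite mulrNN mulr1.
    + exact: ww.
    + by rewrite mulrC.
    + exact: ii.
    + by rewrite mulrC.
  have [M1 | qz] := M1qz.
    constructor 1; split=> //; first by rewrite -(expr1 q) -M1.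
    by rewrite -(expr1 zeta) -M1 (prim_expr_order zeta_prim).
  have zr := zeta_prim.
  have [eM|eM|eM|eM] := order_le4 zeta_prim r_def zeta_q qz; rewrite eM in zr.
  + constructor 1; split=> //; first by rewrite -(expr1 q) -eM.
    by rewrite -(expr1 zeta) (prim_expr_order zr).
  + constructor 2; have zN : zeta = -1.
      apply/eqP; rewrite -subr_eq0 opprK.
      have z1 : zeta - 1 != 0 by rewrite subr_eq0 -[zeta]expr1 -(prim_order_dvd zr).
      rewrite -(inj_eq (mulfI z1)) mulr0.
      have -> : (zeta - 1) * (zeta + 1) = zeta ^+ 2 - 1 by ring.
      by rewrite (prim_expr_order zr) subrr.
    by split=> //; move: qz; rewrite zN mulrN1 => /eqP; rewrite eqr_oppLR => /eqP.
  + constructor 3; split=> //.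
    have [[? ?]|[? ?]] := inv_pair ww qz (prim_root3 zr); [right | left]; by [].
  constructor 4; split=> //.
  have [[? ?]|[? ?]] := inv_pair ii qz (prim_root4 zr); [right | left]; by [].
have [c c0 vc] := v_unit g_inv zeta_prim adm.
apply: (shift_pivotal g_inv g_order adm _ c0).
- by move=> *; exact: tau_incl.
- by move=> m; case: (vc m).
by move=> m; case: (vc m).
Qed.
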